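(* Suppose the dilation matrix is $M=\lambda_0\,\mathrm{Id}$ with $\lambda_0>1$, and let $s>0$. Let $x\in\mathbb{R}^n$ and let $f$ be a bounded function on $\mathbb{R}^n$. Then the following are equivalent: (i) $f\in C^s(x)$; (ii) there is a constant $C$ such that $|f(y)-S_lf(y)|\le C(\lambda_0^{-l}+|x-y|)^s$ for all integers $l\ge0$ and (almost) all $y\in\mathbb{R}^n$.
   Context: $M=\lambda_0\,\mathrm{Id}$ is an integer matrix on $\mathbb{R}^n$. $T\subset\mathbb{R}^n$ is a compact set (self-affine tile) such that $\bigcup_{\nu\in\mathbb{Z}^n}(T+\nu)=\mathbb{R}^n$ and $\bigcup_{\gamma\in\Gamma_0}(T+\gamma)=MT$, both unions disjoint up to null sets, where $\Gamma_0\subset\mathbb{Z}^n$ is a complete set of representatives of $\mathbb{Z}^n/M\mathbb{Z}^n$. $Q_0$ is a translate of $T$ containing the origin as an interior point, and $Q_l(x)=M^{-l}Q_0+x$. $\mathbb{P}^k$ is the space of polynomials of degree at most $k$, and $\mathrm{osc}^k_\infty f(x,l)=\inf_{P\in\mathbb{P}^k}\|f-P\|_{L^\infty(Q_l(x))}$. For $s>0$ and a nonnegative integer $k$ with $k+1>s$, $f\in C^s(x)$ (also written $T^s_{\infty\infty}(x)$) means $\sup_{l\ge0}\lambda_0^{ls}\,\mathrm{osc}^k_\infty f(x,l)<\infty$. Littlewood–Paley operators: $\varphi\in\mathcal{S}(\mathbb{R}^n)$ is a fixed Schwartz function with $\mathrm{supp}\,\hat\varphi\subset\{|\xi|\le1\}$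 and $\hat\varphi(\xi)=1$ for $|\xi|\le\lambda_0^{-1}$; $\varphi_l(x)=\lambda_0^{ln}\varphi(\lambda_0^lx)$ and $S_lf=f*\varphi_l$, $l=0,1,2,\dots$. *)

(* Defs.v *)
(* R^n is 'rV[R]_n over an arbitrary R : realType, with the library topology.
   The functions f and phi and the coefficients of polynomials are complex. *)
From HB Require Import structures.
From mathcomp Require Import all_boot all_order all_algebra.
(* the notations of mpoly clash with those of analysis; so do some of its names, hence
   the order of the imports *)
From mathcomp Require Import -(notations) mpoly.
From mathcomp Require Import all_classical all_reals all_analysis.
From mathcomp Require Import ess_sup_inf complex.
Set Implicit Arguments.
Unset Strict Implicit.
Unset Printing Implicit Defensive.
Import Order.TTheory GRing.Theory Num.Theory numFieldNormedType.Exports.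
Local Open Scope classical_set_scope.
Local Open Scope ring_scope.

(* 'rV[R]_n carries the sigma-algebra generated by the coordinates, that is,
   the Borel sigma-algebra of R^n. *)
Section measurable_rV.
Variables (R : realType) (n : nat).

Let coord : 'I_n -> 'rV[R]_n -> R := fun i x => x ord0 i.

Let rV_set0 : g_sigma_preimage coord set0.
Proof. exact: sigma_algebra0. Qed.

Let rV_setC A : g_sigma_preimage coord A -> g_sigma_preimage coord (~` A).
Proof. exact: sigma_algebraC. Qed.

Let rV_bigcup (F : (set 'rV[R]_n)^nat) :
  (forall i, g_sigma_preimage coord (F i)) ->
  g_sigma_preimage coord (\bigcup_i F i).
Proof. exact: sigma_algebra_bigcup. Qed.

Fact rV_display : measure_display.
Proof. exact: default_measure_display. Qed.

HB.instance Definition _ := @isMeasurable.Build rV_display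
  'rV[R]_n (g_sigma_preimage coord) rV_set0 rV_setC rV_bigcup.

End measurable_rV.

Section lebesgue_rV.
Variable R : realType.

Definition rV_cons n (p : R * 'rV[R]_n) : 'rV[R]_n.+1 :=
  row_mx (const_mx p.1 : 'rV[R]_1) p.2.

Lemma rV_cons0 n (p : R * 'rV[R]_n) : rV_cons p ord0 ord0 = p.1.
Proof. by rewrite mxE; case: splitP => // j _; rewrite mxE. Qed.

Lemma rV_consS n (p : R * 'rV[R]_n) (i : 'I_n) :
  rV_cons p ord0 (lift ord0 i) = p.2 ord0 i.
Proof.
rewrite mxE; case: splitP => [j|k] /=; first by rewrite ord1.
by rewrite /bump/= !add1n => -[ik]; congr (p.2 ord0 _); exact/val_inj.
Qed.

Lemma measurable_coord n (i : 'I_n) :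
  measurable_fun [set: 'rV[R]_n] (fun v : 'rV[R]_n => v ord0 i).
Proof.
move=> _ Y mY; rewrite setTI; apply: sub_sigma_algebra => /=.
rewrite -bigcup_seq/=; exists i => /=; first by rewrite mem_index_enum.
by exists Y => //; rewrite setTI.
Qed.

Lemma measurable_fun_rVP d (T : measurableType d) n (f : T -> 'rV[R]_n) :
  measurable_fun [set: T] f <->
  forall i, measurable_fun [set: T] (fun t => f t ord0 i).
Proof.
split=> [mf i|mf].
  by apply: (measurableT_comp (measurable_coord i)).
suff : g_sigma_preimage (fun i (v : 'rV[R]_n) => v ord0 i) `<=`
    [set B | measurable (f @^-1` B)].
  by move=> sub _ B mB; rewrite setTI; exact: sub.
apply: smallest_sub; first split => /=.
- by rewrite preimage_set0.
- by move=> A mA; rewrite setTD preimage_setC; exact: measurableC.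
- by move=> F mF; rewrite preimage_bigcup; exact: bigcup_measurable.
case: n => [|n] in f mf *; first by rewrite big_ord0.
rewrite -bigcup_mkord_ord; apply: bigcup_sub => i Ii A [B mB <-] /=.
by rewrite setTI -comp_preimage -[X in measurable X]setTI; exact: mf.
Qed.

Lemma measurable_rV_cons n : measurable_fun setT (@rV_cons n).
Proof.
apply/measurable_fun_rVP => i; have [j ->|->] := unliftP ord0 i.
  under eq_fun do rewrite rV_consS.
  exact: (measurableT_comp (measurable_coord j) measurable_snd).
by under eq_fun do rewrite rV_cons0; exact: measurable_fst.
Qed.

Lemma sigma_finite_rV_cons n (m : {sigma_finite_measure set 'rV[R]_n -> \bar R}) :
  sigma_finite [set: 'rV[R]_n.+1]
    (pushforward (@lebesgue_measure R \x m)%E (@rV_cons n)).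
Proof.
have /sigma_finiteP[F [TF ndF Foo]] := sigma_finiteT (@lebesgue_measure R).
have /sigma_finiteP[G [TG ndG Goo]] := sigma_finiteT m.
pose g (v : 'rV[R]_n.+1) := (v ord0 ord0, \row_i v ord0 (lift ord0 i)).
have mg : measurable_fun setT g.
  apply/measurable_fun_pairP; split; first exact: measurable_coord.
  apply/measurable_fun_rVP => i; rewrite /comp /=.
  by under eq_fun do rewrite mxE; exact: measurable_coord.
have gK : cancel (@rV_cons n) g.
  move=> [a v]; rewrite /g rV_cons0 /=; congr pair.
  by apply/rowP => i; rewrite mxE rV_consS.
exists (fun i => g @^-1` (F i `*` G i)) => [|i].
  rewrite -preimage_bigcup (_ : \bigcup_i _ = setT) ?preimage_setT//.
  rewrite -subTset => -[x y] _.
  have [i _ Fix] : (\bigcup_i F i) x by rewrite -TF.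
  have [j _ Gjy] : (\bigcup_i G i) y by rewrite -TG.
  exists (maxn i j) => //; split => /=.
    by move: x Fix; exact/subsetPset/ndF/leq_maxl.
  by move: y Gjy; exact/subsetPset/ndG/leq_maxr.
have [mFi Fioo] := Foo i; have [mGi Gioo] := Goo i; split.
  by rewrite -[X in measurable X]setTI; apply: mg => //; exact: measurableX.
rewrite /pushforward -comp_preimage (_ : g \o _ = id); last first.
  by apply/funext => p; exact: gK.
by rewrite preimage_id product_measure1E// lte_mul_pinfty// ge0_fin_numE.
Qed.

Definition lebesgue_rV_succ n (m : {sigma_finite_measure set 'rV[R]_n -> \bar R}) :
  set 'rV[R]_n.+1 -> \bar R :=
  pushforward (@lebesgue_measure R \x m)%E (@rV_cons n).

Let push n (m : {sigma_finite_measure set 'rV[R]_n -> \bar R}) :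
    {measure set 'rV[R]_n.+1 -> \bar R} :=
  measure_function_pushforward__canonical__measure_function_Measure
    (@lebesgue_measure R \x m)%E (@measurable_rV_cons n).

HB.instance Definition _ n (m : {sigma_finite_measure set 'rV[R]_n -> \bar R}) :=
  isMeasure.Build _ _ _ (lebesgue_rV_succ m) (measure0 (push m))
    (measure_ge0 (push m)) (@measure_semi_sigma_additive _ _ _ (push m)).

HB.instance Definition _ n (m : {sigma_finite_measure set 'rV[R]_n -> \bar R}) :=
  Measure_isSigmaFinite.Build _ _ _ (lebesgue_rV_succ m) (sigma_finite_rV_cons m).

(* Lebesgue measure on R^n: the n-fold product of lebesgue_measure *)
Fixpoint lebesgue_rV n : {sigma_finite_measure set 'rV[R]_n -> \bar R} :=
  match n with
  | 0 => [the {sigma_finite_measure set 'rV[R]_0 -> \bar R} of \d_(0 : 'rV[R]_0)]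
  | m.+1 => [the {sigma_finite_measure set 'rV[R]_m.+1 -> \bar R} of
               lebesgue_rV_succ (lebesgue_rV m)]
  end.

End lebesgue_rV.

Section notions.
Variables (R : realType) (n : nat).
Implicit Types (x y xi v : 'rV[R]_n) (A Q T : set 'rV[R]_n).
Local Notation leb := (lebesgue_rV R n).

Definition dot x y : R := \sum_i x ord0 i * y ord0 i.

(* the library's norm on 'rV[R]_n is the sup norm *)
Definition enorm x : R := Num.sqrt (dot x x).

Definition modc (z : R[i]) : R := ComplexField.Normc.normc z.

Definition cintegral (F : 'rV[R]_n -> R[i]) : R[i] :=
  Complex (\int[leb]_y complex.Re (F y)) (\int[leb]_y complex.Im (F y)).

(* The sigma-algebra on 'rV[R]_n is not completed: F is Lebesgue measurable when
   it agrees almost everywhere with a Borel function. *)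
Definition lebesgue_measurable (F : 'rV[R]_n -> R[i]) : Prop :=
  exists G : 'rV[R]_n -> R[i],
    [/\ measurable_fun setT (fun y => complex.Re (G y)),
        measurable_fun setT (fun y => complex.Im (G y)) &
        {ae leb, forall y, F y = G y}].

Definition bounded_function (F : 'rV[R]_n -> R[i]) : Prop :=
  exists B : R, forall y, modc (F y) <= B.

(* The dilation matrix is M = lam Id; lam is a nat because M has integer
   entries, and M acts on 'rV[R]_n as lam%:R *: _. *)
Section tiles.
Variable lam : nat.

Definition translate A v : set 'rV[R]_n := [set y + v | y in A].

Definition int_rV (nu : 'rV[int]_n) : 'rV[R]_n := map_mx intr nu.

Definition complete_residues (Gamma : set 'rV[int]_n) : Prop :=
  forall nu : 'rV[int]_n,
    exists! g, Gamma g /\ exists mu : 'rV[int]_n, nu = g + mu *+ lam.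

Definition ae_disjoint (I : set 'rV[int]_n) T : Prop :=
  forall mu nu, I mu -> I nu -> mu <> nu ->
    leb.-negligible (translate T (int_rV mu) `&` translate T (int_rV nu)).

Definition self_affine_tile (Gamma : set 'rV[int]_n) T : Prop :=
  [/\ compact T,
      \bigcup_nu translate T (int_rV nu) = setT,
      ae_disjoint setT T,
      \bigcup_(g in Gamma) translate T (int_rV g) = [set lam%:R *: y | y in T] &
      ae_disjoint Gamma T].

Definition cell Q0 (l : nat) x : set 'rV[R]_n :=
  [set lam%:R ^- l *: y + x | y in Q0].

(* evaluation at a real point of a polynomial with complex coefficients *)
Definition peval (P : mpoly n R[i]) y : R[i] :=
  meval (fun i => real_complex R (y ord0 i)) P.

Definition Linfty_norm Q (F : 'rV[R]_n -> R[i]) : \bar R :=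
  ess_sup leb (fun y => (\1_Q y * modc (F y))%:E).

(* mmeasure mdeg P is the total degree of P plus one, and 0 for P = 0 *)
Definition osc (k : nat) Q0 (f : 'rV[R]_n -> R[i]) x (l : nat) : \bar R :=
  ereal_inf [set Linfty_norm (cell Q0 l x) (fun y => f y - peval P y) |
    P in [set P | (mmeasure mdeg P <= k.+1)%N]].

(* the class C^s(x); any k with s < k + 1 may be used to define it *)
Definition C_at (k : nat) Q0 (s : R) (f : 'rV[R]_n -> R[i]) x : Prop :=
  (ereal_sup (range (fun l : nat =>
     (lam%:R `^ (l%:R * s))%:E * osc k Q0 f x l)) < +oo)%E.

End tiles.

Definition partial (i : 'I_n) (g : 'rV[R]_n -> R) : 'rV[R]_n -> R :=
  fun x => 'D_(delta_mx ord0 i) g x.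

Definition partials (s : seq 'I_n) (g : 'rV[R]_n -> R) : 'rV[R]_n -> R :=
  foldr partial g s.

Definition schwartzR (g : 'rV[R]_n -> R) : Prop :=
  forall s : seq 'I_n,
    [/\ continuous (partials s g),
        forall i x, derivable (partials s g) x (delta_mx ord0 i) &
        forall m : nat, exists B : R, forall x,
          (1 + enorm x) ^+ m * `|partials s g x| <= B].

Definition schwartz (phi : 'rV[R]_n -> R[i]) : Prop :=
  schwartzR (fun x => complex.Re (phi x)) /\
  schwartzR (fun x => complex.Im (phi x)).

(* Kernel exp(-i <x, xi>) and no normalizing factor, so that the value of the
   transform at 0 is the integral of phi. *)
Definition fourier (phi : 'rV[R]_n -> R[i]) xi : R[i] :=
  cintegral (fun x => phi x * Complex (cos (dot x xi)) (- sin (dot x xi))).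

Definition convolution (f g : 'rV[R]_n -> R[i]) y : R[i] :=
  cintegral (fun z => f z * g (y - z)).

Definition LP_function (lam : nat) (phi : 'rV[R]_n -> R[i]) : Prop :=
  [/\ schwartz phi,
      closure [set xi | fourier phi xi != 0] `<=` [set xi | enorm xi <= 1] &
      forall xi, enorm xi <= lam%:R^-1 -> fourier phi xi = 1].

Definition dilate (lam : nat) (phi : 'rV[R]_n -> R[i]) (l : nat) x : R[i] :=
  lam%:R ^+ (l * n) * phi (lam%:R ^+ l *: x).

Definition LP (lam : nat) (phi : 'rV[R]_n -> R[i]) (l : nat)
    (f : 'rV[R]_n -> R[i]) : 'rV[R]_n -> R[i] :=
  convolution f (dilate lam phi l).

End notions.

(* Main.v *)
(* Of the tile, only the fact that Q0 lies between two balls centred at 0 matters, and f may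
   be replaced by a bounded Borel function that agrees with it almost everywhere.
   Write L = lam%:R.

   The moments of phi, computed by testing phi against trigonometric polynomials of
   frequency at most 1/lam, where the transform of phi is 1, show that S_l reproduces
   polynomials. If P_m is a near-best polynomial at scale m, then f - P_m grows at most
   like L^(-m s) (1 + L^m |y - x|)^K, so that f - S_l f = (f - P_m) - S_l (f - P_m) has
   this bound as well when m <= l; the choice L^-m ~ max (L^-l, |x - y|) gives (ii).

   Conversely S_m (S_j f) = S_j f for j < m, because the transforms of S_m (phi_j) and
   phi_j coincide. Hence, with r_j = f - S_j f,
     S_(j+2) f - S_(j+1) f = S_(j+2) r_j - S_(j+1) r_j,
   and the Taylor polynomial of the right-hand side at x has an error at most
   C L^(-j s) (L^j |y - x|)^(k+1). These errors add up because s < k + 1. *)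
Require Import Defs.
From HB Require Import structures.
From mathcomp Require Import all_boot all_order all_algebra.
From mathcomp Require Import ring lra.
From mathcomp Require Import -(notations) mpoly.
From mathcomp Require Import all_classical all_reals all_analysis.
From mathcomp Require Import measurable_realfun ess_sup_inf complex.
Import Order.TTheory GRing.Theory Num.Theory numFieldNormedType.Exports.
Local Open Scope classical_set_scope.
Local Open Scope ring_scope.
Set Implicit Arguments.
Unset Strict Implicit.
Unset Printing Implicit Defensive.

(** * Lebesgue measure and complex integrals on R^n *)

(** Both estimates reduce to averages of [w (x - L^-l u)] against [phi (u + L^l v)]. The increment
    [v] enters through the kernel alone, so that expansions in [v] differentiate only phi, and [w]
    is merely measurable and of polynomial growth. Rapid decay of phi absorbs every growth exponent
    K, which may therefore be as large as convenient. The residual r_j is smoothed at the levels j+1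
    and j+2 and not at j: the transform of phi_m is 1 up to radius L^(m-1), that of phi_j reaches
    radius L^j, and so S_m S_j = S_j asks for j < m. Trigonometric polynomials replace
    differentiation and inversion of the Fourier transform. Pairing them with a function involves
    only values of its transform, and in the limit they yield monomials, hence the moments, and
    Gaussians, hence injectivity of the transform. The Taylor errors are summed by a recursion in
    the level, whose constant A has to satisfy (A + C2) L^s <= A L^(k+1). *)

Section affine_line.
Variable R : realType.
Local Notation mu := (@lebesgue_measure R).

Definition affine1 (c b : R) : measurableTypeR R -> measurableTypeR R :=
  fun z => c * z + b.

Lemma measurable_affine1 c b : measurable_fun setT (affine1 c b).
Proof.
by apply: measurable_realfun.measurable_funD => //; exact: measurable_realfun.measurable_funM.
Qed.

Let affine_measure (c b : R) : {measure set (measurableTypeR R) -> \bar R} :=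
  measure_function_pushforward__canonical__measure_function_Measure
    mu (measurable_affine1 c b).

(** Both sides are measures in [A], so it is enough to compare them on the intervals []x, y]]. For
    [c < 0] the preimage is closed at the other end, which does not affect its length. *)
Lemma lebesgue_affine1 (c b : R) (A : set R) : c != 0 -> measurable A ->
  mu A = (`|c|%:E * mu (affine1 c b @^-1` A))%E.
Proof.
move=> c0 mA.
rewrite (lebesgue_measure_unique
  (mu := mscale (NngNum (normr_ge0 c)) (affine_measure c b)))// => _ [[x y]] _ <-.
change (mu `]x, y] = (`|c|%:E * mu (affine1 c b @^-1` `]x, y]))%E).
move: c0; rewrite neq_lt => /orP[c0|c0].
- have -> : affine1 c b @^-1` `]x, y] = `[(y - b) / c, (x - b) / c[%classic.
    by apply/seteqP; split => z /=; rewrite !in_itv/= /affine1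
      ler_ndivrMr// ltr_ndivlMr// lerBrDr ltrBlDr mulrC andbC.
  rewrite !lebesgue_measure_itv/= !lte_fin ltr_nM2r ?invr_lt0// ltrD2r.
  case: ifPn => _; last by rewrite mule0.
  by rewrite ltr0_norm// -!EFinD -EFinM; congr EFin; field; lra.
- have -> : affine1 c b @^-1` `]x, y] = `](x - b) / c, (y - b) / c]%classic.
    by apply/seteqP; split => z /=; rewrite !in_itv/= /affine1
      ltr_pdivrMr// ler_pdivlMr// ltrBlDr lerBrDr mulrC.
  rewrite !lebesgue_measure_itv/= !lte_fin ltr_pM2r ?invr_gt0// ltrD2r.
  case: ifPn => _; last by rewrite mule0.
  by rewrite gtr0_norm// -!EFinD -EFinM; congr EFin; field; lra.
Qed.

Lemma ge0_integral_affine1 (c b : R) (F : R -> \bar R) : c != 0 ->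
  measurable_fun [set: R] F -> (forall x, 0 <= F x)%E ->
  (\int[mu]_x F x = `|c|%:E * \int[mu]_x F (c * x + b)%R)%E.
Proof.
move=> c0 mF F0.
transitivity (\int[mscale (NngNum (normr_ge0 c)) (affine_measure c b)]_x F x)%E.
  by apply: eq_measure_integral => A mA _; exact: lebesgue_affine1.
rewrite ge0_integral_mscale//= ge0_integral_pushforward//.
exact: measurable_affine1.
Qed.

Lemma integral_oneDsqr_lty : (\int[mu]_x (oneDsqr x)^-1%:E < +oo)%E.
Proof.
have mf : measurable_fun [set: R] (fun x : R => (oneDsqr x)^-1%:E).
  apply/measurable_EFinP.
  by apply: (@continuous_measurable_fun R (fun x => (oneDsqr x)^-1)) => x; exact: continuous_oneDsqrV.
have f0 : forall x : R, (0 <= (oneDsqr x)^-1%:E)%E.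
  by move=> x; rewrite lee_fin invr_ge0 (le_trans ler01).
have h : (\int[mu]_(x in `]-oo, 0%R]) (oneDsqr x)^-1%:E = (pi / 2)%:E)%E.
  rewrite -(integral0y_oneDsqr R) ge0_integration_by_substitution0//.
  by apply: eq_integral => x _; rewrite /oneDsqr sqrrN.
have -> : [set: R] = `]-oo, 0%R[%classic `|` `[0%R, +oo[%classic.
  apply/seteqP; split => // x _ /=; rewrite !in_itv/= andbT.
  by apply/orP; rewrite -leNgt || case: (ltP x 0); rewrite ?orbT.
rewrite ge0_integral_setU//=; last 2 first.
- exact: measurable_funTS.
- apply/disj_setPS => x [/=]; rewrite !in_itv/= andbT => /lt_le_trans /[apply].
  by rewrite ltxx.
rewrite (integral0y_oneDsqr R) lte_add_pinfty ?ltry//.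
apply: le_lt_trans (ltry (pi / 2)); rewrite -h.
apply: ge0_subset_integral => //; first exact: measurable_funTS.
by move=> x /=; rewrite !in_itv/= => /ltW.
Qed.

End affine_line.

(** * Lebesgue measure on R^n, one coordinate at a time *)

Section measure_rV.
Variable R : realType.

Lemma continuousP_rV n (g : 'rV[R]_n -> R) (x : 'rV[R]_n) (e : R) : continuous g -> 0 < e ->
  exists2 d : R, 0 < d & forall y : 'rV[R]_n, (forall i, `|y ord0 i - x ord0 i| < d) -> `|g y - g x| < e.
Proof.
move=> cg e0; have /cvgrPdist_lt/(_ _ e0) := cg x.
move=> /nbhs_ballP[d /= d0 h]; exists d => // y yx.
rewrite distrC; apply: h; split=> // i j; rewrite ord1 /ball/= distrC; exact: yx.
Qed.

Lemma continuous_rVP n (g : 'rV[R]_n -> R) :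
  (forall (x : 'rV[R]_n) (e : R), 0 < e -> exists2 d : R, 0 < d &
    forall y : 'rV[R]_n, (forall i, `|y ord0 i - x ord0 i| < d) -> `|g y - g x| < e) -> continuous g.
Proof.
move=> h x; have F : Filter (nbhs x) by exact: nbhs_filter.
apply/(@cvgrPdist_lt R R _ (nbhs x) F) => e e0; have [d d0 {}h] := h x e e0.
apply/nbhs_ballP; exists d => //= y [_ xy]; rewrite distrC; apply: h => i.
by rewrite distrC; exact: xy.
Qed.

Lemma measurable_box n (A : 'I_n -> set R) : (forall i, measurable (A i)) ->
  measurable [set x : 'rV[R]_n | forall i, A i (x ord0 i)].
Proof.
move=> mA.
have -> : [set x : 'rV[R]_n | forall i, A i (x ord0 i)] =
    \bigcap_(i in setT) ((fun x : 'rV[R]_n => x ord0 i) @^-1` A i).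
  by apply/seteqP; split => x h i //=; exact: h.
apply: fin_bigcap_measurable => [|i _]; first exact: finite_finset.
by rewrite -[X in measurable X]setTI; apply: measurable_coord.
Qed.

(** The sigma-algebra is generated by the coordinates and not by the open sets. The function is the
    limit of its values at grid points of mesh [1 / (m + 1)]; each such approximation is constant on
    countably many boxes. *)
Lemma measurable_continuous_rV n (g : 'rV[R]_n -> R) :
  continuous g -> measurable_fun setT g.
Proof.
move=> cg.
pose q (m : nat) (x : 'rV[R]_n) : 'rV[int]_n := \row_i Num.floor (m.+1%:R * x ord0 i).
pose p (m : nat) (v : 'rV[int]_n) : 'rV[R]_n := \row_i ((v ord0 i)%:~R / m.+1%:R).
apply: (@measurable_fun_cvg _ _ _ _ (fun m => g \o p m \o q m)); last first.
  move=> x _ /=; apply/cvgrPdist_lt => e e0.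
  have [d d0 h] := continuousP_rV x cg e0.
  near=> m; rewrite distrC; apply: h => i; rewrite !mxE.
  have m0 : (0:R) < m.+1%:R by rewrite ltr0n.
  apply: (@le_lt_trans _ _ m.+1%:R^-1); last first.
    by near: m; exact: (near_infty_natSinv_lt (PosNum d0)).
  have /andP[] := floor_itv (m.+1%:R * x ord0 i).
  set k := Num.floor _; rewrite intrD => h1 h2.
  rewrite -(ler_pM2l m0) divff ?gt_eqF// -{1}(gtr0_norm m0) -normrM mulrBr.
  by rewrite mulrCA divff ?gt_eqF// mulr1 ler_norml; apply/andP; split; lra.
move=> m _ Y mY; rewrite setTI.
rewrite [X in measurable X](_ : _ = \bigcup_v (if g (p m v) \in Y
    then [set x : 'rV[R]_n | forall i, [set t : R | Num.floor (m.+1%:R * t) = v ord0 i] (x ord0 i)] else set0)); last first.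
  apply/seteqP; split => [x /= Yx|x [v _]].
    exists (q m x) => //; rewrite ifT ?inE// => i; by rewrite /= mxE.
  case: ifPn => //; rewrite inE => Yv h /=.
  by have <- : v = q m x by apply/rowP => i; rewrite mxE h.
apply: countable_bigcupT_measurable => [|v]; first exact: countableP.
case: ifPn => // _.
apply: (@measurable_box n (fun i => [set t : R | Num.floor (m.+1%:R * t) = v ord0 i])) => i.
rewrite (_ : mkset _ = `[ (v ord0 i)%:~R / m.+1%:R, ((v ord0 i)%:~R + 1) / m.+1%:R [%classic).
  exact: measurable_itv.
have m0 : (0:R) < m.+1%:R by rewrite ltr0n.
apply/seteqP; split => t /=; rewrite in_itv/= ler_pdivrMr// ltr_pdivlMr// ![t * _]mulrC.
  by move=> /eqP; rewrite floor_eq intrD.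
by move=> h; apply/eqP; rewrite floor_eq intrD.
Unshelve. all: by end_near. Qed.

Lemma ge0_integral_rV_succ n (F : 'rV[R]_n.+1 -> \bar R) :
  measurable_fun setT F -> (forall x, 0 <= F x)%E ->
  (\int[lebesgue_rV R n.+1]_x F x =
   \int[@lebesgue_measure R]_t \int[lebesgue_rV R n]_u F (rV_cons (t, u)))%E.
Proof.
move=> mF F0.
pose P := [the {sigma_finite_measure set 'rV[R]_n -> \bar R} of lebesgue_rV R n].
pose M := (@lebesgue_measure R \x P)%E.
transitivity (\int[M]_z F (rV_cons z))%E; last first.
  rewrite fubini_tonelli1//=.
  by apply: measurableT_comp => //; exact: measurable_rV_cons.
have mc : @measurable_fun _ _ (measurableTypeR R * 'rV[R]_n)%type 'rV[R]_n.+1 setT (@rV_cons R n).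
  exact: measurable_rV_cons.
have H := ge0_integral_pushforward mc [the {measure set (measurableTypeR R * 'rV[R]_n)%type -> \bar R} of M] measurableT mF (fun y _ => F0 y).
by rewrite preimage_setT in H.
Qed.

Lemma rV_cons_affine n (c : R) (b : 'rV[R]_n.+1) (t : R) (u : 'rV[R]_n) :
  c *: rV_cons (t, u) + b =
  rV_cons (c * t + b ord0 ord0, c *: u + \row_i b ord0 (lift ord0 i)).
Proof.
apply/rowP => i; rewrite mxE [X in X + _]mxE.
have [j ->|->] := unliftP ord0 i; last by rewrite !rV_cons0.
by rewrite !rV_consS/= !mxE.
Qed.

Lemma measurable_rV_affine n (c : R) (b : 'rV[R]_n) :
  measurable_fun setT (fun x : 'rV[R]_n => c *: x + b).
Proof.
apply/measurable_fun_rVP => i.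
under eq_fun do rewrite !mxE.
apply: measurable_funD => //; apply: measurable_funM => //.
exact: measurable_coord.
Qed.

(** Induction on [n] by Tonelli: the inner integral contributes [|c|^n], the outer one the last
    factor [|c|]. *)
Lemma ge0_integral_rV_affine n (c : R) (b : 'rV[R]_n) (F : 'rV[R]_n -> \bar R) :
  c != 0 -> measurable_fun setT F -> (forall x, 0 <= F x)%E ->
  (\int[lebesgue_rV R n]_x F x =
   (`|c| ^+ n)%:E * \int[lebesgue_rV R n]_x F (c *: x + b)%R)%E.
Proof.
move=> c0; elim: n b F => [|n IH] b F mF F0.
  rewrite expr0 mul1e; apply: eq_integral => x _.
  by congr F; apply/rowP => -[].
pose b' : 'rV[R]_n := \row_i b ord0 (lift ord0 i).
have mc : measurable_fun setT (fun p : measurableTypeR R * 'rV[R]_n => F (rV_cons p)).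
  by apply: measurableT_comp => //; exact: measurable_rV_cons.
have mc' : measurable_fun setT (fun p : measurableTypeR R * 'rV[R]_n =>
    F (rV_cons (p.1, c *: p.2 + b'))).
  apply: (measurableT_comp mc); apply/measurable_fun_pairP.
  split; first exact: measurable_fst.
  exact: (measurableT_comp (measurable_rV_affine c b') measurable_snd).
pose G (t : measurableTypeR R) := (\int[lebesgue_rV R n]_u F (rV_cons (t, c *: u + b')%R))%E.
have mG : measurable_fun [set: measurableTypeR R] G.
  exact: (@measurable_fun_fubini_tonelli_F _ _ _ _ _ (lebesgue_rV R n) _ mc').
have G0 t : (0 <= G t)%E by apply: integral_ge0 => u _.
rewrite !ge0_integral_rV_succ//; last first.
  by apply: measurableT_comp => //; exact: measurable_rV_affine.
transitivity (\int[@lebesgue_measure R]_t ((`|c| ^+ n)%:E * G t))%E.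
  apply: eq_integral => t _; rewrite (IH b')//.
  by apply: (measurableT_comp mc); exact: measurable_pair1.
rewrite (ge0_integralZl _ measurableT mG (fun t _ => G0 t)); last by rewrite lee_fin exprn_ge0.
rewrite (@ge0_integral_affine1 _ c (b ord0 ord0) G c0 mG G0) muleA -EFinM -exprSr.
congr (_ * _)%E; apply: eq_integral => t _; apply: eq_integral => u _.
by rewrite rV_cons_affine.
Qed.

(** The sup-norm ball written as a product of intervals, so that its measure follows by induction on
    [n]. *)
Definition cube n (x : 'rV[R]_n) (r : R) : set 'rV[R]_n :=
  [set y | forall i, ball (x ord0 i) r (y ord0 i)].

Lemma measurable_cube n (x : 'rV[R]_n) (r : R) : measurable (cube x r).
Proof.
by apply: (@measurable_box n (fun i => ball (x ord0 i) r)) => i; exact: measurable_ball.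
Qed.

Lemma lebesgue_cube n (x : 'rV[R]_n) (r : R) : 0 < r ->
  lebesgue_rV R n (cube x r) = ((r *+ 2) ^+ n)%:E.
Proof.
move=> r0; elim: n x => [|n IH] x.
  by rewrite /= diracE mem_set// => -[].
pose x' : 'rV[R]_n := \row_i x ord0 (lift ord0 i).
have -> : lebesgue_rV R n.+1 (cube x r) =
    (@lebesgue_measure R \x lebesgue_rV R n)%E (ball (x ord0 ord0) r `*` cube x' r).
  congr (_ \x _)%E; apply/seteqP; split => [[t u] h|[t u] [h0 h1] i] /=.
    split; first by have := h ord0; rewrite rV_cons0.
    by move=> i /=; have := h (lift ord0 i); rewrite rV_consS mxE.
  have [j ->|->] := unliftP ord0 i; last by rewrite rV_cons0.
  by rewrite rV_consS; have := h1 j; rewrite mxE.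
rewrite product_measure1E//=; last 2 first.
- exact: measurable_ball.
- exact: measurable_cube.
by rewrite IH lebesgue_measure_ball ?ltW// -EFinM exprS.
Qed.

(** A tensor product of the functions [1 / (1 + t^2)], integrable by Tonelli; it serves as a
    majorant of the weight [wt (2 * n)]. *)
Definition prodwt n (x : 'rV[R]_n) : R := \prod_i (oneDsqr (x ord0 i))^-1.

Lemma measurable_prodwt n : measurable_fun setT (@prodwt n).
Proof.
apply: measurable_prod => i _.
have : measurable_fun [set: R] (fun x : R => (oneDsqr x)^-1).
  by apply: continuous_measurable_fun => x; exact: continuous_oneDsqrV.
by move=> /measurableT_comp; apply; exact: measurable_coord.
Qed.

Lemma integral_prodwt_lty n : (\int[lebesgue_rV R n]_x (prodwt x)%:E < +oo)%E.
Proof.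
have w0 : forall n (x : 'rV[R]_n), 0 <= prodwt x.
  by move=> m x; apply: prodr_ge0 => i _; rewrite invr_ge0 (le_trans ler01).
elim: n => [|n IH].
  by rewrite /= integral_dirac//= ?diracT ?mul1e ?ltry//; apply/measurable_EFinP; exact: measurable_prodwt.
rewrite ge0_integral_rV_succ//; last 2 first.
- by apply/measurable_EFinP; exact: measurable_prodwt.
- by move=> x; rewrite lee_fin.
set I := (\int[lebesgue_rV R n]_x _)%E in IH.
have I0 : (0 <= I)%E by apply: integral_ge0 => x _; rewrite lee_fin.
have -> : (\int[@lebesgue_measure R]_t \int[lebesgue_rV R n]_u (prodwt (rV_cons (t, u)))%:E =
   \int[@lebesgue_measure R]_t (I * (oneDsqr t)^-1%:E))%E.
  apply: eq_integral => t _; rewrite muleC -ge0_integralZl//; last 2 first.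
  - by apply/measurable_EFinP; exact: measurable_prodwt.
  - by move=> x _; rewrite lee_fin.
  apply: eq_integral => u _; rewrite -EFinM /prodwt big_ord_recl rV_cons0.
  by congr (_ * _)%:E; apply: eq_bigr => i _; rewrite rV_consS.
rewrite ge0_integralZl//; last first.
  apply/measurable_EFinP.
  by apply: (@continuous_measurable_fun R (fun x => (oneDsqr x)^-1)) => x; exact: continuous_oneDsqrV.
rewrite lte_mul_pinfty//; last exact: integral_oneDsqr_lty.
by rewrite ge0_fin_numE.
Qed.

End measure_rV.

(** * Complex modulus and complex-valued measurable functions *)

Section modc.
Variable R : realType.
Implicit Types z w : R[i].

Lemma modc_ge0 z : 0 <= modc z.
Proof. by case: z => a b; exact: sqrtr_ge0. Qed.

Lemma modcD z w : modc (z + w) <= modc z + modc w.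
Proof. exact: le_normcD. Qed.

Lemma modcN z : modc (- z) = modc z.
Proof. exact: normcN. Qed.

Lemma modcB z w : modc (z - w) <= modc z + modc w.
Proof. by rewrite -(modcN w) modcD. Qed.

Lemma modcM z w : modc (z * w) = modc z * modc w.
Proof. exact: ComplexField.Normc.normcM. Qed.

Lemma modc_real (x : R) : modc (real_complex R x) = `|x|.
Proof. by rewrite /modc/= expr0n/= addr0 sqrtr_sqr. Qed.

Lemma modc0 : modc (0 : R[i]) = 0.
Proof. by rewrite (modc_real 0) normr0. Qed.

Lemma modc_sum (I : Type) (s : seq I) (F : I -> R[i]) :
  modc (\sum_(i <- s) F i) <= \sum_(i <- s) modc (F i).
Proof.
elim: s => [|i s IH]; first by rewrite !big_nil modc0.
by rewrite !big_cons (le_trans (modcD _ _))// lerD2l.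
Qed.

Lemma normr_Re_le z : `|complex.Re z| <= modc z.
Proof.
by case: z => a b; rewrite -sqrtr_sqr ler_sqrt ?lerDl ?addr_ge0 ?sqr_ge0.
Qed.

Lemma normr_Im_le z : `|complex.Im z| <= modc z.
Proof.
by case: z => a b; rewrite -sqrtr_sqr ler_sqrt ?lerDr ?addr_ge0 ?sqr_ge0.
Qed.

Lemma modc_le z : modc z <= `|complex.Re z| + `|complex.Im z|.
Proof.
case: z => a b /=; rewrite /modc/=.
rewrite -(@ger0_norm _ (`|a| + `|b|)) ?addr_ge0// -sqrtr_sqr ler_sqrt ?sqr_ge0//.
by rewrite sqrrD !real_normK ?num_real// lerD2r lerDl mulrn_wge0// mulr_ge0.
Qed.

Lemma modc_eq0 z : modc z = 0 -> z = 0.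
Proof. exact: ComplexField.Normc.eq0_normc. Qed.

Lemma cReD z w : complex.Re (z + w) = complex.Re z + complex.Re w.
Proof. by case: z w => [? ?] []. Qed.
Lemma cImD z w : complex.Im (z + w) = complex.Im z + complex.Im w.
Proof. by case: z w => [? ?] []. Qed.
Lemma cReN z : complex.Re (- z) = - complex.Re z.
Proof. by case: z. Qed.
Lemma cImN z : complex.Im (- z) = - complex.Im z.
Proof. by case: z. Qed.
Lemma cReM z w : complex.Re (z * w) =
  complex.Re z * complex.Re w - complex.Im z * complex.Im w.
Proof. by case: z w => [? ?] []. Qed.
Lemma cImM z w : complex.Im (z * w) =
  complex.Re z * complex.Im w + complex.Im z * complex.Re w.
Proof. by case: z w => [? ?] []. Qed.

Lemma complex_eq z w : complex.Re z = complex.Re w -> complex.Im z = complex.Im w -> z = w.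
Proof. by case: z w => [? ?] [? ?] /= -> ->. Qed.

End modc.

Section cmeasurable.
Variables (R : realType) (d : measure_display) (T : measurableType d).
Implicit Types F G : T -> R[i].

Definition cmeasurable F :=
  measurable_fun setT (fun x => complex.Re (F x)) /\
  measurable_fun setT (fun x => complex.Im (F x)).

Lemma cmeasurable_cst c : cmeasurable (fun=> c).
Proof. by split; exact: measurable_cst. Qed.

Lemma cmeasurableD F G : cmeasurable F -> cmeasurable G ->
  cmeasurable (fun x => F x + G x).
Proof.
move=> [F1 F2] [G1 G2]; split.
  by under eq_fun do rewrite cReD; exact: measurable_funD.
by under eq_fun do rewrite cImD; exact: measurable_funD.
Qed.

Lemma cmeasurableN F : cmeasurable F -> cmeasurable (fun x => - F x).
Proof.
move=> [F1 F2]; split.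
  by under eq_fun do rewrite cReN; exact: measurable_funN.
by under eq_fun do rewrite cImN; exact: measurable_funN.
Qed.

Lemma cmeasurableB F G : cmeasurable F -> cmeasurable G ->
  cmeasurable (fun x => F x - G x).
Proof. by move=> mF mG; apply: cmeasurableD => //; exact: cmeasurableN. Qed.

Lemma cmeasurableM F G : cmeasurable F -> cmeasurable G ->
  cmeasurable (fun x => F x * G x).
Proof.
move=> [F1 F2] [G1 G2]; split.
  by under eq_fun do rewrite cReM; apply: measurable_funB; exact: measurable_funM.
by under eq_fun do rewrite cImM; apply: measurable_funD; exact: measurable_funM.
Qed.

Lemma cmeasurable_real (g : T -> R) : measurable_fun setT g ->
  cmeasurable (fun x => real_complex R (g x)).
Proof. by move=> mg; split => //=; exact: measurable_cst. Qed.

Lemma cmeasurable_sum (I : Type) (s : seq I) (F : I -> T -> R[i]) :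
  (forall i, cmeasurable (F i)) -> cmeasurable (fun x => \sum_(i <- s) F i x).
Proof.
move=> mF; elim: s => [|i s IH].
  rewrite (_ : (fun _ => _) = fun=> 0); first exact: cmeasurable_cst.
  by apply/funext => x; rewrite big_nil.
rewrite (_ : (fun _ => _) = fun x => F i x + \sum_(i <- s) F i x).
  exact: cmeasurableD.
by apply/funext => x; rewrite big_cons.
Qed.

Lemma measurable_modc F : cmeasurable F -> measurable_fun setT (fun x => modc (F x)).
Proof.
move=> [F1 F2].
have -> : (fun x => modc (F x)) =
    (@Num.sqrt R) \o (fun x => complex.Re (F x) ^+ 2 + complex.Im (F x) ^+ 2).
  by apply/funext => x; rewrite /=; case: (F x).
apply: measurableT_comp.
  by apply: continuous_measurable_fun; exact: sqrt_continuous.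
by apply: measurable_funD; apply: measurable_funX.
Qed.

End cmeasurable.

Lemma cmeasurable_comp (R : realType) d d' (T : measurableType d) (U : measurableType d')
    (F : U -> R[i]) (h : T -> U) :
  cmeasurable F -> measurable_fun setT h -> cmeasurable (fun x => F (h x)).
Proof.
by move=> [F1 F2] mh; split; [exact: (measurableT_comp F1 mh)|exact: (measurableT_comp F2 mh)].
Qed.

(** * Norms and polynomial weights *)

Section norms.
Variables (R : realType) (n : nat).
Implicit Types x y : 'rV[R]_n.

Lemma coord_le_norm x i : `|x ord0 i| <= `|x|.
Proof.
by rewrite [leRHS]/Num.Def.normr /= mx_normrE; apply/bigmax_geP; right => /=; exists (ord0, i).
Qed.

Lemma norm_rV_le x (a : R) : 0 <= a -> (forall i, `|x ord0 i| <= a) -> `|x| <= a.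
Proof.
move=> a0 h; rewrite [leLHS]/Num.Def.normr /= mx_normrE.
by apply/bigmax_leP; split=> // -[i j] _ /=; rewrite ord1.
Qed.

Lemma norm_le_enorm x : `|x| <= enorm x.
Proof.
apply: norm_rV_le => [|i]; first exact: sqrtr_ge0.
rewrite -sqrtr_sqr ler_sqrt ?sqr_ge0//; last first.
  by apply: sumr_ge0 => j _; rewrite -expr2 sqr_ge0.
rewrite /dot (bigD1 i)//= expr2 lerDl sumr_ge0// => j _.
by rewrite -expr2 sqr_ge0.
Qed.

Lemma enorm_ge0 x : 0 <= enorm x.
Proof. exact: sqrtr_ge0. Qed.

Lemma enorm_le_norm x : enorm x <= n%:R * `|x|.
Proof.
have nx0 : 0 <= n%:R * `|x| by rewrite mulr_ge0.
rewrite -(ger0_norm nx0) -sqrtr_sqr ler_sqrt ?sqr_ge0//.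
apply: (@le_trans _ _ (\sum_(i < n) `|x| ^+ 2)).
  apply: ler_sum => i _; rewrite -expr2 -(real_normK (num_real (x ord0 i))).
  by rewrite lerXn2r ?nnegrE//; exact: coord_le_norm.
rewrite sumr_const card_ord -[leLHS]mulr_natl exprMn ler_wpM2r ?sqr_ge0//.
case: n => [|m]; first by rewrite expr0n.
by rewrite -[leLHS]mulr1 expr2 ler_pM2l ?ltr0n// ler1n.
Qed.

Lemma enormZ (c : R) x : enorm (c *: x) = `|c| * enorm x.
Proof.
rewrite /enorm -(sqrtr_sqr c) -sqrtrM ?sqr_ge0//; congr Num.sqrt.
by rewrite /dot mulr_sumr; apply: eq_bigr => i _; rewrite !mxE; ring.
Qed.

Definition wt (N : nat) x : R := ((1 + `|x|) ^+ N)^-1.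

Lemma norm1_gt0 x : 0 < 1 + `|x|.
Proof. by rewrite ltr_wpDr. Qed.

Lemma norm1_ge1 x : 1 <= 1 + `|x|.
Proof. by rewrite lerDl. Qed.

Lemma wt_gt0 N x : 0 < wt N x.
Proof. by rewrite invr_gt0 exprn_gt0// norm1_gt0. Qed.

Lemma wt_ge0 N x : 0 <= wt N x. Proof. exact/ltW/wt_gt0. Qed.

Lemma wt_le1 N x : wt N x <= 1.
Proof. by rewrite invf_le1 ?exprn_gt0 ?norm1_gt0// exprn_ege1// norm1_ge1. Qed.

Lemma wtM_expr K N x : (1 + `|x|) ^+ K * wt (K + N) x = wt N x.
Proof.
by rewrite /wt exprD invfM mulrA divff ?mul1r// expf_neq0// gt_eqF// norm1_gt0.
Qed.

Lemma measurable_norm_rV : measurable_fun setT (fun x : 'rV[R]_n => `|x|).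
Proof. by apply: measurable_continuous_rV; exact: norm_continuous. Qed.

Lemma measurable_wt N : measurable_fun setT (wt N).
Proof.
have : measurable_fun [set: R] (fun t : R => ((1 + `|t|) ^+ N)^-1).
  apply: continuous_measurable_fun => t; apply: cvgV.
    by rewrite expf_neq0// gt_eqF// ltr_wpDr.
  apply: (continuous_comp (f := fun t : R => 1 + `|t|) (g := fun t : R => t ^+ N)).
    by apply: cvgD; [exact: cvg_cst|exact: norm_continuous].
  exact: exprn_continuous.
move=> /measurableT_comp /(_ measurable_norm_rV).
by congr (measurable_fun _ _); apply/funext => x /=; rewrite normr_id.
Qed.

(** Each coordinate takes two of the [2 * n] powers, since [1 + x_i^2 <= (1 + |x|)^2]. This is where
    the exponent [2 * n], used for integrability throughout, comes from. *)
Lemma wt_le_prodwt x : wt (2 * n) x <= prodwt x.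
Proof.
have -> : wt (2 * n) x = \prod_(i < n) ((1 + `|x|) ^+ 2)^-1.
  by rewrite prodr_const card_ord /wt exprM exprVn.
apply: ler_prod => i _; rewrite invr_ge0 exprn_ge0 ?(ltW (norm1_gt0 _))//=.
rewrite lef_pV2 ?posrE ?exprn_gt0 ?norm1_gt0//.
rewrite /oneDsqr sqrrD expr1n -(real_normK (num_real (x ord0 i))).
have : `|x ord0 i| ^+ 2 <= `|x| ^+ 2.
  by rewrite lerXn2r ?nnegrE//; exact: coord_le_norm.
have : 0 <= `|x| by [].
by rewrite mul1r mulr2n; lra.
Qed.

Lemma integrable_wt : (lebesgue_rV R n).-integrable setT (EFin \o wt (2 * n)).
Proof.
apply/integrableP; split; first by apply/measurable_EFinP; exact: measurable_wt.
apply: le_lt_trans (integral_prodwt_lty R n); apply: ge0_le_integral => //=.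
- by apply/measurable_EFinP; apply: measurableT_comp => //; exact: measurable_wt.
- by apply/measurable_EFinP; exact: measurable_prodwt.
- by move=> x _; rewrite lee_fin ger0_norm ?wt_ge0// wt_le_prodwt.
Qed.

Lemma norm1D x y : 1 + `|x + y| <= (1 + `|x|) * (1 + `|y|).
Proof.
have := ler_normD x y; have : 0 <= `|x| * `|y| by rewrite mulr_ge0.
by rewrite mulrDl mul1r mulrDr mulr1; lra.
Qed.

End norms.

(** * Complex integrals *)

Section cintegral.
Variables (R : realType) (n : nat).
Local Notation leb := (lebesgue_rV R n).
Implicit Types (F G : 'rV[R]_n -> R[i]) (g : 'rV[R]_n -> R).

Definition cintegrable F :=
  leb.-integrable setT (EFin \o (fun x => complex.Re (F x))) /\
  leb.-integrable setT (EFin \o (fun x => complex.Im (F x))).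

Lemma cintegrableW F g : cmeasurable F -> (forall x, modc (F x) <= g x) ->
  leb.-integrable setT (EFin \o g) -> cintegrable F.
Proof.
move=> [F1 F2] Fg ig.
have mg : forall x, `|g x| = g x.
  by move=> x; rewrite ger0_norm// (le_trans (modc_ge0 _) (Fg x)).
split; apply: le_integrable ig => //=; try exact/measurable_EFinP.
- by move=> x _; rewrite lee_fin mg (le_trans (normr_Re_le _)).
- by move=> x _; rewrite lee_fin mg (le_trans (normr_Im_le _)).
Qed.

Lemma cintegrable_wt F B : cmeasurable F ->
  (forall x, modc (F x) <= B * wt (2 * n) x) -> cintegrable F.
Proof.
move=> mF FB; apply: cintegrableW mF FB _.
rewrite (_ : _ \o _ = fun x => (B%:E * (EFin \o wt (2 * n)) x)%E)//.
exact: integrableZl (integrable_wt R n).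
Qed.

Lemma cintegrable_cmeasurable F : cintegrable F -> cmeasurable F.
Proof. by move=> [/measurable_int/measurable_EFinP F1 /measurable_int/measurable_EFinP F2]. Qed.

Lemma cintegrableD F G : cintegrable F -> cintegrable G ->
  cintegrable (fun x => F x + G x).
Proof.
move=> [F1 F2] [G1 G2]; split.
  rewrite (_ : _ \o _ = (EFin \o (fun x => complex.Re (F x))) \+
     (EFin \o (fun x => complex.Re (G x))))%E; first exact: integrableD.
  by apply/funext => x /=; rewrite cReD.
rewrite (_ : _ \o _ = (EFin \o (fun x => complex.Im (F x))) \+
   (EFin \o (fun x => complex.Im (G x))))%E; first exact: integrableD.
by apply/funext => x /=; rewrite cImD.
Qed.

Lemma cintegralD F G : cintegrable F -> cintegrable G ->
  cintegral (fun x => F x + G x) = cintegral F + cintegral G.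
Proof.
move=> [F1 F2] [G1 G2]; apply: complex_eq.
  by rewrite cReD /= -RintegralD//; apply: eq_Rintegral => x _; rewrite cReD.
by rewrite cImD /= -RintegralD//; apply: eq_Rintegral => x _; rewrite cImD.
Qed.

Lemma integrable_lin (u v : 'rV[R]_n -> R) (a b : R) :
  leb.-integrable setT (EFin \o u) -> leb.-integrable setT (EFin \o v) ->
  leb.-integrable setT (EFin \o (fun x => a * u x + b * v x)).
Proof.
move=> iu iv.
have -> : EFin \o (fun x => a * u x + b * v x) =
    ((fun x => a%:E * (EFin \o u) x) \+ (fun x => b%:E * (EFin \o v) x))%E by [].
by apply: integrableD => //; apply: integrableZl.
Qed.

Lemma Rintegral_lin (u v : 'rV[R]_n -> R) (a b : R) :
  leb.-integrable setT (EFin \o u) -> leb.-integrable setT (EFin \o v) ->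
  \int[leb]_x (a * u x + b * v x) = a * \int[leb]_x u x + b * \int[leb]_x v x.
Proof.
move=> iu iv; rewrite RintegralD//; first by rewrite !RintegralZl.
- exact: (@integrableZl _ _ _ leb setT measurableT a _ iu).
- exact: (@integrableZl _ _ _ leb setT measurableT b _ iv).
Qed.

Lemma cintegrableZ c F : cintegrable F -> cintegrable (fun x => c * F x).
Proof.
move=> [F1 F2]; split.
  rewrite (_ : (fun x => complex.Re _) = (fun x => complex.Re c * complex.Re (F x) + (- complex.Im c) * complex.Im (F x))).
    exact: integrable_lin.
  by apply/funext => x; rewrite cReM mulNr.
rewrite (_ : (fun x => complex.Im _) = (fun x => complex.Re c * complex.Im (F x) + complex.Im c * complex.Re (F x))).
  exact: integrable_lin.
by apply/funext => x; rewrite cImM.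
Qed.

Lemma cintegralZ c F : cintegrable F ->
  cintegral (fun x => c * F x) = c * cintegral F.
Proof.
move=> [F1 F2]; apply: complex_eq.
  rewrite cReM /= -mulNr -Rintegral_lin//.
  by apply: eq_Rintegral => x _; rewrite cReM mulNr.
rewrite cImM /= -Rintegral_lin//.
by apply: eq_Rintegral => x _; rewrite cImM.
Qed.

Lemma cintegrableN F : cintegrable F -> cintegrable (fun x => - F x).
Proof. 
move=> iF; rewrite (_ : (fun x => - F x) = (fun x => (-1) * F x)); last by apply/funext => x; rewrite mulN1r.
exact: cintegrableZ.
Qed.

Lemma cintegralN F : cintegrable F -> cintegral (fun x => - F x) = - cintegral F.
Proof. 
move=> iF; rewrite (_ : (fun x => - F x) = (fun x => (-1) * F x)); last by apply/funext => x; rewrite mulN1r.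
by rewrite cintegralZ// mulN1r.
Qed.

Lemma cintegralB F G : cintegrable F -> cintegrable G ->
  cintegral (fun x => F x - G x) = cintegral F - cintegral G.
Proof.
move=> iF iG; rewrite -cintegralN//; apply: cintegralD => //; exact: cintegrableN.
Qed.

Lemma cintegral0 : cintegral (fun _ : 'rV[R]_n => 0) = 0.
Proof.
by rewrite /cintegral /= /Rintegral integral0.
Qed.

Lemma cintegrable0 : cintegrable (fun _ : 'rV[R]_n => 0).
Proof. by split; exact: integrable0. Qed.

Lemma cintegrable_sum (I : Type) (s : seq I) (H : I -> 'rV[R]_n -> R[i]) :
  (forall i, cintegrable (H i)) -> cintegrable (fun x => \sum_(i <- s) H i x).
Proof.
move=> iH; elim: s => [|i s IH].
  by under eq_fun do rewrite big_nil; exact: cintegrable0.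
by under eq_fun do rewrite big_cons; exact: cintegrableD.
Qed.

Lemma cintegral_sum (I : Type) (s : seq I) (H : I -> 'rV[R]_n -> R[i]) :
  (forall i, cintegrable (H i)) ->
  cintegral (fun x => \sum_(i <- s) H i x) = \sum_(i <- s) cintegral (H i).
Proof.
move=> iH; elim: s => [|i s IH].
  by under eq_fun do rewrite big_nil; rewrite big_nil cintegral0.
under eq_fun do rewrite big_cons.
by rewrite big_cons -IH cintegralD//; exact: cintegrable_sum.
Qed.

(* The factor 2 comes from estimating the real and imaginary parts separately. *)
Lemma modc_cintegral F g : cintegrable F -> leb.-integrable setT (EFin \o g) ->
  (forall x, 0 <= g x) ->
  {ae leb, forall x, modc (F x) <= g x} -> modc (cintegral F) <= 2 * \int[leb]_x g x.
Proof.
move=> [F1 F2] ig g0 Fg.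
have key (u : 'rV[R]_n -> R) : leb.-integrable setT (EFin \o u) ->
    (forall x, `|u x| <= modc (F x)) -> `|\int[leb]_x u x| <= \int[leb]_x g x.
  move=> iu uF; apply: (le_trans (le_normr_Rintegral _ iu)) => //.
  have iau := integrable_norm iu.
  rewrite /Rintegral fine_le ?integrable_fin_num//.
  apply: ae_ge0_le_integral => //.
  - exact: (measurable_int _ iau).
  - by move=> x _; rewrite lee_fin.
  - exact: (measurable_int _ ig).
  - apply: filterS Fg => x Fgx _.
    by rewrite lee_fin (le_trans (uF x)).
rewrite mulr2n mulrDl mul1r; apply: (le_trans (modc_le _)); apply: lerD.
  by apply: key F1 _ => x; exact: normr_Re_le.
by apply: key F2 _ => x; exact: normr_Im_le.
Qed.

End cintegral.

(** * Integrals of functions that agree almost everywhere *)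

Section ae_integral.
Local Open Scope ereal_scope.
Context d (T : measurableType d) (R : realType) (mu : {measure set T -> \bar R}).

Import HBNNSimple.

(** The integral of a nonnegative function is the supremum over the simple functions below it,
    whether or not the function is measurable. *)
Lemma ge0_integral_mono (u v : T -> \bar R) : (forall x, 0 <= u x) ->
  (forall x, u x <= v x) -> \int[mu]_x u x <= \int[mu]_x v x.
Proof.
move=> u0 uv; have v0 x : 0 <= v x by apply: le_trans (uv x).
rewrite !ge0_integralTE//; apply: le_ereal_sup => _ [h hu <-].
by exists h => // x; exact: le_trans (hu x) (uv x).
Qed.

(** A simple function below [u] keeps its integral when it is set to 0 on the null set where [u] and
    [v] may differ, and it is then below [v]. *)
Lemma ae_ge0_integral_le (u v : T -> \bar R) : (forall x, 0 <= u x) ->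
  (forall x, 0 <= v x) -> {ae mu, forall x, u x = v x} ->
  \int[mu]_x u x <= \int[mu]_x v x.
Proof.
move=> u0 v0 [N [mN N0 uvN]].
rewrite [leLHS]ge0_integralTE//; apply: ub_ereal_sup => _ [h hu <-].
have mh : measurable_fun setT (EFin \o h) by exact/measurable_EFinP.
rewrite -integralT_nnsfun (ge0_negligible_integral _ _ _ _ N0)//=; last first.
  by move=> x _; rewrite lee_fin.
rewrite setTD integral_mkcond; apply: ge0_integral_mono => x.
  by apply: erestrict_ge0 => y _; rewrite lee_fin.
rewrite /patch; case: ifPn => // /set_mem xN.
have <- : u x = v x by apply: contrapT => uvx; apply: xN; exact: uvN.
exact: hu.
Qed.

(* Measurability is not assumed: the function f of the theorem is Borel only up to a
   null set. *)
Lemma ae_integral (u v : T -> \bar R) : {ae mu, forall x, u x = v x} ->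
  \int[mu]_x u x = \int[mu]_x v x.
Proof.
move=> uv; rewrite integralE [RHS]integralE; congr (_ - _); apply/eqP; rewrite eq_le.
  by apply/andP; split; apply: ae_ge0_integral_le => //; apply: filterS uv => x uvx;
    rewrite !funepos.unlock/= uvx.
by apply/andP; split; apply: ae_ge0_integral_le => //; apply: filterS uv => x uvx;
  rewrite !funeneg.unlock/= uvx.
Qed.

End ae_integral.

(** * Change of variables, Fubini and dominated convergence *)

Section change_of_variables.
Variables (R : realType) (n : nat).
Local Notation leb := (lebesgue_rV R n).
Implicit Types (F G : 'rV[R]_n -> R[i]) (g : 'rV[R]_n -> R).

Lemma ae_cintegral F G : {ae leb, forall x, F x = G x} -> cintegral F = cintegral G.
Proof.
move=> FG; rewrite /cintegral; congr Complex; congr fine; apply: ae_integral;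
  by apply: filterS FG => x ->.
Qed.

Lemma integrable_rV_affine (c : R) (b : 'rV[R]_n) g : c != 0 ->
  leb.-integrable setT (EFin \o g) ->
  leb.-integrable setT (EFin \o (fun x => g (c *: x + b))).
Proof.
move=> c0 /integrableP[mg ig]; apply/integrableP; split.
  by apply: (measurableT_comp mg); exact: measurable_rV_affine.
move: ig; rewrite (ge0_integral_rV_affine b c0)//=; last first.
  exact: (measurableT_comp (@abse_measurable R setT) mg).
have : (0 < (`|c| ^+ n)%:E)%E by rewrite lte_fin exprn_gt0// normr_gt0.
case: (integral _ _ _) => [r _ _|k0|_ _ //]; first exact: ltry.
by rewrite gt0_muley.
Qed.

Lemma Rintegral_rV_affine (c : R) (b : 'rV[R]_n) g : c != 0 ->
  leb.-integrable setT (EFin \o g) ->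
  \int[leb]_x g x = `|c| ^+ n * \int[leb]_x g (c *: x + b).
Proof.
move=> c0 ig; have ig' := integrable_rV_affine b c0 ig.
have mg := measurable_int _ ig.
rewrite /Rintegral -[X in X * _]/(fine (`|c| ^+ n)%:E) -fineM//; last first.
  exact: integrable_fin_num.
congr fine.
have -> : (\int[leb]_x (g (c *: x + b))%:E =
    \int[leb]_x ((EFin \o g)^\+ (c *: x + b)%R) -
    \int[leb]_x ((EFin \o g)^\- (c *: x + b)%R))%E.
  rewrite integralE; congr (_ - _)%E.
    by apply: eq_integral => x _; rewrite !funepos.unlock.
  by apply: eq_integral => x _; rewrite !funeneg.unlock.
rewrite integralE [X in (X - _)%E = _](ge0_integral_rV_affine b c0); last 2 first.
- exact: measurable_funepos.
- by [].
rewrite [X in (_ - X)%E = _](ge0_integral_rV_affine b c0); last 2 first.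
- exact: measurable_funeneg.
- by [].
have : (\int[leb]_x ((EFin \o g)^\+ (c *: x + b)%R))%E \is a fin_num.
  have := integrable_pos_fin_num measurableT ig'.
  by congr (_ \is a fin_num); apply: eq_integral => x _; rewrite !funepos.unlock.
move: (integral leb _ _) => P; move: (integral leb _ _) => N finP.
by rewrite muleBr// fin_num_adde_defr.
Qed.

Lemma cintegrable_affine (c : R) (b : 'rV[R]_n) F : c != 0 -> cintegrable F ->
  cintegrable (fun x => F (c *: x + b)).
Proof.
move=> c0 [F1 F2].
by split; [exact: (integrable_rV_affine b c0 F1)|exact: (integrable_rV_affine b c0 F2)].
Qed.

Lemma cintegral_affine (c : R) (b : 'rV[R]_n) F : c != 0 -> cintegrable F ->
  cintegral F = real_complex R (`|c| ^+ n) * cintegral (fun x => F (c *: x + b)).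
Proof.
move=> c0 [F1 F2]; apply: complex_eq.
  by rewrite cReM/= mul0r subr0; exact: (Rintegral_rV_affine b c0 F1).
by rewrite cImM/= mul0r addr0; exact: (Rintegral_rV_affine b c0 F2).
Qed.

(** A convolution-type majorant [h1 z * h2 (y - z)] is integrable in the pair, by Tonelli and
    translation invariance. The bound [K] makes every slice integrable, and not only almost every
    one, so that [fine] loses nothing in the inner integrals. *)
Lemma Rintegral_fubini (u : 'rV[R]_n -> 'rV[R]_n -> R) (h1 h2 : 'rV[R]_n -> R) (K : R) :
  measurable_fun setT (fun p : 'rV[R]_n * 'rV[R]_n => u p.1 p.2) ->
  leb.-integrable setT (EFin \o h1) -> leb.-integrable setT (EFin \o h2) ->
  (forall z, 0 <= h1 z <= K) -> (forall z, 0 <= h2 z <= K) ->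
  (forall y z, `|u y z| <= h1 z * h2 (y - z)) ->
  \int[leb]_y \int[leb]_z u y z = \int[leb]_z \int[leb]_y u y z.
Proof.
move=> mu ih1 ih2 hK1 hK2 uh.
have h10 z : 0 <= h1 z by have /andP[] := hK1 z.
have h20 z : 0 <= h2 z by have /andP[] := hK2 z.
have ih2' z : leb.-integrable setT (EFin \o (fun y => h2 (y - z))).
  have := integrable_rV_affine (- z) (oner_neq0 R) ih2.
  by under [X in EFin \o X]eq_fun do rewrite scale1r.
have iuz z : leb.-integrable setT (EFin \o (fun y => u y z)).
  apply: (le_integrable measurableT _ _ (integrableZl measurableT K (ih2' z))).
  - apply/measurable_EFinP.
    exact: (measurableT_comp mu (measurable_pair2 z)).
  - move=> y _ /=; rewrite lee_fin (le_trans (uh y z))//.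
    rewrite [leRHS]ger0_norm ?mulr_ge0//; last by have /andP[/le_trans + ?] := hK1 z; apply.
    by rewrite ler_wpM2r//; have /andP[] := hK1 z.
have iuy y : leb.-integrable setT (EFin \o (fun z => u y z)).
  apply: (le_integrable measurableT _ _ (integrableZl measurableT K ih1)).
  - apply/measurable_EFinP.
    exact: (measurableT_comp mu (measurable_pair1 y)).
  - move=> z _ /=; rewrite lee_fin (le_trans (uh y z))//.
    rewrite [leRHS]ger0_norm ?mulr_ge0//; last by have /andP[/le_trans + ?] := hK1 z; apply.
    by rewrite mulrC ler_wpM2r//; have /andP[] := hK2 (y - z).
have iu : (leb \x leb)%E.-integrable setT (EFin \o (fun p : 'rV[R]_n * 'rV[R]_n => u p.1 p.2)).
  apply/integrable21ltyP; first exact/measurable_EFinP.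
  apply: (@le_lt_trans _ _ (\int[leb]_z ((\int[leb]_y (h2 y)%:E) * (h1 z)%:E))%E).
    apply: ge0_integral_mono => z; first by apply: integral_ge0 => y _; rewrite abse_ge0.
    rewrite [X in (X * _)%E](ge0_integral_rV_affine (- z) (oner_neq0 R))//=; last first.
      exact: measurable_int ih2.
    rewrite normr1 expr1n mul1e muleC.
    under [X in (_ * X)%E]eq_integral do rewrite scale1r.
    rewrite -(ge0_integralZl leb measurableT (measurable_int _ (ih2' z))); last 2 first.
    - by move=> y _; rewrite lee_fin.
    - by rewrite lee_fin.
    apply: ge0_integral_mono => y; first by rewrite lee_fin.
    by rewrite /= -EFinM lee_fin.
  have Ih2 : (\int[leb]_y (h2 y)%:E)%E \is a fin_num by exact: integrable_fin_num ih2.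
  rewrite (ge0_integralZl leb measurableT (measurable_int _ ih1)); last 2 first.
  - by move=> y _; rewrite lee_fin.
  - by apply: integral_ge0 => y _; rewrite lee_fin.
  have Ih1 : (\int[leb]_y (EFin \o h1) y)%E \is a fin_num by exact: integrable_fin_num ih1.
  by rewrite -(fineK Ih1) -(fineK Ih2) -EFinM ltry.
have fub := Fubini iu; rewrite /Rintegral; congr fine.
transitivity (\int[leb]_y \int[leb]_z (u y z)%:E)%E.
  by apply: eq_integral => y _; rewrite fineK//; exact: integrable_fin_num (iuy y).
transitivity (\int[leb]_z \int[leb]_y (u y z)%:E)%E; first exact: fub.
by apply: eq_integral => z _; rewrite fineK//; exact: integrable_fin_num (iuz z).
Qed.

Lemma cintegral_fubini (F : 'rV[R]_n -> 'rV[R]_n -> R[i]) (h1 h2 : 'rV[R]_n -> R) (K : R) :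
  cmeasurable (fun p : 'rV[R]_n * 'rV[R]_n => F p.1 p.2) ->
  leb.-integrable setT (EFin \o h1) -> leb.-integrable setT (EFin \o h2) ->
  (forall z, 0 <= h1 z <= K) -> (forall z, 0 <= h2 z <= K) ->
  (forall y z, modc (F y z) <= h1 z * h2 (y - z)) ->
  cintegral (fun y => cintegral (F y)) = cintegral (fun z => cintegral (F^~ z)).
Proof.
move=> [m1 m2] ih1 ih2 hK1 hK2 Fh; apply: complex_eq => /=.
  apply: (Rintegral_fubini m1 ih1 ih2 hK1 hK2) => y z.
  exact: le_trans (normr_Re_le _) (Fh y z).
apply: (Rintegral_fubini m2 ih1 ih2 hK1 hK2) => y z.
exact: le_trans (normr_Im_le _) (Fh y z).
Qed.

(** Stated for integrals that do not depend on [m], the form in which trigonometric approximations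
    are used below. *)
Lemma Rintegral_dct (u_ : nat -> 'rV[R]_n -> R) (u g : 'rV[R]_n -> R) (c : R) :
  (forall m, measurable_fun setT (u_ m)) -> leb.-integrable setT (EFin \o g) ->
  (forall m x, `|u_ m x| <= g x) -> (forall x, u_ m x @[m --> \oo] --> u x) ->
  (forall m, \int[leb]_x u_ m x = c) -> \int[leb]_x u x = c.
Proof.
move=> mu ig ug uu uc.
have mu' : measurable_fun setT u.
  by apply: (measurable_fun_cvg mu) => x _; exact: uu.
have [] := @dominated_convergence _ _ _ leb setT measurableT (fun m => EFin \o u_ m) (EFin \o u) (EFin \o g).
- by move=> m; exact/measurable_EFinP.
- exact/measurable_EFinP.
- by apply: aeW => x _; apply: cvg_EFin; [exact: nearW|exact: uu].
- exact: ig.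
- by apply: aeW => x m _; rewrite lee_fin.
move=> iu _ cv.
have iu_ m : leb.-integrable setT (EFin \o u_ m).
  apply: le_integrable ig => //; first exact/measurable_EFinP.
  by move=> x _ /=; rewrite lee_fin (le_trans (ug m x))// ler_norm.
have : (\int[leb]_x (EFin \o u_ m) x)%E @[m --> \oo] --> c%:E.
  rewrite (_ : (fun _ => _) = fun=> c%:E); first exact: cvg_cst.
  apply/funext => m; rewrite -(uc m) /Rintegral fineK//.
  exact: integrable_fin_num (iu_ m).
move=> cv'; rewrite /Rintegral.
by rewrite (cvg_unique _ cv cv').
Qed.

End change_of_variables.

(** * Polynomials *)

Section ccontinuous.
Variables (R : realType) (n : nat).
Implicit Types F G : 'rV[R]_n -> R[i].

(** Stated with the real-valued [modc], because the norm of [R[i]] takes its values in [R[i]]. *)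
Definition ccontinuous F := forall (x : 'rV[R]_n) (e : R), 0 < e ->
  exists2 d : R, 0 < d & forall y : 'rV[R]_n, `|y - x| < d -> modc (F y - F x) < e.

Lemma ccontinuous_cst c : ccontinuous (fun=> c).
Proof. by move=> x e e0; exists 1 => // y _; rewrite subrr modc0. Qed.

Lemma ccontinuous_coord i : ccontinuous (fun y => real_complex R (y ord0 i)).
Proof.
move=> x e e0; exists e => // y; apply: le_lt_trans.
rewrite -rmorphB modc_real.
by have := coord_le_norm (y - x) i; rewrite !mxE.
Qed.

Lemma ccontinuousD F G : ccontinuous F -> ccontinuous G ->
  ccontinuous (fun y => F y + G y).
Proof.
move=> cF cG x e e0; have e2 : 0 < e / 2 by lra.
have [d d0 Fd] := cF x _ e2; have [d' d'0 Gd] := cG x _ e2.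
exists (Num.min d d') => [|y]; first by rewrite lt_min d0.
rewrite lt_min => /andP[/Fd h1 /Gd h2].
rewrite opprD addrACA (le_lt_trans (modcD _ _))//; lra.
Qed.

Lemma ccontinuousM F G : ccontinuous F -> ccontinuous G ->
  ccontinuous (fun y => F y * G y).
Proof.
move=> cF cG x e e0.
pose a := 1 + modc (F x) + modc (G x).
have a0 : 1 <= a by have := modc_ge0 (F x); have := modc_ge0 (G x); rewrite /a; lra.
(* The bound 1 makes the product of the two increments at most one of them; the total is then at
   most [a] times the sum of the increments. *)
have e2 : 0 < Num.min 1 (e / (2 * a)) by rewrite lt_min ltr01 divr_gt0//; lra.
have [d d0 Fd] := cF x _ e2; have [d' d'0 Gd] := cG x _ e2.
exists (Num.min d d') => [|y]; first by rewrite lt_min d0.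
rewrite lt_min => /andP[/Fd + /Gd].
rewrite !lt_min => /andP[h1 h1'] /andP[h2 h2'].
have -> : F y * G y - F x * G x = (F y - F x) * (G y - G x) + (F x * (G y - G x) + (F y - F x) * G x) by ring.
apply: (le_lt_trans (modcD _ _)); rewrite modcM.
have := modcD (F x * (G y - G x)) ((F y - F x) * G x); rewrite !modcM.
move: h1 h1' h2 h2'; rewrite !ltr_pdivlMr; try lra.
have := modc_ge0 (F x); have := modc_ge0 (G x); have := modc_ge0 (F y - F x).
have := modc_ge0 (G y - G x); move: a0; rewrite /a.
set r := modc (F y - F x); set t := modc (G y - G x).
set p := modc (F x); set q := modc (G x); set w := modc (_ + _).
move=> a0 t0 r0 q0 p0 r1 ra t1 ta w1.
apply: (@le_lt_trans _ _ (t + (p * t + r * q))).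
  by apply: lerD => //; rewrite ler_piMl//; lra.
have := mulr_ge0 t0 q0; have := mulr_ge0 r0 p0; lra.
Qed.

Lemma ccontinuousX F m : ccontinuous F -> ccontinuous (fun y => F y ^+ m).
Proof.
move=> cF; elim: m => [|m IH]; first exact: ccontinuous_cst.
by under eq_fun do rewrite exprS; exact: ccontinuousM.
Qed.

Lemma ccontinuous_sum (I : Type) (s : seq I) (F : I -> 'rV[R]_n -> R[i]) :
  (forall i, ccontinuous (F i)) -> ccontinuous (fun y => \sum_(i <- s) F i y).
Proof.
move=> cF; elim: s => [|i s IH].
  by under eq_fun do rewrite big_nil; exact: ccontinuous_cst.
by under eq_fun do rewrite big_cons; exact: ccontinuousD.
Qed.

Lemma ccontinuous_prod (I : Type) (s : seq I) (F : I -> 'rV[R]_n -> R[i]) :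
  (forall i, ccontinuous (F i)) -> ccontinuous (fun y => \prod_(i <- s) F i y).
Proof.
move=> cF; elim: s => [|i s IH].
  by under eq_fun do rewrite big_nil; exact: ccontinuous_cst.
by under eq_fun do rewrite big_cons; exact: ccontinuousM.
Qed.

Lemma ccontinuous_cmeasurable F : ccontinuous F -> cmeasurable F.
Proof.
have norm_lt (x y : 'rV[R]_n) (d : R) : 0 < d ->
    (forall i, `|y ord0 i - x ord0 i| < d) -> `|y - x| < d.
  move=> d0 h; have [->//|] := eqVneq `|y - x| 0.
  move=> /mx_norm_neq0[[i j] /= E]; rewrite [ltLHS]E.
  by rewrite !mxE (ord1 i); exact: h.
move=> cF; split; apply: measurable_continuous_rV; apply: continuous_rVP => x e e0.
  have [d d0 Fd] := cF x e e0; exists d => // y /(norm_lt _ _ _ d0) /Fd.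
  by apply: le_lt_trans; rewrite -cReN -cReD normr_Re_le.
have [d d0 Fd] := cF x e e0; exists d => // y /(norm_lt _ _ _ d0) /Fd.
by apply: le_lt_trans; rewrite -cImN -cImD normr_Im_le.
Qed.

End ccontinuous.

Section polynomials.
Variables (R : realType) (n : nat).
Implicit Types (x y : 'rV[R]_n) (P : mpoly n R[i]) (e : 'I_n -> nat).

Definition mono e y : R := \prod_(i < n) y ord0 i ^+ e i.

(** Turns [P] into a finite list of coefficients and exponents. Growth, continuity and moments are
    then proved monomial by monomial, with the degree under control. *)
Lemma peval_expand k P : (mmeasure mdeg P <= k.+1)%N ->
  exists s : seq (R[i] * ('I_n -> nat)),
    (forall p, List.In p s -> (\sum_(i < n) p.2 i <= k)%N) /\
    forall y, peval P y = \sum_(p <- s) p.1 * real_complex R (mono p.2 y).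
Proof.
move=> Pk; exists [seq (mcoeff m P, fun i => m i) | m <- msupp P]; split.
  move=> p /List.in_map_iff[m [<- mP]] /=; rewrite -mdegE -ltnS.
  apply: leq_trans Pk; apply: mmeasure_mnm_lt.
  elim: (msupp P) mP => //= a s IH [->|/IH]; rewrite inE ?eqxx// => ->.
  by rewrite orbT.
move=> y; rewrite /peval mevalE [RHS]big_map; apply: eq_bigr => m _ /=.
by rewrite /mono rmorph_prod; congr (_ * _); apply: eq_bigr => i _; rewrite rmorphXn.
Qed.

Definition polyfun k (F : 'rV[R]_n -> R[i]) :=
  exists2 P, (mmeasure mdeg P <= k.+1)%N & forall y, peval P y = F y.

Lemma polyfunW k l F : (k <= l)%N -> polyfun k F -> polyfun l F.
Proof. by move=> kl [P Pk PF]; exists P => //; exact: leq_trans Pk _. Qed.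

Lemma polyfun_cst c : polyfun 0 (fun=> c).
Proof.
exists (mpolyC n c) => [|y]; first by rewrite mmeasureC; case: (_ == _).
by rewrite /peval mevalC.
Qed.

Lemma polyfun_coord i : polyfun 1 (fun y => real_complex R (y ord0 i)).
Proof.
exists (mpolyX R[i] (mnm1 i)) => [|y]; first by rewrite msizeX mdeg1.
by rewrite /peval mevalXU.
Qed.

Lemma polyfunD k F G : polyfun k F -> polyfun k G -> polyfun k (fun y => F y + G y).
Proof.
move=> [P Pk PF] [Q Qk QG]; exists (P + Q) => [|y]; last by rewrite /peval mevalD -PF -QG.
by rewrite (leq_trans (mmeasureD_le _ _ _))// geq_max Pk.
Qed.

Lemma polyfunM k l F G : polyfun k F -> polyfun l G ->
  polyfun (k + l) (fun y => F y * G y).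
Proof.
move=> [P Pk PF] [Q Qk QG]; exists (P * Q) => [|y]; last by rewrite /peval mevalM -PF -QG.
have [->|P0] := eqVneq P 0; first by rewrite mul0r mmeasure0.
have [->|Q0] := eqVneq Q 0; first by rewrite mulr0 mmeasure0.
rewrite msizeM//.
move: Pk Qk; move: (mmeasure _ P) (mmeasure _ Q) => a b ha hb.
by move: (leq_add ha hb); rewrite addSn addnS; case: (a + b)%N.
Qed.

Lemma polyfunX k F m : polyfun k F -> polyfun (m * k) (fun y => F y ^+ m).
Proof.
move=> pF; elim: m => [|m IH]; first exact: polyfun_cst.
by under eq_fun do rewrite exprS; rewrite mulSn; exact: polyfunM.
Qed.

Lemma polyfun_sum (I : Type) (s : seq I) k (F : I -> 'rV[R]_n -> R[i]) :
  (forall i, List.In i s -> polyfun k (F i)) -> polyfun k (fun y => \sum_(i <- s) F i y).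
Proof.
elim: s => [|i s IH] pF.
  by under eq_fun do rewrite big_nil; exact: polyfunW (leq0n _) (polyfun_cst _).
under eq_fun do rewrite big_cons; apply: polyfunD; first by apply: pF; left.
by apply: IH => j js; apply: pF; right.
Qed.

Lemma polyfun_prod (I : Type) (s : seq I) (k : I -> nat) (F : I -> 'rV[R]_n -> R[i]) :
  (forall i, polyfun (k i) (F i)) ->
  polyfun (\sum_(i <- s) k i) (fun y => \prod_(i <- s) F i y).
Proof.
move=> pF; elim: s => [|i s IH].
  rewrite big_nil (_ : (fun _ => _) = fun=> 1); first exact: polyfun_cst.
  by apply/funext => y; rewrite big_nil.
rewrite big_cons (_ : (fun _ => _) = fun y => F i y * \prod_(i <- s) F i y).
  exact: polyfunM.
by apply/funext => y; rewrite big_cons.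
Qed.

Lemma mono_le e y : `|mono e y| <= (1 + `|y|) ^+ (\sum_(i < n) e i).
Proof.
rewrite /mono normr_prod -prodrXr; apply: ler_prod => i _; rewrite normr_ge0/= normrX.
rewrite lerXn2r ?nnegrE ?(ltW (norm1_gt0 _))//.
by rewrite (le_trans (coord_le_norm y i))// lerDr.
Qed.

Lemma monoE e y :
  real_complex R (mono e y) = \prod_(i < n) real_complex R (y ord0 i) ^+ e i.
Proof. by rewrite /mono rmorph_prod; apply: eq_bigr => i _; rewrite rmorphXn. Qed.

Lemma mono_ccontinuous e : ccontinuous (fun y => real_complex R (mono e y)).
Proof.
rewrite (funext (monoE e)); apply: ccontinuous_prod => i.
by apply: ccontinuousX; exact: ccontinuous_coord.
Qed.

Lemma polyfun_affine e x (h : R) :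
  polyfun (\sum_(i < n) e i) (fun u => real_complex R (mono e (x + h *: u))).
Proof.
rewrite (funext (fun u => monoE e (x + h *: u))).
apply: polyfun_prod => i; rewrite -[X in polyfun X _]muln1; apply: polyfunX.
rewrite (_ : (fun _ => _) = fun u : 'rV[R]_n => real_complex R (x ord0 i) +
    real_complex R h * real_complex R (u ord0 i)); last first.
  by apply/funext => u; rewrite !mxE rmorphD rmorphM.
apply: polyfunD; first by apply: polyfunW (leq0n 1) (polyfun_cst _).
rewrite -[X in polyfun X _]add0n.
by apply: polyfunM; [exact: polyfun_cst|exact: polyfun_coord].
Qed.

Lemma peval_affine k P x (h : R) : (mmeasure mdeg P <= k.+1)%N ->
  polyfun k (fun u => peval P (x + h *: u)).
Proof.
move=> /peval_expand[s [sk Ps]]; rewrite (funext (fun u => Ps (x + h *: u))).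
apply: polyfun_sum => p ps; rewrite -[k]add0n; apply: polyfunM; first exact: polyfun_cst.
by apply: polyfunW (sk p ps) _; exact: polyfun_affine.
Qed.

Lemma peval_ccontinuous P : ccontinuous (peval P).
Proof.
have [s [_ Ps]] := peval_expand (leqnSn (mmeasure mdeg P)).
have -> : peval P = fun y => \sum_(p <- s) p.1 * real_complex R (mono p.2 y).
  exact/funext.
apply: ccontinuous_sum => p; apply: ccontinuousM; first exact: ccontinuous_cst.
exact: mono_ccontinuous.
Qed.

Lemma peval_growth k P : (mmeasure mdeg P <= k.+1)%N ->
  exists B, forall y, modc (peval P y) <= B * (1 + `|y|) ^+ k.
Proof.
move=> /peval_expand[s [sk Ps]]; exists (\sum_(p <- s) modc p.1) => y.
rewrite Ps (le_trans (modc_sum _ _))// {Ps}.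
elim: s sk => [|p s IH] sk; first by rewrite !big_nil mul0r.
rewrite !big_cons mulrDl lerD//; last by apply: IH => q qs; apply: sk; right.
rewrite modcM modc_real ler_wpM2l ?modc_ge0// (le_trans (mono_le _ _))//.
by rewrite ler_weXn2l ?norm1_ge1// sk//; left.
Qed.

End polynomials.

(** * Growth of a polynomial that is bounded on a ball *)

Section lines.
Variable R : realType.
Implicit Types f g : R -> R[i].

Definition polyline k f :=
  exists2 q : {poly R[i]}, (size q <= k.+1)%N & forall t, q.[real_complex R t] = f t.

Lemma polyline_cst k c : polyline k (fun=> c).
Proof.
exists c%:P => [|t]; last by rewrite hornerC.
by rewrite (leq_trans (size_polyC_leq1 _)).
Qed.

Lemma polylineD k f g : polyline k f -> polyline k g -> polyline k (fun t => f t + g t).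
Proof.
move=> [p pk pf] [q qk qg]; exists (p + q) => [|t]; last by rewrite hornerD pf qg.
by rewrite (leq_trans (size_polyD _ _))// geq_max pk.
Qed.

Lemma polylineM k l f g : polyline k f -> polyline l g ->
  polyline (k + l) (fun t => f t * g t).
Proof.
move=> [p pk pf] [q qk qg]; exists (p * q) => [|t]; last by rewrite hornerM pf qg.
rewrite (leq_trans (size_polyMleq _ _))//.
by move: (leq_add pk qk); rewrite addSn addnS; case: (_ + _)%N.
Qed.

Lemma polylineW k l f : (k <= l)%N -> polyline k f -> polyline l f.
Proof. by move=> kl [q qk qf]; exists q => //; exact: leq_trans qk _. Qed.

Lemma polyline_lin a b : polyline 1 (fun t => real_complex R (a + t * b)).
Proof.
exists ((real_complex R a)%:P + (real_complex R b) *: 'X) => [|t].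
  rewrite (leq_trans (size_polyD _ _))// geq_max (leq_trans (size_polyC_leq1 _))//=.
  by rewrite (leq_trans (size_scale_leq _ _))// size_polyX.
by rewrite hornerD hornerC hornerZ hornerX rmorphD rmorphM mulrC.
Qed.

Lemma polyline_mono n (e : 'I_n -> nat) (x v : 'rV[R]_n) :
  polyline (\sum_(i < n) e i) (fun t => real_complex R (mono e (x + t *: v))).
Proof.
rewrite (funext (fun t => monoE e (x + t *: v))); elim: (index_enum _) => [|i s IH].
  rewrite big_nil (_ : (fun _ => _) = fun=> 1); first exact: polyline_cst.
  by apply/funext => t; rewrite big_nil.
rewrite big_cons (_ : (fun _ => _) = fun t => real_complex R (x ord0 i + t * v ord0 i) ^+ e i *
   \prod_(i <- s) real_complex R ((x + t *: v) ord0 i) ^+ e i); last first.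
  by apply/funext => t; rewrite big_cons !mxE.
apply: polylineM => //; elim: (e i) => [|m IHm]; first exact: polyline_cst.
rewrite (_ : (fun _ => _) = fun t => real_complex R (x ord0 i + t * v ord0 i) *
  real_complex R (x ord0 i + t * v ord0 i) ^+ m); last by apply/funext => t; rewrite exprS.
by rewrite -[m.+1]add1n; apply: polylineM => //; exact: polyline_lin.
Qed.

Lemma polyline_peval n k (P : mpoly n R[i]) (x v : 'rV[R]_n) :
  (mmeasure mdeg P <= k.+1)%N -> polyline k (fun t => peval P (x + t *: v)).
Proof.
move=> /peval_expand[s [sk Ps]]; rewrite (funext (fun t => Ps (x + t *: v))) {Ps}.
elim: s sk => [|p s IH] sk.
  rewrite (_ : (fun _ => _) = fun=> 0); first exact: polyline_cst.
  by apply/funext => t; rewrite big_nil.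
rewrite (_ : (fun _ => _) = fun t => p.1 * real_complex R (mono p.2 (x + t *: v)) +
   \sum_(p <- s) p.1 * real_complex R (mono p.2 (x + t *: v))); last first.
  by apply/funext => t; rewrite big_cons.
apply: polylineD; last by apply: IH => q qs; apply: sk; right.
rewrite -[k]add0n; apply: polylineM; first exact: polyline_cst.
by apply: polylineW (polyline_mono _ _ _); apply: sk; left.
Qed.

Lemma horner_growth k (p : {poly R[i]}) : (size p <= k.+1)%N ->
  exists2 B, 0 <= B & forall t : R, 0 <= t -> modc p.[real_complex R t] <= B * (1 + t) ^+ k.
Proof.
move=> pk; exists (\sum_(i < k.+1) modc p`_i) => [|t t0].
  by apply: sumr_ge0 => i _; exact: modc_ge0.
rewrite (horner_coef_wide _ pk) (le_trans (modc_sum _ _))// mulr_suml.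
apply: ler_sum => i _; rewrite modcM ler_wpM2l ?modc_ge0//.
rewrite -rmorphXn modc_real ger0_norm ?exprn_ge0//.
apply: (@le_trans _ _ ((1 + t) ^+ i)).
  by rewrite lerXn2r ?nnegrE ?addr_ge0// lerDr.
by rewrite ler_weXn2l ?lerDl// -ltnS.
Qed.

(** A polynomial of degree at most [k] is interpolated at the nodes [i / (k + 1)], [i <= k], of the
    unit interval, where its values are at most [A]. [C] is the sum of the growth constants of the
    Lagrange basis, so it depends on [k] only. *)
Lemma lagrange_growth k : exists2 C : R, 0 <= C &
  forall (q : {poly R[i]}) A, (size q <= k.+1)%N ->
    (forall t : R, 0 <= t <= 1 -> modc q.[real_complex R t] <= A) ->
    forall t : R, 0 <= t -> modc q.[real_complex R t] <= C * A * (1 + t) ^+ k.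
Proof.
pose x (i : nat) : R[i] := real_complex R (i%:R / k.+1%:R).
have xI : injective x.
  move=> i j /complexI /(mulIf _) h; apply/eqP; rewrite -(eqr_nat R); apply/eqP/h.
  by rewrite invr_eq0 pnatr_eq0.
have /choice[B Bx] : forall i : 'I_k.+1, exists B, 0 <= B /\ forall t : R, 0 <= t ->
    modc (tnth (k.+1.-lagrange x) i : {poly R[i]}).[real_complex R t] <= B * (1 + t) ^+ k.
  move=> i; have [|B B0 h] := @horner_growth k (tnth (k.+1.-lagrange x) i : {poly R[i]}).
    by rewrite size_lagrange_.
  by exists B.
exists (\sum_i B i) => [|q A qk qA t t0].
  by apply: sumr_ge0 => i _; have [] := Bx i.
rewrite {1}(lagrange_gen (ltn0Sn k) xI qk) horner_sum (le_trans (modc_sum _ _))//.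
rewrite mulrAC -mulrA [(_ ^+ k * _)]mulrC mulr_suml; apply: ler_sum => i _.
have [B0 /(_ t t0) hB] := Bx i.
have qi : modc q.[x i] <= A.
  apply: qA; rewrite divr_ge0//= ler_pdivrMr ?ltr0n// mul1r ler_nat.
  exact: ltnW.
rewrite hornerM hornerC modcM mulrA [B i * A]mulrC -mulrA.
by rewrite ler_pM ?modc_ge0.
Qed.

(** On the ray from [x] through [y], in units of [r], the polynomial has one variable, is bounded by
    [A] on the unit interval, and is evaluated at [t = |y - x| / r]. *)
Lemma peval_ball_growth n k : exists2 C : R, 0 <= C &
  forall (P : mpoly n R[i]) (x : 'rV[R]_n) (r A : R), (mmeasure mdeg P <= k.+1)%N -> 0 < r ->
    (forall y, `|y - x| <= r -> modc (peval P y) <= A) ->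
    forall y, modc (peval P y) <= C * A * (1 + `|y - x| / r) ^+ k.
Proof.
have [C C0 HC] := lagrange_growth k; exists C => // P x r A Pk r0 PA y.
(* For [y = x] the slope is 0 by the convention on division, and the line reduces to the point
   [x]. *)
have [q qk qP] := polyline_peval x ((r / `|y - x|) *: (y - x)) Pk.
have t0 : 0 <= `|y - x| / r by rewrite divr_ge0// ltW.
have := HC q A qk _ _ t0; rewrite qP scalerA.
have -> : x + (`|y - x| / r * (r / `|y - x|)) *: (y - x) = y.
  have [/eqP|yx] := eqVneq `|y - x| 0.
    by rewrite normr_eq0 subr_eq0 => /eqP ->; rewrite subrr scaler0 addr0.
  rewrite mulrA divfK ?gt_eqF// divff// scale1r addrC subrK//.
apply => t /andP[tge0 t1]; rewrite qP; apply: PA.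
rewrite addrC addKr scalerA normrZ normrM (ger0_norm tge0).
have [->|yx] := eqVneq `|y - x| 0; first by rewrite mulr0 ltW.
rewrite (@ger0_norm _ (r / _)) ?divr_ge0// ?(ltW r0)// -mulrA divfK//.
by rewrite ler_piMl// ltW.
Qed.

(** By continuity a violation of the bound at one point would persist on a small cube, which has
    positive measure. *)
Lemma ae_ccontinuous_le n (F : 'rV[R]_n -> R[i]) (x : 'rV[R]_n) (r A : R) :
  ccontinuous F -> {ae lebesgue_rV R n, forall y, `|y - x| < r -> modc (F y) <= A} ->
  forall y, `|y - x| < r -> modc (F y) <= A.
Proof.
move=> cF aeF y yr; rewrite leNgt; apply/negP => yA.
have e0 : 0 < modc (F y) - A by rewrite subr_gt0.
have [d d0 Fd] := cF y _ e0.
pose rho := Num.min d (r - `|y - x|) / 2.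
have rho0 : 0 < rho by rewrite divr_gt0// lt_min d0 subr_gt0.
have [N [mN N0 badN]] := aeF.
have sub : cube y rho `<=` N.
  move=> z yz; apply: badN => /= h.
  have zy : `|z - y| <= rho.
    apply: norm_rV_le => [|i]; first exact: ltW.
    by rewrite !mxE distrC ltW//; exact: yz.
  have rd : rho < d.
    by rewrite ltr_pdivrMr//; apply: (@le_lt_trans _ _ d); rewrite ?ge_min ?lexx//; lra.
  have rr : rho < r - `|y - x|.
    have : 0 < r - `|y - x| by rewrite subr_gt0.
    rewrite ltr_pdivrMr// => ?; apply: (@le_lt_trans _ _ (r - `|y - x|)); first by rewrite ge_min lexx orbT.
    lra.
  have zr : `|z - x| < r.
    rewrite (_ : z - x = (z - y) + (y - x)); last by rewrite addrA subrK.
    by rewrite (le_lt_trans (ler_normD _ _))//; lra.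
  have := Fd z (le_lt_trans zy rd); have := h zr.
  have := modcB (F z) (F z - F y); rewrite opprB addrC subrK.
  by lra.
have : (lebesgue_rV R n (cube y rho) <= lebesgue_rV R n N)%E.
  by apply: le_measure => //; rewrite inE//; exact: measurable_cube.
rewrite lebesgue_cube// N0 lee_fin leNgt exprn_gt0//.
by rewrite mulrn_wgt0.
Qed.

End lines.

(** * Taylor expansion of averages *)

Section taylor_line.
Variable R : realType.

(** The sequence [g] lists successive derivatives. The derivative of [g 0] minus its Taylor
    polynomial is [g 1] minus a Taylor polynomial of one degree less, so each use of the mean value
    theorem gains a power of [r]. The factor [1 / m!] is given up. *)
Lemma taylor_line (g : nat -> R -> R) (m : nat) (r M t : R) :
  (forall (j : nat) (u : R), is_derive u 1 (g j) (g j.+1 u)) ->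
  (forall u, `|u| <= r -> `|g m u| <= M) -> `|t| <= r ->
  `|g 0%N t - (\poly_(j < m) (g j 0 / j`!%:R)).[t]| <= M * r ^+ m.
Proof.
elim: m g t => [|m IH] g t dg gM tr.
  by rewrite (_ : \poly_(j < 0) _ = 0) ?horner0 ?subr0 ?mulr1 ?gM// poly_def big_ord0.
pose p : {poly R} := \poly_(j < m.+1) (g j 0 / j`!%:R).
pose q : {poly R} := \poly_(j < m) (g j.+1 0 / j`!%:R).
have pq : p^`() = q.
  apply/polyP => j; rewrite coef_deriv !coef_poly ltnS; case: ifP => _; last by rewrite mul0rn.
  rewrite factS natrM -mulr_natr; field.
  by rewrite pnatr_eq0 -lt0n fact_gt0 -(natrD R 1 j) pnatr_eq0 add1n.
have dh (u : R) : is_derive u 1 (g 0%N - horner p) (g 1%N u - q.[u]).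
  by rewrite -pq; apply: is_deriveB.
have hM u : `|u| <= r -> `|g 1%N u - q.[u]| <= M * r ^+ m.
  by move=> ur; apply: (IH (fun j => g j.+1)).
have h0 : (g 0%N - horner p) 0 = 0.
  rewrite /= [X in X = _](_ : _ = g 0%N 0 - p.[0])// horner_coef0 coef_poly/= divr1.
  by rewrite subrr.
have r0 : 0 <= r by rewrite (le_trans _ tr).
have ch : continuous (g 0%N - horner p).
  move=> u; apply/differentiable_continuous/derivable1_diffP.
  by have [] := dh u.
(* The mean value theorem wants ordered endpoints; [key] serves both [[0, t]] and [[t, 0]]. *)
have key a b : a <= b -> (forall c, c \in `[a, b]%R -> `|c| <= `|t|) -> `|b - a| = `|t| ->
    `|(g 0%N - horner p) b - (g 0%N - horner p) a| <= M * r ^+ m.+1.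
  move=> ab abt abE.
  have [c cab ->] := MVT_segment ab (fun u _ => dh u) (continuous_subspaceT ch).
  rewrite normrM abE exprSr mulrA ler_pM// hM// (le_trans (abt c cab))//.
have -> : g 0%N t - p.[t] = (g 0%N - horner p) t by [].
have -> : (g 0%N - horner p) t = (g 0%N - horner p) t - (g 0%N - horner p) 0.
  by rewrite h0 subr0.
have [t0|t0] := leP 0 t.
  apply: key => //; rewrite ?subr0// => c.
  by rewrite in_itv/= => /andP[c0 ct]; rewrite !ger0_norm.
rewrite distrC; apply: key; rewrite ?(ltW t0) ?sub0r ?normrN// => c.
rewrite in_itv/= => /andP[ct c0]; rewrite ler0_norm// ler0_norm ?(ltW t0)//.
by rewrite lerN2.
Qed.

End taylor_line.

Section taylor_space.
Variables (R : realType) (n : nat).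
Implicit Types (g : 'rV[R]_n -> R) (c v w : 'rV[R]_n) (s : seq 'I_n).

Let e_ (i : 'I_n) : 'rV[R]_n := delta_mx ord0 i.

Lemma is_derive_coord_line g s i c (u : R) : schwartzR g ->
  is_derive u 1 (fun t : R => partials s g (c + t *: e_ i))
    (partials (i :: s) g (c + u *: e_ i)).
Proof.
move=> sg; have [_ /(_ i (c + u *: e_ i)) dg _] := sg s.
have E : (fun h : R => h^-1 *: (partials s g (c + (h *: (1 : R) + u) *: e_ i) -
    partials s g (c + u *: e_ i))) =
    (fun h : R => h^-1 *: (partials s g (h *: e_ i + (c + u *: e_ i)) -
      partials s g (c + u *: e_ i))).
  apply/funext => h; congr (_ *: (partials s g _ - _)).
  by rewrite [h *: 1]mulr1 scalerDl addrCA.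
apply: DeriveDef; first by rewrite /derivable E.
by rewrite /derive E.
Qed.

Definition restr (cs : seq 'I_n) v : 'rV[R]_n :=
  \row_j (if j \in cs then v ord0 j else 0).

Lemma restr_cons i cs v : i \notin cs -> restr (i :: cs) v = restr cs v + v ord0 i *: e_ i.
Proof.
move=> ics; apply/rowP => j; rewrite !mxE inE eqxx/=.
have [->|ji] := eqVneq j i; first by rewrite (negbTE ics) add0r mulr1.
by rewrite mulr0 addr0.
Qed.

Lemma In_flatten_map (I J : Type) (f : I -> seq J) (t : seq I) (p : J) :
  List.In p (flatten [seq f j | j <- t]) -> exists2 j, List.In j t & List.In p (f j).
Proof.
elim: t => //= j t IH /List.in_app_iff[pj|/IH[l lt pl]]; first by exists j => //; left.
by exists l => //; right.
Qed.

Lemma mono_shift i (j : nat) (e : 'I_n -> nat) v :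
  mono (fun l => (j * (l == i) + e l)%N) v = v ord0 i ^+ j * mono e v.
Proof.
rewrite /mono; under eq_bigr do rewrite exprD.
rewrite big_split/=; congr (_ * _).
rewrite (bigD1 i)//= eqxx muln1 big1 ?mulr1// => l /negbTE ->.
by rewrite muln0 expr0.
Qed.

Lemma norm_restr_line (cs : seq 'I_n) i v (u r : R) : i \notin cs ->
  (forall l, `|v ord0 l| <= r) -> 0 <= r -> `|u| <= r -> `|restr cs v + u *: e_ i| <= r.
Proof.
move=> ics vr r0 ur; apply: norm_rV_le => // l; rewrite !mxE eqxx/=.
have [->|li] := eqVneq l i; first by rewrite (negbTE ics) add0r mulr1.
by rewrite mulr0 addr0; case: ifP; rewrite ?normr0.
Qed.

(* The entries of L are (exponents of v, coefficient, directions of the derivative).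
   Coordinates outside cs are frozen, which allows an induction on cs by one-variable
   Taylor expansions. *)
Definition taylor_expansion (cs : seq 'I_n) k s
    (L : seq (('I_n -> nat) * R * seq 'I_n)) (C : R) :=
  forall g c v (r M : R), schwartzR g -> (forall i, `|v ord0 i| <= r) -> 0 <= r ->
    (forall s' w, size s' = (k.+1 + size s)%N -> `|w| <= r ->
      `|partials s' g (c + w)| <= M) ->
    `|partials s g (c + restr cs v) -
      \sum_(p <- L) p.1.2 * mono p.1.1 v * partials p.2 g c| <= C * M * r ^+ k.+1.

(** After expansion in the coordinate [i], the coefficient of [v_i^j] is a derivative with [j] more
    directions [i]. It is expanded in the remaining coordinates to order [k - j] only: the total
    degree stays at most [k] and the remainder is of size [r^(k-j+1) r^j]. [L] and [C] do not depend
    on the function, so that real and imaginary parts share one expansion. *)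
Lemma taylor_coords (cs : seq 'I_n) : uniq cs -> forall k s, exists L, exists C,
  [/\ forall p, List.In p L -> (\sum_(i < n) p.1.1 i <= k)%N, 0 <= C &
    taylor_expansion cs k s L C].
Proof.
elim: cs => [_|i cs IH /=/andP[ics ucs]] k s.
  exists [:: (fun=> 0%N, 1, s)]; exists 0; split => [p [<-|//]||]//; first by rewrite big1.
  move=> g c v r M _ _ _ _.
  rewrite big_seq1 /= (_ : restr [::] v = 0) ?addr0; last by apply/rowP => j; rewrite !mxE.
  by rewrite /mono big1 ?mulr1 ?mul1r ?subrr ?normr0 ?mul0r.
have /choice[L /choice[C /all_and3[HL C0 HC]]] := fun j => IH ucs (k - j)%N (nseq j i ++ s).
pose LL := flatten [seq [seq ((fun l => (j * (l == i) + p.1.1 l)%N), p.1.2 / j`!%:R, p.2)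
  | p <- L j] | j <- iota 0 k.+1].
exists LL; exists (1 + \sum_(j < k.+1) C j); split.
- move=> p pLL; have [j jk] := In_flatten_map pLL.
  move=> /List.in_map_iff[q [<- qL]].
  have {}jk : (j <= k)%N.
    have : j \in iota 0 k.+1 by elim: (iota 0 k.+1) jk => //= a t IHt [->|/IHt]; rewrite inE ?eqxx// => ->; rewrite orbT.
    by rewrite mem_iota.
  rewrite /= big_split/= (bigD1 i)//= eqxx muln1 big1 ?addn0; last first.
    by move=> l /negbTE ->; rewrite muln0.
  by rewrite -(subnKC jk) leq_add2l; exact: HL.
- by rewrite addr_ge0// sumr_ge0.
move=> g c v r M sg vr r0 gM.
pose G j (u : R) := partials (nseq j i ++ s) g (c + restr cs v + u *: e_ i).
have G1 : `|G 0%N (v ord0 i) - (\poly_(j < k.+1) (G j 0 / j`!%:R)).[v ord0 i]| <= M * r ^+ k.+1.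
  apply: taylor_line => // [j u|u ur].
    exact: (is_derive_coord_line (nseq j i ++ s)).
  rewrite /G -addrA; apply: gM; first by rewrite size_cat size_nseq.
  exact: norm_restr_line.
rewrite restr_cons// addrA -[partials s g _]/(G 0%N (v ord0 i)).
rewrite -(subrKA ((\poly_(j < k.+1) (G j 0 / j`!%:R)).[v ord0 i])).
apply: (le_trans (ler_normD _ _)); rewrite -mulrA mulrDl mul1r; apply: lerD => //.
have -> : \sum_(p <- LL) p.1.2 * mono p.1.1 v * partials p.2 g c =
    \sum_(j < k.+1) (\sum_(p <- L j) p.1.2 * mono p.1.1 v * partials p.2 g c) /
      j`!%:R * v ord0 i ^+ j.
  rewrite big_flatten big_map -[iota 0 k.+1]/(index_iota 0 k.+1) big_mkord.
  apply: eq_bigr => j _; rewrite big_map !mulr_suml; apply: eq_bigr => p _ /=.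
  by rewrite mono_shift; ring.
rewrite horner_poly -sumrB (le_trans (ler_norm_sum _ _ _))// mulr_suml.
apply: ler_sum => j _; rewrite -!mulrBl normrM normrX normrM.
have jk : (j <= k)%N by rewrite -ltnS.
have -> : r ^+ k.+1 = r ^+ (k - j).+1 * r ^+ j by rewrite -exprD addSn subnK.
rewrite !mulrA ler_pM// ?mulr_ge0//; last by rewrite lerXn2r ?nnegrE.
have h := HC j g c v r M sg vr r0.
rewrite /G scale0r addr0; set X := _ - _ in h *.
apply: (@le_trans _ _ `|X|).
  rewrite ler_piMr// ger0_norm ?invr_ge0// invf_le1 ?ltr0n ?fact_gt0//.
  by rewrite ler1n fact_gt0.
apply: h => s' w ss'; apply: gM.
by rewrite ss' size_cat size_nseq addnA addSn subnK.
Qed.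

Lemma restr_enum v : restr (enum 'I_n) v = v.
Proof. by apply/rowP => j; rewrite !mxE mem_enum. Qed.

End taylor_space.

(** * Taylor expansion of Schwartz functions *)

Section schwartz.
Variables (R : realType) (n : nat).
Implicit Types (c v x : 'rV[R]_n) (phi : 'rV[R]_n -> R[i]).

Definition cpartials (s : seq 'I_n) phi x : R[i] :=
  Complex (partials s (fun y => complex.Re (phi y)) x)
          (partials s (fun y => complex.Im (phi y)) x).

Definition decays phi := forall N, exists2 B, 0 <= B & forall x, modc (phi x) <= B * wt N x.

Lemma schwartzR_wt (g : 'rV[R]_n -> R) s N : schwartzR g ->
  exists2 B, 0 <= B & forall x, `|partials s g x| <= B * wt N x.
Proof.
move=> /(_ s)[_ _ /(_ N)[B gB]]; exists B.
  by rewrite (le_trans _ (gB 0))// mulr_ge0// exprn_ge0// addr_ge0// enorm_ge0.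
move=> x; rewrite ler_pdivlMr ?exprn_gt0 ?norm1_gt0// mulrC (le_trans _ (gB x))//.
rewrite ler_wpM2r// lerXn2r ?nnegrE ?addr_ge0 ?enorm_ge0//.
by rewrite lerD2l norm_le_enorm.
Qed.

Lemma schwartz_decays s phi : schwartz phi -> decays (cpartials s phi).
Proof.
move=> [p1 p2] N; have [B1 B10 h1] := schwartzR_wt s N p1.
have [B2 B20 h2] := schwartzR_wt s N p2.
exists (B1 + B2) => [|x]; first exact: addr_ge0.
apply: (le_trans (modc_le _)); rewrite mulrDl.
by apply: lerD; [exact: h1|exact: h2].
Qed.

Lemma schwartz_cmeasurable s phi : schwartz phi -> cmeasurable (cpartials s phi).
Proof.
by move=> [p1 p2]; split; apply: measurable_continuous_rV;
  [have [] := p1 s|have [] := p2 s].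
Qed.

Lemma cpartials_nil phi : cpartials [::] phi = phi.
Proof. by apply/funext => x; rewrite /cpartials/=; case: (phi x). Qed.

Lemma wt_shift N x v : wt N (x + v) <= (1 + `|v|) ^+ N * wt N x.
Proof.
rewrite /wt -ler_pdivrMl ?exprn_gt0 ?norm1_gt0// -invfM -exprMn.
rewrite lef_pV2 ?posrE ?exprn_gt0 ?mulr_gt0 ?norm1_gt0//.
rewrite lerXn2r ?nnegrE ?mulr_ge0 ?(ltW (norm1_gt0 _))//.
have := norm1D (x + v) (- v); by rewrite addrK normrN mulrC.
Qed.

Lemma cRe_sum (I : Type) (s : seq I) (F : I -> R[i]) :
  complex.Re (\sum_(i <- s) F i) = \sum_(i <- s) complex.Re (F i).
Proof. by elim: s => [|i s IH]; rewrite ?big_nil// !big_cons cReD IH. Qed.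

Lemma cIm_sum (I : Type) (s : seq I) (F : I -> R[i]) :
  complex.Im (\sum_(i <- s) F i) = \sum_(i <- s) complex.Im (F i).
Proof. by elim: s => [|i s IH]; rewrite ?big_nil// !big_cons cImD IH. Qed.

(** The remainder inherits the decay of the derivatives of order [k + 1]: they are taken within
    distance [r0] of [c], where the weight changes by a factor [(1 + r0)^N] at most. *)
Lemma schwartz_taylor phi k : schwartz phi ->
  exists L : seq (('I_n -> nat) * R * seq 'I_n),
    (forall p, List.In p L -> (\sum_(i < n) p.1.1 i <= k)%N) /\
    forall (r0 : R) N, 0 <= r0 -> exists2 B, 0 <= B & forall c v, `|v| <= r0 ->
      modc (phi (c + v) -
        \sum_(p <- L) real_complex R (p.1.2 * mono p.1.1 v) * cpartials p.2 phi c)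
      <= B * `|v| ^+ k.+1 * wt N c.
Proof.
move=> sphi; have [L [C [HL C0 HC]]] := taylor_coords R (enum_uniq 'I_n) k [::].
exists L; split=> // r0 N r00; have [p1 p2] := sphi.
have bnd (g : 'rV[R]_n -> R) : schwartzR g -> exists2 B, 0 <= B & forall c v, `|v| <= r0 ->
    `|g (c + v) - \sum_(p <- L) p.1.2 * mono p.1.1 v * partials p.2 g c|
    <= B * `|v| ^+ k.+1 * wt N c.
  move=> sg; have /choice[B HB] : forall s : k.+1.-tuple 'I_n, exists B, 0 <= B /\
      forall x, `|partials s g x| <= B * wt N x.
    by move=> s; have [B B0 h] := schwartzR_wt s N sg; exists B.
  (* There are finitely many strings of [k + 1] directions; the sum of their bounds serves for
     all. *)
  exists (C * (\sum_s B s * (1 + r0) ^+ N)).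
    by rewrite mulr_ge0// sumr_ge0// => s _; rewrite mulr_ge0 ?exprn_ge0 ?addr_ge0//; have [] := HB s.
  move=> c v vr.
  have := HC g c v `|v| ((\sum_s B s * (1 + r0) ^+ N) * wt N c) sg (coord_le_norm v) (normr_ge0 v).
  rewrite restr_enum mulrA mulrAC; apply => s w; rewrite addn0 => ss wv.
  have sE : s = tcast ss (in_tuple s) by rewrite val_tcast.
  rewrite sE; have [_ /(_ (c + w)) h] := HB (tcast ss (in_tuple s)).
  apply: (le_trans h); rewrite (bigD1 (tcast ss (in_tuple s)))//= mulrDl -mulrA.
  apply: ler_wpDr.
    rewrite mulr_ge0 ?wt_ge0// sumr_ge0// => s' _; rewrite mulr_ge0 ?exprn_ge0 ?addr_ge0//.
    by have [] := HB s'.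
  apply: ler_wpM2l; first by have [] := HB (tcast ss (in_tuple s)).
  apply: (le_trans (wt_shift _ _ _)); rewrite ler_wpM2r ?wt_ge0//.
  by rewrite lerXn2r ?nnegrE ?addr_ge0// lerD2l (le_trans wv).
have [B1 B10 h1] := bnd _ p1; have [B2 B20 h2] := bnd _ p2.
exists (B1 + B2) => [|c v vr]; first exact: addr_ge0.
rewrite (le_trans (modc_le _))// !mulrDl lerD//.
  rewrite cReD cReN cRe_sum (eq_bigr (fun p => p.1.2 * mono p.1.1 v * partials p.2 (fun y => complex.Re (phi y)) c)).
    exact: h1.
  by move=> p _; rewrite cReM/= mul0r subr0.
rewrite cImD cImN cIm_sum (eq_bigr (fun p => p.1.2 * mono p.1.1 v * partials p.2 (fun y => complex.Im (phi y)) c)).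
  exact: h2.
by move=> p _; rewrite cImM/= mul0r addr0.
Qed.

End schwartz.

(** * Averages against rapidly decaying kernels *)

Section averages.
Variables (R : realType) (n : nat).
Local Notation leb := (lebesgue_rV R n).
Implicit Types (x y z u v : 'rV[R]_n) (phi psi w : 'rV[R]_n -> R[i]).

Definition pgrowth w := exists B K, 0 <= B /\ forall z, modc (w z) <= B * (1 + `|z|) ^+ K.

Lemma bounded_pgrowth w B : (forall z, modc (w z) <= B) -> pgrowth w.
Proof.
move=> wB; exists B, 0%N; split; first by rewrite (le_trans _ (wB 0))// modc_ge0.
by move=> z; rewrite mulr1.
Qed.

(** The preimage of a null set is null by the change of variables for its indicator, since the
    factor [|c|^n] is not 0. *)
Lemma ae_rV_affine (c : R) (b : 'rV[R]_n) (P : 'rV[R]_n -> Prop) : c != 0 ->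
  {ae leb, forall z, P z} -> {ae leb, forall u, P (c *: u + b)}.
Proof.
move=> c0 [N [mN N0 PN]]; exists ((fun u => c *: u + b) @^-1` N); split.
- by rewrite -[X in measurable X]setTI; exact: measurable_rV_affine.
- have mN' : measurable ((fun u : 'rV[R]_n => c *: u + b) @^-1` N).
    by rewrite -[X in measurable X]setTI; exact: measurable_rV_affine.
  have m1 : measurable_fun setT (fun z : 'rV[R]_n => (\1_N z : R)%:E).
    by apply/measurable_EFinP; exact: measurable_indic.
  have /eqP := ge0_integral_rV_affine b c0 m1 (fun z => ltac:(by rewrite lee_fin)).
  have -> : (\int[leb]_x (\1_N (c *: x + b) : R)%:E)%E = leb ((fun u => c *: u + b) @^-1` N).
    by have := integral_indic leb measurableT mN'; rewrite setIT.
  have -> : (\int[leb]_x (\1_N x : R)%:E)%E = 0%E.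
    by have := integral_indic leb measurableT mN; rewrite setIT => ->; exact: N0.
  rewrite eq_sym mule_eq0 => /orP[|/eqP//].
  by rewrite eqe expf_eq0 normr_eq0 (negbTE c0) andbF.
- by move=> u /= Pu; apply: PN.
Qed.

Lemma norm1_affine (b h : R) x y u : 0 <= b -> b * `|h| <= 1 ->
  1 + b * `|y + h *: u - x| <= (1 + b * `|y - x|) * (1 + `|u|).
Proof.
move=> b0 bh.
have h1 : `|y + h *: u - x| <= `|y - x| + `|h| * `|u|.
  by rewrite addrAC -normrZ ler_normD.
have h2 : b * `|y + h *: u - x| <= b * `|y - x| + b * `|h| * `|u|.
  by rewrite -mulrA -mulrDr ler_wpM2l.
have h3 : b * `|h| * `|u| <= `|u| by rewrite ler_piMl.
have h4 : 0 <= b * `|y - x| * `|u| by rewrite !mulr_ge0.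
by rewrite mulrDl mul1r mulrDr mulr1; lra.
Qed.

Lemma pgrowth_affine w y (h : R) : pgrowth w -> pgrowth (fun u => w (y + h *: u)).
Proof.
move=> [B [K [B0 wB]]]; exists (B * ((1 + `|y|) * (1 + `|h|)) ^+ K), K; split.
  by rewrite mulr_ge0// exprn_ge0// mulr_ge0// addr_ge0.
move=> u; rewrite (le_trans (wB _))// -mulrA ler_wpM2l// -exprMn.
rewrite lerXn2r ?nnegrE ?mulr_ge0 ?addr_ge0//.
rewrite (le_trans (norm1D _ _))// -mulrA ler_wpM2l ?addr_ge0// normrZ.
have := mulr_ge0 (normr_ge0 h) (normr_ge0 u); have := normr_ge0 h; have := normr_ge0 u.
by rewrite mulrDl mul1r mulrDr mulr1; lra.
Qed.

Lemma decays_shift psi v : decays psi -> decays (fun u => psi (u + v)).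
Proof.
move=> dpsi N; have [B B0 h] := dpsi N.
exists (B * (1 + `|v|) ^+ N) => [|u]; first by rewrite mulr_ge0// exprn_ge0// addr_ge0.
by rewrite (le_trans (h _))// -mulrA ler_wpM2l// wt_shift.
Qed.

Lemma measurable_shift v : measurable_fun setT (fun u : 'rV[R]_n => u + v).
Proof.
by have := measurable_rV_affine 1 v; under eq_fun do rewrite scale1r.
Qed.

Lemma measurable_affine x (h : R) : measurable_fun setT (fun u : 'rV[R]_n => x + h *: u).
Proof.
by have := measurable_rV_affine h x; under eq_fun do rewrite addrC.
Qed.

Lemma cintegrable_pgrowth w psi : cmeasurable w -> pgrowth w ->
  cmeasurable psi -> decays psi -> cintegrable (fun u => w u * psi u).
Proof.
move=> mw [B [K [B0 wB]]] mpsi /(_ (K + 2 * n)%N)[B' B'0 psiB].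
apply: (@cintegrable_wt _ _ _ (B * B')); first exact: cmeasurableM.
move=> u; rewrite modcM (le_trans (ler_pM (modc_ge0 _) (modc_ge0 _) (wB u) (psiB u)))//.
by rewrite mulrACA wtM_expr.
Qed.

Lemma cintegrable_average w psi x (h : R) : cmeasurable w -> pgrowth w ->
  cmeasurable psi -> decays psi -> cintegrable (fun u => w (x + h *: u) * psi u).
Proof.
move=> mw pw mpsi dpsi; apply: cintegrable_pgrowth => //; last exact: pgrowth_affine.
exact: (cmeasurable_comp mw (measurable_affine x h)).
Qed.

Definition wt_int : R := \int[leb]_u wt (2 * n) u.

Lemma wt_int_ge0 : 0 <= wt_int.
Proof. by apply: Rintegral_ge0 => u _; exact: wt_ge0. Qed.

(** The condition [b * |h| <= 1] says that the average is taken at a scale no coarser than that of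
    the growth of [w]. At [y + h u] the growth factor then splits into the one at [y] and
    [(1 + |u|)^K]; the latter is absorbed by [K] powers of the weight, and the other [2 * n] make it
    integrable. *)
Lemma average_bound w psi y x (h b A B : R) K : cmeasurable w -> pgrowth w ->
  cmeasurable psi -> decays psi -> 0 <= b -> b * `|h| <= 1 -> h != 0 -> 0 <= A ->
  {ae leb, forall z, modc (w z) <= A * (1 + b * `|z - x|) ^+ K} ->
  (forall u, modc (psi u) <= B * wt (K + 2 * n) u) ->
  modc (cintegral (fun u => w (y + h *: u) * psi u)) <=
    2 * wt_int * (A * B) * (1 + b * `|y - x|) ^+ K.
Proof.
move=> mw pw mpsi dpsi b0 bh h0 A0 wA psiB.
have B0 : 0 <= B.
  have := le_trans (modc_ge0 _) (psiB 0).
  by rewrite pmulr_lge0// wt_gt0.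
pose D := A * B * (1 + b * `|y - x|) ^+ K.
have D0 : 0 <= D by rewrite !mulr_ge0// exprn_ge0// addr_ge0// mulr_ge0.
have iD : leb.-integrable setT (EFin \o (fun u => D * wt (2 * n) u)).
  rewrite (_ : _ \o _ = fun x => (D%:E * (EFin \o wt (2 * n)) x)%E)//.
  exact: integrableZl (integrable_wt R n).
rewrite (_ : _ * _ * _ * _ = 2 * \int[leb]_u (D * wt (2 * n) u)); last first.
  rewrite RintegralZl//; last exact: integrable_wt.
  by rewrite -/wt_int /D; ring.
apply: (modc_cintegral (cintegrable_average y h mw pw mpsi dpsi) iD).
  by move=> u; rewrite mulr_ge0// wt_ge0.
apply: filterS (ae_rV_affine y h0 wA) => u.
rewrite addrC modcM => wu.
apply: (le_trans (ler_pM (modc_ge0 _) (modc_ge0 _) wu (psiB u))).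
rewrite mulrACA /D -[leRHS]mulrA ler_wpM2l ?mulr_ge0//.
rewrite -(wtM_expr K (2 * n) u) mulrA ler_wpM2r ?wt_ge0// -exprMn.
by rewrite lerXn2r ?nnegrE ?mulr_ge0 ?addr_ge0 ?mulr_ge0// norm1_affine.
Qed.

(* psi is the Taylor remainder of u |-> phi (u + a *: v); it decays rapidly and has size
   (a |v|)^(k+1), so average_bound applies to it. *)
Lemma average_taylor phi k K (r0 : R) : schwartz phi -> 0 <= r0 ->
  exists2 C, 0 <= C & forall (a b A : R) w x, 0 <= b -> b <= a -> 0 < a -> 0 <= A ->
    cmeasurable w -> pgrowth w ->
    {ae leb, forall z, modc (w z) <= A * (1 + b * `|z - x|) ^+ K} ->
    exists2 P, (mmeasure mdeg P <= k.+1)%N & forall v, a * `|v| <= r0 ->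
      modc (cintegral (fun u => w (x + (- a^-1) *: u) * phi (u + a *: v)) -
            peval P (x + v)) <= C * A * (a * `|v|) ^+ k.+1.
Proof.
move=> sphi r00; have [L [Lk HL]] := schwartz_taylor k sphi.
have [B B0 {}HL] := HL r0 (K + 2 * n)%N r00.
have mphi := schwartz_cmeasurable [::] sphi; rewrite cpartials_nil in mphi.
have dphi := schwartz_decays [::] sphi; rewrite cpartials_nil in dphi.
exists (2 * wt_int * B); first by rewrite !mulr_ge0// wt_int_ge0.
move=> a b A w x b0 ba a0 A0 mw pw wA.
pose h := - a^-1; have h0 : h != 0 by rewrite oppr_eq0 invr_eq0 gt_eqF.
have bh : b * `|h| <= 1.
  by rewrite normrN ger0_norm ?invr_ge0 ?(ltW a0)// ler_pdivrMr// mul1r.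
pose J s := cintegral (fun u => w (x + h *: u) * cpartials s phi u).
(* The Taylor polynomial of the average in powers of [a (y - x)]; its coefficients are averages of
   [w] against derivatives of phi. *)
pose F y := \sum_(p <- L) real_complex R (p.1.2 * mono p.1.1 (- a *: x + a *: y)) * J p.2.
have [P Pk PF] : polyfun k F.
  apply: polyfun_sum => p pL.
  rewrite (_ : (fun _ => _) = fun y => (real_complex R p.1.2 * J p.2) *
      real_complex R (mono p.1.1 (- a *: x + a *: y))); last first.
    by apply/funext => y; rewrite rmorphM mulrAC.
  rewrite -[k]add0n; apply: polyfunM; first exact: polyfun_cst.
  by apply: polyfunW (polyfun_affine _ _ _); exact: Lk.
exists P => // v vr; rewrite PF {PF}.
have iJ s : cintegrable (fun u => w (x + h *: u) * cpartials s phi u).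
  apply: cintegrable_average => //; first exact: schwartz_cmeasurable.
  exact: schwartz_decays.
pose psi u := phi (u + a *: v) - \sum_(p <- L)
  real_complex R (p.1.2 * mono p.1.1 (a *: v)) * cpartials p.2 phi u.
have mpsi : cmeasurable psi.
  apply: cmeasurableB; first exact: (cmeasurable_comp mphi (measurable_shift _)).
  apply: cmeasurable_sum => p; apply: cmeasurableM; first exact: cmeasurable_cst.
  exact: schwartz_cmeasurable.
have dpsi : decays psi.
  move=> N; have [Bs Bs0 HBs] := decays_shift (a *: v) dphi N.
  have : exists2 B', 0 <= B' & forall u, modc (\sum_(p <- L)
      real_complex R (p.1.2 * mono p.1.1 (a *: v)) * cpartials p.2 phi u) <= B' * wt N u.
    elim: L {Lk HL F Pk psi mpsi} => [|p L [B' B'0 IH]].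
      by exists 0 => // u; rewrite big_nil modc0 mul0r.
    have [B1 B10 HB1] := schwartz_decays p.2 sphi N.
    exists (`|p.1.2 * mono p.1.1 (a *: v)| * B1 + B') => [|u].
      by rewrite addr_ge0// mulr_ge0.
    rewrite big_cons (le_trans (modcD _ _))// mulrDl lerD//.
    by rewrite modcM modc_real -mulrA ler_wpM2l.
  move=> [B' B'0 HB']; exists (Bs + B') => [|u]; first exact: addr_ge0.
  by rewrite (le_trans (modcB _ _))// mulrDl lerD.
have nav : `|a *: v| = a * `|v| by rewrite normrZ gtr0_norm.
have -> : cintegral (fun u => w (x + h *: u) * phi (u + a *: v)) - F (x + v) =
    cintegral (fun u => w (x + h *: u) * psi u).
  have -> : F (x + v) = cintegral (fun u => \sum_(p <- L)
     real_complex R (p.1.2 * mono p.1.1 (a *: v)) * (w (x + h *: u) * cpartials p.2 phi u)).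
    rewrite cintegral_sum; last by move=> p; exact: cintegrableZ.
    apply: eq_bigr => p _; rewrite cintegralZ//; congr (_ * _); congr (real_complex R (_ * mono _ _)).
    by rewrite scalerDr addrA scaleNr addNr add0r.
  rewrite -cintegralB.
  - congr cintegral; apply/funext => u; rewrite /psi mulrBr mulr_sumr; congr (_ - _).
    by apply: eq_bigr => p _; ring.
  - apply: cintegrable_average => //; first exact: (cmeasurable_comp mphi (measurable_shift _)).
    exact: decays_shift.
  - by apply: cintegrable_sum => p; exact: cintegrableZ.
(* The average is centred at [x] itself, where the growth factor equals 1. *)
have := @average_bound w psi x x h b A (B * (a * `|v|) ^+ k.+1) K mw pw mpsi dpsi b0 bh h0 A0 wA.
rewrite subrr normr0 mulr0 addr0 expr1n mulr1 => /(_ _) bnd.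
apply: (le_trans (bnd _)) => [u|].
  by rewrite -nav; apply: HL; rewrite nav.
by rewrite le_eqVlt; apply/orP; left; apply/eqP; ring.
Qed.

Lemma cintegral_affineV (c : R) y (F : 'rV[R]_n -> R[i]) : c != 0 ->
  cintegrable (fun u => F (y + c *: u)) ->
  cintegral F = real_complex R (`|c| ^+ n) * cintegral (fun u => F (y + c *: u)).
Proof.
move=> c0 iF; have E z : F z = (fun u => F (y + c *: u)) (c^-1 *: z + (- c^-1) *: y).
  by rewrite scalerDr !scalerA divff// mulrN divff// scale1r scaleN1r addrC subrK.
rewrite (cintegral_affine y c0); last first.
  rewrite (funext E); exact: (cintegrable_affine _ (invr_neq0 c0) iF).
by congr (_ * cintegral _); apply/funext => u; rewrite addrC.
Qed.

(** Substitute [z = x - a^-1 u] with [a = lam^l]; the Jacobian cancels the factor in [dilate]. The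
    substitution is centred at [x] and not at [x + v], which leaves [v] in the kernel. *)
Lemma LP_average (lam : nat) phi l w x v : (0 < lam)%N -> schwartz phi ->
  cmeasurable w -> pgrowth w ->
  LP lam phi l w (x + v) = cintegral (fun u =>
    w (x + (- (lam%:R ^+ l)^-1) *: u) * phi (u + (lam%:R ^+ l) *: v)).
Proof.
move=> lam0 sphi mw pw; set a : R := lam%:R ^+ l.
have a0 : 0 < a by rewrite exprn_gt0// ltr0n.
have mphi := schwartz_cmeasurable [::] sphi; rewrite cpartials_nil in mphi.
have dphi := schwartz_decays [::] sphi; rewrite cpartials_nil in dphi.
have h0 : - a^-1 != 0 by rewrite oppr_eq0 invr_eq0 gt_eqF.
have E u : w (x + (- a^-1) *: u) * dilate lam phi l (x + v - (x + (- a^-1) *: u)) =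
    real_complex R (a ^+ n) * (w (x + (- a^-1) *: u) * phi (u + a *: v)).
  rewrite /dilate.
  have -> : lam%:R ^+ l *: (x + v - (x + - a^-1 *: u)) = u + a *: v.
    rewrite opprD addrACA subrr add0r scaleNr opprK scalerDr scalerA divff ?gt_eqF//.
    by rewrite scale1r addrC.
  by rewrite mulrCA exprM /a !rmorphXn rmorph_nat.
rewrite /LP /convolution (cintegral_affineV (y := x) h0).
  rewrite (funext E) cintegralZ; last first.
    apply: cintegrable_average => //; first exact: (cmeasurable_comp mphi (measurable_shift _)).
    exact: decays_shift.
  rewrite mulrA -rmorphM normrN gtr0_norm ?invr_gt0// -exprMn mulVf ?gt_eqF//.
  by rewrite expr1n mul1r.
rewrite (funext E); apply: cintegrableZ; apply: cintegrable_average => //.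
  exact: (cmeasurable_comp mphi (measurable_shift _)).
exact: decays_shift.
Qed.

End averages.

(** * Reproduction of polynomials *)

Section trig.
Variables (R : realType) (n : nat).
Implicit Types (x y z xi : 'rV[R]_n) (tau : 'rV[R]_n -> R[i]).

(** This is [exp (- i t)], with the sign of the kernel of [fourier]. *)
Definition cexp (t : R) : R[i] := Complex (cos t) (- sin t).

Lemma cexp0 : cexp 0 = 1.
Proof. by rewrite /cexp cos0 sin0 oppr0. Qed.

Lemma cexpD s t : cexp (s + t) = cexp s * cexp t.
Proof.
by apply: complex_eq; rewrite ?cReM ?cImM /= ?cosD ?sinD; ring.
Qed.

Lemma modc_cexp t : modc (cexp t) = 1.
Proof. by rewrite /modc/= sqrrN cos2Dsin2 sqrtr1. Qed.

Lemma dotDr x y z : dot x (y + z) = dot x y + dot x z.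
Proof. by rewrite /dot -big_split; apply: eq_bigr => i _; rewrite mxE mulrDr. Qed.

Lemma dotZr x (c : R) y : dot x (c *: y) = c * dot x y.
Proof. by rewrite /dot mulr_sumr; apply: eq_bigr => i _; rewrite mxE mulrCA. Qed.

Lemma dot_delta x i : dot x (delta_mx ord0 i) = x ord0 i.
Proof.
rewrite /dot (bigD1 i)//= mxE !eqxx mulr1 big1 ?addr0// => j /negbTE ji.
by rewrite mxE ji mulr0.
Qed.

Lemma dot0l x : dot 0 x = 0.
Proof. by rewrite /dot big1// => i _; rewrite mxE mul0r. Qed.

Lemma dot0r x : dot x 0 = 0.
Proof. by rewrite /dot big1// => i _; rewrite mxE mulr0. Qed.

Definition trig_poly (r : R) tau := exists s : seq (R[i] * 'rV[R]_n),
  (forall p, List.In p s -> `|p.2| <= r) /\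
  forall z, tau z = \sum_(p <- s) p.1 * cexp (dot z p.2).

Lemma trig_polyW r r' tau : r <= r' -> trig_poly r tau -> trig_poly r' tau.
Proof. by move=> rr [s [sr h]]; exists s; split=> // p /sr /le_trans; apply. Qed.

Lemma trig_poly_cst c : trig_poly 0 (fun=> c).
Proof.
exists [:: (c, 0)]; split=> [p [<-|//]|z]; first by rewrite normr0.
by rewrite big_seq1 dot0r cexp0 mulr1.
Qed.

Lemma trig_polyD r tau tau' : trig_poly r tau -> trig_poly r tau' ->
  trig_poly r (fun z => tau z + tau' z).
Proof.
move=> [s [sr h]] [s' [sr' h']]; exists (s ++ s'); split=> [p|z].
  by move=> /List.in_app_iff[/sr|/sr'].
by rewrite big_cat h h'.
Qed.

Lemma trig_polyM r r' tau tau' : trig_poly r tau -> trig_poly r' tau' ->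
  trig_poly (r + r') (fun z => tau z * tau' z).
Proof.
move=> [s [sr h]] [s' [sr' h']].
exists (flatten [seq [seq (p.1 * q.1, p.2 + q.2) | q <- s'] | p <- s]); split=> [p pL|z].
  have [q /sr qr] := In_flatten_map pL.
  move=> /List.in_map_iff[q' [<- /sr' qr']] /=.
  by rewrite (le_trans (ler_normD _ _))// lerD.
rewrite h h' big_flatten big_map mulr_suml; apply: eq_bigr => p _.
rewrite big_map mulr_sumr; apply: eq_bigr => q _ /=.
by rewrite dotDr cexpD; ring.
Qed.

Lemma trig_polyX r tau m : trig_poly r tau -> trig_poly (r *+ m) (fun z => tau z ^+ m).
Proof.
move=> ht; elim: m => [|m IH]; first exact: trig_poly_cst.
rewrite mulrS (_ : (fun _ => _) = fun z => tau z * tau z ^+ m); first exact: trig_polyM.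
by apply/funext => z; rewrite exprS.
Qed.

Lemma trig_poly_prod (I : Type) (s : seq I) (r : I -> R) (tau : I -> 'rV[R]_n -> R[i]) :
  (forall i, trig_poly (r i) (tau i)) ->
  trig_poly (\sum_(i <- s) r i) (fun z => \prod_(i <- s) tau i z).
Proof.
move=> ht; elim: s => [|i s IH].
  rewrite big_nil (_ : (fun _ => _) = fun=> 1); first exact: trig_poly_cst.
  by apply/funext => z; rewrite big_nil.
rewrite big_cons (_ : (fun _ => _) = fun z => tau i z * \prod_(i <- s) tau i z).
  exact: trig_polyM.
by apply/funext => z; rewrite big_cons.
Qed.

Lemma trig_poly_cexp (h b : R) i : trig_poly `|h| (fun z => cexp (h * z ord0 i + b)).
Proof.
exists [:: (cexp b, h *: delta_mx ord0 i)]; split=> [p [<-|//]|z] /=.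
  rewrite normrZ -[leRHS]mulr1 ler_wpM2l// norm_rV_le// => j.
  by rewrite mxE eqxx/=; case: (_ == _); rewrite ?normr1 ?normr0.
by rewrite big_seq1 dotZr dot_delta cexpD mulrC.
Qed.

Lemma trig_poly_cos (h b : R) i :
  trig_poly `|h| (fun z => real_complex R (cos (h * z ord0 i + b))).
Proof.
rewrite (_ : (fun _ => _) = fun z => real_complex R 2^-1 * cexp (h * z ord0 i + b) +
    real_complex R 2^-1 * cexp ((- h) * z ord0 i - b)); last first.
  apply/funext => z; rewrite mulNr -opprD; move: (h * _ + b) => t.
  apply: complex_eq; rewrite ?cReD ?cImD ?cReM ?cImM /= ?cosN ?sinN; by field.
apply: trig_polyD; rewrite -[`|h|]add0r; apply: trig_polyM; try exact: trig_poly_cst.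
  exact: trig_poly_cexp.
by rewrite -normrN; exact: trig_poly_cexp.
Qed.

Lemma trig_poly_sin (h b : R) i :
  trig_poly `|h| (fun z => real_complex R (sin (h * z ord0 i + b))).
Proof.
have := trig_poly_cos h (b - pi / 2) i.
congr trig_poly; apply/funext => z; congr (real_complex R _).
by rewrite addrA cosB cos_pihalf sin_pihalf mulr0 add0r mulr1.
Qed.

Lemma cmeasurable_cexp xi : cmeasurable (fun z => cexp (dot z xi)).
Proof.
have md : measurable_fun setT (fun z : 'rV[R]_n => dot z xi).
  apply: measurable_sum => i; apply: measurable_funM => //.
  exact: measurable_coord.
split; first by apply: (measurableT_comp _ md); apply: continuous_measurable_fun; exact: continuous_cos.
apply: measurable_funN.
by apply: (measurableT_comp _ md); apply: continuous_measurable_fun; exact: continuous_sin.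
Qed.

Lemma cintegrable_cexp F xi : cintegrable F -> cintegrable (fun z => F z * cexp (dot z xi)).
Proof.
move=> iF; have mF := cintegrable_cmeasurable iF.
have [iF1 iF2] := iF.
apply: (@cintegrableW _ _ _ (fun z => `|complex.Re (F z)| + `|complex.Im (F z)|)).
- by apply: cmeasurableM => //; exact: cmeasurable_cexp.
- by move=> z; rewrite modcM modc_cexp mulr1 modc_le.
- have := integrableD measurableT (integrable_norm iF1) (integrable_norm iF2).
  by [].
Qed.

(** Integrating against one character gives a value of the transform, here the constant [c]; by
    linearity what remains is [c] times the sum of the coefficients of [tau], which is [tau 0]. *)
Lemma trig_poly_integral F r c tau : cintegrable F ->
  (forall xi, `|xi| <= r -> fourier F xi = c) -> trig_poly r tau ->
  cintegral (fun z => F z * tau z) = c * tau 0.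
Proof.
move=> iF Fc [s [sr h]].
have -> : (fun z => F z * tau z) = (fun z => \sum_(p <- s) p.1 * (F z * cexp (dot z p.2))).
  by apply/funext => z; rewrite h mulr_sumr; apply: eq_bigr => p _; rewrite mulrCA.
rewrite cintegral_sum => [|p]; last by apply: cintegrableZ; exact: cintegrable_cexp.
rewrite h mulr_sumr; elim: s sr {h} => [|p s IH] sr; first by rewrite !big_nil.
rewrite !big_cons IH; last by move=> q qs; apply: sr; right.
congr (_ + _); rewrite cintegralZ; last exact: cintegrable_cexp.
rewrite -[cintegral _]/(fourier F p.2) Fc; last by apply: sr; left.
by rewrite dot0l cexp0 mulr1 mulrC.
Qed.

End trig.

(** * Moments from the values of the transform near 0 *)

Section moments.
Variables (R : realType) (n : nat).
Local Notation leb := (lebesgue_rV R n).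

(** The [j]-th derivative of the sine is its translate by [j pi / 2], which puts the sine in the
    format of [taylor_line]. *)
Lemma is_derive_sin_line (j : nat) (u : R) :
  is_derive u 1 (fun t : R => sin (t + j%:R * (pi / 2))) (sin (u + j.+1%:R * (pi / 2))).
Proof.
have -> : sin (u + j.+1%:R * (pi / 2)) = cos (u + j%:R * (pi / 2)).
  by rewrite -addn1 natrD mulrDl mul1r addrA sinD cos_pihalf sin_pihalf mulr0 add0r mulr1.
have h1 : is_derive (u + j%:R * (pi / 2)) (1 : R) (@sin R) (cos (u + j%:R * (pi / 2))).
  exact: is_derive_sin.
have h2 : is_derive u (1 : R) (fun t : R => t + j%:R * (pi / 2)) 1.
  have := is_deriveD (is_derive_id u (1 : R)) (is_derive_cst (j%:R * (pi / 2) : R) u (1 : R)).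
  by rewrite addr0.
by have := @is_derive1_comp R (@sin R) (fun t => t + j%:R * (pi / 2)) u _ _ h1 h2; rewrite mulr1.
Qed.

Lemma sin_taylor m (t : R) :
  `|sin t - (\poly_(j < m) (sin (0 + j%:R * (pi / 2)) / j`!%:R)).[t]| <= `|t| ^+ m.
Proof.
have := @taylor_line R (fun j t => sin (t + j%:R * (pi / 2))) m `|t| 1 t is_derive_sin_line.
by rewrite mul0r addr0 mul1r; apply => // u _; exact: sin_max.
Qed.

Lemma normr_sin_le (t : R) : `|sin t| <= `|t|.
Proof.
have := sin_taylor 1 t.
by rewrite horner_poly big_ord_recl big_ord0 /= !(mul0r,addr0,add0r,sin0,subr0) expr1.
Qed.

Lemma sin_sub_id_le (t : R) : `|sin t - t| <= t ^+ 2.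
Proof.
have := sin_taylor 2 t.
rewrite horner_poly !big_ord_recl big_ord0 /= !(mul0r,addr0,add0r,sin0,mul1r).
by rewrite sin_pihalf divr1 mul1r expr1 real_normK ?num_real.
Qed.

Lemma cvg_scaled_sin (z M0 : R) :
  sin (z / (m%:R + M0)) * (m%:R + M0) @[m --> \oo] --> z.
Proof.
apply/cvgrPdist_le => e e0; near=> m.
have M1 : z ^+ 2 / e + 1 + `|M0| <= m%:R by near: m; exact: nbhs_infty_ger.
have ze : 0 <= z ^+ 2 / e by rewrite divr_ge0// ?sqr_ge0// ltW.
have hM0 := ler_norm (- M0); rewrite normrN in hM0.
have M0' : 0 < m%:R + M0 by lra.
rewrite distrC.
have -> : sin (z / (m%:R + M0)) * (m%:R + M0) - z =
    (sin (z / (m%:R + M0)) - z / (m%:R + M0)) * (m%:R + M0).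
  by rewrite mulrBl divfK// gt_eqF.
rewrite normrM (gtr0_norm M0'); apply: le_trans (ler_wpM2r (ltW M0') (sin_sub_id_le _)) _.
have -> : (z / (m%:R + M0)) ^+ 2 * (m%:R + M0) = z ^+ 2 / (m%:R + M0).
  by field; rewrite gt_eqF.
rewrite ler_pdivrMr// -ler_pdivrMl// mulrC; lra.
Unshelve. all: by end_near. Qed.

Lemma cvg_prodX (I : Type) (s : seq I) (e : I -> nat) (f : I -> nat -> R) (l : I -> R) :
  (forall i, f i m @[m --> \oo] --> l i) ->
  \prod_(i <- s) f i m ^+ e i @[m --> \oo] --> \prod_(i <- s) l i ^+ e i.
Proof.
move=> fl; elim: s => [|i s IH].
  rewrite big_nil (_ : (fun _ => _) = fun=> 1); first exact: cvg_cst.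
  by apply/funext => m; rewrite big_nil.
rewrite big_cons (_ : (fun _ => _) = fun m => f i m ^+ e i * \prod_(i <- s) f i m ^+ e i).
  apply: cvgM => //; apply: (cvg_comp (f i) (fun t => t ^+ e i) (fl i)).
  exact: exprn_continuous.
by apply/funext => m; rewrite big_cons.
Qed.

Lemma cintegral_dct (F : 'rV[R]_n -> R[i]) (tau_ : nat -> 'rV[R]_n -> R)
    (tau g : 'rV[R]_n -> R) (c : R[i]) : cmeasurable F ->
  (forall m, measurable_fun setT (tau_ m)) -> leb.-integrable setT (EFin \o g) ->
  (forall m x, modc (F x) * `|tau_ m x| <= g x) ->
  (forall x, tau_ m x @[m --> \oo] --> tau x) ->
  (forall m, cintegral (fun x => F x * real_complex R (tau_ m x)) = c) ->
  cintegral (fun x => F x * real_complex R (tau x)) = c.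
Proof.
move=> [F1 F2] mtau ig taug ttau tauc; apply: complex_eq => /=.
- apply: (Rintegral_dct (u_ := fun m x => complex.Re (F x * real_complex R (tau_ m x))) _ ig).
  + move=> m; under eq_fun do rewrite cReM/= mulr0 subr0; exact: measurable_funM.
  + move=> m x; rewrite (le_trans _ (taug m x))//.
    by rewrite cReM/= mulr0 subr0 normrM ler_wpM2r// normr_Re_le.
  + move=> x; rewrite cReM/= mulr0 subr0; under eq_cvg do rewrite cReM/= mulr0 subr0.
    by apply: cvgM => //; exact: cvg_cst.
  + by move=> m; rewrite -(tauc m).
- apply: (Rintegral_dct (u_ := fun m x => complex.Im (F x * real_complex R (tau_ m x))) _ ig).
  + move=> m; under eq_fun do rewrite cImM/= mulr0 add0r; exact: measurable_funM.
  + move=> m x; rewrite (le_trans _ (taug m x))//.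
    by rewrite cImM/= mulr0 add0r normrM ler_wpM2r// normr_Im_le.
  + move=> x; rewrite cImM/= mulr0 add0r; under eq_cvg do rewrite cImM/= mulr0 add0r.
    by apply: cvgM => //; exact: cvg_cst.
  + by move=> m; rewrite -(tauc m).
Qed.

(* Test F against \prod_i (h^-1 sin (h z_i))^(e i), which has frequency at most r when
   h is small, and let h tend to 0. *)
Lemma cintegral_moment (F : 'rV[R]_n -> R[i]) (r : R) (c : R[i]) (e : 'I_n -> nat) :
  cmeasurable F -> decays F -> 0 < r ->
  (forall xi, `|xi| <= r -> fourier F xi = c) ->
  cintegral (fun z => F z * real_complex R (mono e z)) = c * real_complex R (mono e 0).
Proof.
move=> mF dF r0 Fc; pose N := (\sum_(i < n) e i)%N.
have iF : cintegrable F.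
  by have [B _ FB] := dF (2 * n)%N; exact: cintegrable_wt mF FB.
(* With this shift the total frequency [N / (m + M0)] is below [r] for every [m], including [m = 0],
   so that the integrals are constant in [m]. *)
pose M0 : R := 1 + N%:R / r.
have M1 (m : nat) : N%:R / r < m%:R + M0.
  by have : (0 : R) <= m%:R by []; rewrite /M0; lra.
have M0' (m : nat) : 0 < m%:R + M0.
  by rewrite (le_lt_trans _ (M1 m))// divr_ge0// ltW.
pose tau_ (m : nat) (z : 'rV[R]_n) : R :=
  \prod_(i < n) (sin (z ord0 i / (m%:R + M0)) * (m%:R + M0)) ^+ e i.
have [B B0 FB] := dF (N + 2 * n)%N.
apply: (@cintegral_dct F tau_ (mono e) (fun z => B * wt (2 * n) z) _ mF).
- move=> m; apply: measurable_prod => i _; apply: measurable_funX.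
  apply: measurable_funM => //.
  have ms : measurable_fun [set: R] (@sin R).
    by apply: continuous_measurable_fun; exact: continuous_sin.
  apply: (measurableT_comp ms); apply: measurable_funM => //.
  exact: measurable_coord.
- rewrite (_ : _ \o _ = fun x => (B%:E * (EFin \o wt (2 * n)) x)%E)//.
  exact: integrableZl (integrable_wt R n).
- move=> m z; rewrite -(wtM_expr N) mulrCA [leRHS]mulrC ler_pM ?modc_ge0//.
  rewrite normr_prod /N -prodrXr; apply: ler_prod => i _; rewrite normr_ge0/= normrX.
  rewrite lerXn2r ?nnegrE ?(ltW (norm1_gt0 _))// normrM (gtr0_norm (M0' m)).
  apply: (le_trans (ler_wpM2r (ltW (M0' m)) (normr_sin_le _))).
  rewrite normrM normfV (gtr0_norm (M0' m)) divfK ?gt_eqF//.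
  by rewrite (le_trans (coord_le_norm z i))// lerDr.
- move=> z; apply: (cvg_prodX (f := fun i m => sin (z ord0 i / (m%:R + M0)) * (m%:R + M0))) => i.
  exact: cvg_scaled_sin.
- move=> m; have ttau : trig_poly r (fun z => real_complex R (tau_ m z)).
    apply: (@trig_polyW _ _ (\sum_(i < n) `|(m%:R + M0)^-1| *+ e i)).
      rewrite sumrMnr gtr0_norm ?invr_gt0// -[leLHS]mulr_natl ler_pdivrMr// mulrC.
      by rewrite -ler_pdivrMr// ltW.
    rewrite (_ : (fun _ => _) = fun z : 'rV[R]_n => \prod_(i < n)
        (real_complex R (sin ((m%:R + M0)^-1 * z ord0 i + 0)) * real_complex R (m%:R + M0)) ^+ e i).
      apply: trig_poly_prod => i; apply: trig_polyX; rewrite -[`|_|]addr0.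
      apply: trig_polyM; [exact: trig_poly_sin|exact: trig_poly_cst].
    apply/funext => z; rewrite /tau_ rmorph_prod; apply: eq_bigr => i _.
    by rewrite rmorphXn rmorphM addr0 [_^-1 * _]mulrC.
  rewrite (trig_poly_integral iF Fc ttau); congr (_ * real_complex R _).
  by apply: eq_bigr => i _; rewrite mxE mul0r sin0 mul0r.
Qed.

(** As a polynomial in [u], [P (y + h u)] has constant term [P y], and the moments of [F] are those
    of a unit mass at 0. *)
Lemma average_polynomial (F : 'rV[R]_n -> R[i]) (r : R) (P : mpoly n R[i]) (y : 'rV[R]_n) (h : R) :
  cmeasurable F -> decays F -> 0 < r ->
  (forall xi, `|xi| <= r -> fourier F xi = 1) ->
  cintegral (fun u => peval P (y + h *: u) * F u) = peval P y.
Proof.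
move=> mF dF r0 F1.
have [Q Qk QP] := peval_affine y h (leqnSn (mmeasure mdeg P)).
have [s [_ Qs]] := peval_expand Qk.
have iF (e : 'I_n -> nat) : cintegrable (fun u => F u * real_complex R (mono e u)).
  have -> : (fun u => F u * real_complex R (mono e u)) =
    (fun u => real_complex R (mono e u) * F u) by apply/funext => u; rewrite mulrC.
  apply: cintegrable_pgrowth => //.
    exact/ccontinuous_cmeasurable/mono_ccontinuous.
  exists 1, (\sum_(i < n) e i)%N; split=> // u.
  by rewrite modc_real mul1r mono_le.
have -> : (fun u => peval P (y + h *: u) * F u) =
    (fun u => \sum_(p <- s) p.1 * (F u * real_complex R (mono p.2 u))).
  by apply/funext => u; rewrite -QP Qs mulr_suml; apply: eq_bigr => p _; rewrite -mulrA [_ * F u]mulrC.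
rewrite cintegral_sum => [|p]; last exact: cintegrableZ.
have -> : peval P y = peval Q 0 by rewrite QP scaler0 addr0.
rewrite Qs; apply: eq_bigr => p _; rewrite cintegralZ//.
by rewrite (cintegral_moment p.2 mF dF r0 F1) mul1r.
Qed.

End moments.

(** * The Littlewood-Paley operators reproduce each other *)

Section gauss.
Variables (R : realType) (n : nat).
Local Notation leb := (lebesgue_rV R n).

(** Both functions are compared with [1 - t^2 / 2]. For the cosine, [cos t = 1 - 2 sin^2 (t / 2)]
    reduces the cubic bound to the quadratic one for [sin u - u]. *)
Lemma cos_sub_expR_le (t : R) :
  `|cos t - expR (- (t ^+ 2 / 2))| <= `|t| ^+ 3 + t ^+ 4.
Proof.
pose u := t / 2.
have cosE : cos t = 1 - 2 * sin u ^+ 2.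
  have -> : t = u *+ 2 by rewrite /u -mulr_natr divfK.
  by rewrite cos_mulr2n sin2cos2 mulr2n; ring.
have h1 := sin_sub_id_le u; have h2 := normr_sin_le u.
have h3 : `|cos t - (1 - t ^+ 2 / 2)| <= `|t| ^+ 3.
  have -> : cos t - (1 - t ^+ 2 / 2) = - 2 * (sin u - u) * (sin u + u).
    by rewrite cosE /u; field.
  rewrite !normrM normrN (ger0_norm (ler0n R 2)).
  have h4 : `|sin u + u| <= 2 * `|u| by rewrite (le_trans (ler_normD _ _))//; lra.
  have h5 := ler_pM (normr_ge0 _) (normr_ge0 _) h1 h4.
  have -> : `|t| = 2 * `|u|.
    by rewrite /u normrM normfV (ger0_norm (ler0n R 2)) mulrC divfK.
  have u3 : 0 <= `|u| ^+ 3 by rewrite exprn_ge0.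
  have E : u ^+ 2 * (2 * `|u|) = 2 * `|u| ^+ 3.
    by rewrite -(real_normK (num_real u)); ring.
  rewrite E in h5; rewrite exprMn -mulrA; apply: (le_trans (ler_wpM2l _ h5)) => //.
  lra.
pose s := t ^+ 2 / 2.
have s0 : 0 <= s by rewrite divr_ge0// sqr_ge0.
have e1 : 1 - s <= expR (- s) by apply: expR_ge1Dx.
(* Follows from [exp s >= 1 + s] and [(1 - s + s^2) (1 + s) = 1 + s^3 >= 1]. *)
have e2 : expR (- s) <= 1 - s + s ^+ 2.
  have p0 : 0 < 1 - s + s ^+ 2 by nra.
  rewrite expRN -[leLHS]mul1r ler_pdivrMr ?expR_gt0//.
  apply: (le_trans _ (ler_wpM2l (ltW p0) (expR_ge1Dx s))).
  have : 0 <= s ^+ 3 by rewrite exprn_ge0.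
  by rewrite (_ : (1 - s + s ^+ 2) * (1 + s) = 1 + s ^+ 3); [lra|ring].
have -> : cos t - expR (- s) = (cos t - (1 - s)) + ((1 - s) - expR (- s)) by ring.
rewrite (le_trans (ler_normD _ _))// lerD//.
rewrite ler_norml; apply/andP; split; last first.
  by rewrite (@le_trans _ _ 0) ?subr_le0// (exprM t 2 2) sqr_ge0.
have -> : t ^+ 4 = 4 * s ^+ 2 by rewrite /s; field.
by have := sqr_ge0 s; lra.
Qed.

Lemma exprB_le (a b : R) m : `|a| <= 1 -> `|b| <= 1 ->
  `|a ^+ m - b ^+ m| <= m%:R * `|a - b|.
Proof.
move=> a1 b1; elim: m => [|m IH]; first by rewrite subrr normr0 mul0r.
have -> : a ^+ m.+1 - b ^+ m.+1 = a * (a ^+ m - b ^+ m) + (a - b) * b ^+ m by rewrite !exprS; ring.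
rewrite (le_trans (ler_normD _ _))// !normrM -natr1 mulrDl mul1r lerD//.
  by rewrite (le_trans _ IH)// ler_piMl.
by rewrite ler_piMr// normrX exprn_ile1.
Qed.

(** With [M = m + 1], each of the [M^2] factors differs from the corresponding Gaussian factor by
    [O (M^-3)], which leaves a total error [O (1 / M)]. *)
Lemma cvg_cos_gauss (w : R) :
  cos (w / m.+1%:R) ^+ (m.+1 * m.+1) @[m --> \oo] --> expR (- (w ^+ 2 / 2)).
Proof.
apply/cvgrPdist_le => e e0; near=> m.
have m0 : (0 : R) < m.+1%:R by [].
pose t := w / m.+1%:R.
have -> : expR (- (w ^+ 2 / 2)) = expR (- (t ^+ 2 / 2)) ^+ (m.+1 * m.+1).
  rewrite -expRM_natl; congr expR; rewrite /t natrM; field; rewrite gt_eqF//.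
rewrite distrC (le_trans (exprB_le _ _ _))//.
- by rewrite ler_norml cos_geN1 cos_le1.
- by rewrite ger0_norm ?expR_ge0// -expR0 ler_expR oppr_le0 divr_ge0// sqr_ge0.
apply: (@le_trans _ _ ((`|w| ^+ 3 + w ^+ 4) / m.+1%:R)).
  apply: (le_trans (ler_wpM2l _ (cos_sub_expR_le t))) => //.
  rewrite /t normrM normfV (gtr0_norm m0) natrM.
  have -> : m.+1%:R * m.+1%:R * ((`|w| / m.+1%:R) ^+ 3 + (w / m.+1%:R) ^+ 4) =
     (`|w| ^+ 3 + w ^+ 4 / m.+1%:R) / m.+1%:R by field; rewrite gt_eqF.
  rewrite ler_wpM2r ?invr_ge0// lerD2l ler_pdivrMr// ler_peMr ?ler1n//.
  by rewrite -[4%N]/(2 * 2)%N exprM sqr_ge0.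
rewrite ler_pdivrMr// -ler_pdivrMl// mulrC.
by apply: (@le_trans _ _ m%:R); [near: m; exact: nbhs_infty_ger|rewrite ler_nat].
Unshelve. all: by end_near. Qed.

Definition sqdist (y z : 'rV[R]_n) : R := \sum_(i < n) (z ord0 i - y ord0 i) ^+ 2.

Lemma sqdist_ge (y z : 'rV[R]_n) (d : R) : 0 <= d -> d <= `|z - y| -> d ^+ 2 <= sqdist y z.
Proof.
move=> d0 dz; apply: (@le_trans _ _ (`|z - y| ^+ 2)); first by rewrite lerXn2r ?nnegrE.
have [->|] := eqVneq `|z - y| 0.
  by rewrite expr0n sumr_ge0// => i _; rewrite sqr_ge0.
move=> /mx_norm_neq0[[i j] /= E]; rewrite [X in X ^+ 2]E real_normK ?num_real//.
rewrite !mxE (ord1 i) /sqdist (bigD1 j)//= lerDl sumr_ge0// => l _.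
by rewrite sqr_ge0.
Qed.

Lemma sqdist_le (y z : 'rV[R]_n) (d : R) : `|z - y| <= d -> sqdist y z <= n%:R * d ^+ 2.
Proof.
move=> zd; apply: (@le_trans _ _ (\sum_(i < n) d ^+ 2)).
  apply: ler_sum => i _; rewrite -(real_normK (num_real _)).
  rewrite lerXn2r ?nnegrE ?(le_trans _ zd)//.
  by have := coord_le_norm (z - y) i; rewrite !mxE.
by rewrite sumr_const card_ord mulr_natl.
Qed.

Lemma measurable_gauss (y : 'rV[R]_n) (p : nat) :
  measurable_fun setT (fun z => expR (- (p%:R * sqdist y z))).
Proof.
apply: (measurableT_comp (@measurable_expR R)); apply: measurable_funN.
apply: measurable_funM => //; apply: measurable_sum => i; apply: measurable_funX.
by apply: measurable_funB => //; exact: measurable_coord.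
Qed.

Lemma gauss_le1 (y z : 'rV[R]_n) (p : nat) : expR (- (p%:R * sqdist y z)) <= 1.
Proof.
by rewrite -expR0 ler_expR oppr_le0 mulr_ge0// sumr_ge0// => i _; exact: sqr_ge0.
Qed.

(* As p grows, the mass near y dominates that outside the ball of radius d by a factor
   exp (3 p d^2 / 4). *)
Lemma gauss_concentration (g : 'rV[R]_n -> R) (y : 'rV[R]_n) (d c : R) :
  leb.-integrable setT (EFin \o g) -> 0 < d -> 0 < c ->
  (forall z, `|z - y| < d -> c <= g z) ->
  (forall p : nat, \int[leb]_z (g z * expR (- (p%:R * sqdist y z))) = 0) -> False.
Proof.
move=> ig d0 c0 gc gp.
(* Small enough for [sqdist y z <= n r^2 <= d^2 / 4] on the cube of radius [r]. *)
pose r := d / (2 * n.+1%:R).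
have r0 : 0 < r by rewrite divr_gt0// mulr_gt0.
have rd : r < d.
  rewrite ltr_pdivrMr ?mulr_gt0// ltr_pMr// (@lt_le_trans _ _ 2)//; first lra.
  by rewrite ler_peMr// ler1n.
pose e1 (p : nat) := expR (- (p%:R * (d ^+ 2 / 4))); pose e2 (p : nat) := expR (- (p%:R * d ^+ 2)).
pose G := \int[leb]_z `|g z|.
pose vol := (r *+ 2) ^+ n.
have vol0 : 0 < vol by rewrite exprn_gt0// mulrn_wgt0.
have Evol : (\int[leb]_z (\1_(cube y r) z : R)%:E = vol%:E)%E.
  rewrite (integral_indic leb measurableT (measurable_cube y r)) setIT.
  exact: lebesgue_cube.
have ivol : leb.-integrable setT (EFin \o (fun z => \1_(cube y r) z : R)).
  apply/integrableP; split.
    by apply/measurable_EFinP; apply: measurable_indic; exact: measurable_cube.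
  rewrite (eq_integral (fun z => (\1_(cube y r) z)%:E)); last first.
    by move=> z _ /=; rewrite ger0_norm.
  by rewrite Evol ltry.
have Ivol : \int[leb]_z (\1_(cube y r) z : R) = vol.
  by rewrite /Rintegral Evol.
have iabs := integrable_norm ig.
have mg : measurable_fun setT g by apply/measurable_EFinP; exact: (measurable_int leb ig).
have key p : c * e1 p * vol <= e2 p * G.
  have ik : leb.-integrable setT (EFin \o (fun z => g z * expR (- (p%:R * sqdist y z)))).
    apply: (le_integrable measurableT _ _ ig).
      apply/measurable_EFinP; apply: measurable_funM; first exact: mg.
      exact: measurable_gauss.
    move=> z _ /=; rewrite lee_fin normrM ler_piMr// ger0_norm ?expR_ge0//.
    exact: gauss_le1.
  rewrite -subr_le0 -(gp p) -Ivol /G.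
  have -> : c * e1 p * \int[leb]_z (\1_(cube y r) z : R) - e2 p * \int[leb]_z `|g z| =
    \int[leb]_z (c * e1 p * (\1_(cube y r) z : R) + (- e2 p) * `|g z|).
    by rewrite Rintegral_lin// mulNr.
  apply: le_Rintegral => //; first exact: integrable_lin.
  (* The function [g] times the Gaussian is at least [c * e1 p] on the cube, nonnegative on the rest
     of the ball, and at least [- e2 p * |g|] outside the ball. *)
  move=> z _; have [zd|dz] := ltP `|z - y| d.
    have gz := gc z zd; have gz0 : 0 <= g z by rewrite (le_trans (ltW c0)).
    have h2 : 0 <= e2 p * `|g z| by rewrite mulr_ge0// expR_ge0.
    have h3 : 0 <= g z * expR (- (p%:R * sqdist y z)) by rewrite mulr_ge0// expR_ge0.
    rewrite indicE; case: (boolP (z \in cube y r)) => [/set_mem zc|_]; last first.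
      by rewrite mulr0 add0r; lra.
    rewrite mulr1 mulNr lerBlDr; apply: ler_wpDr => //.
    apply: ler_pM => //; [exact: ltW|exact: expR_ge0|].
    rewrite ler_expR lerN2 ler_wpM2l//.
    have zr : `|z - y| <= r.
      apply: norm_rV_le => [|i]; first exact: ltW.
      by rewrite !mxE distrC ltW//; exact: zc.
    apply: (le_trans (sqdist_le zr)); rewrite /r expr_div_n exprMn.
    have n1 : (1 : R) <= n.+1%:R by rewrite ler1n.
    have nn : (n%:R : R) <= n.+1%:R by rewrite ler_nat.
    rewrite mulrCA ler_wpM2l ?sqr_ge0// ler_pdivrMr; last by rewrite mulr_gt0// exprn_gt0.
    rewrite -natrX mulrA mulVf// mul1r (le_trans nn)// expr2 ler_peMr//.
  have -> : (\1_(cube y r) z : R) = 0.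
    rewrite indicE; apply/eqP; rewrite pnatr_eq0 eqb0; apply/negP => /set_mem zc.
    have : `|z - y| <= r.
      apply: norm_rV_le => [|i]; first exact: ltW.
      by rewrite !mxE distrC ltW//; exact: zc.
    by move=> /(le_trans dz); rewrite leNgt rd.
  have -> : c * e1 p * 0 + - e2 p * `|g z| = - (`|g z| * e2 p) by ring.
  rewrite lerNl -mulNr.
  apply: (@le_trans _ _ (`|g z| * expR (- (p%:R * sqdist y z)))).
    by rewrite ler_wpM2r ?expR_ge0// -normrN ler_norm.
  rewrite ler_wpM2l// ler_expR lerN2 ler_wpM2l//.
  by apply: sqdist_ge => //; exact: ltW.
(* The quotient [e1 p / e2 p = exp (p a)] exceeds [p a], so [key] would bound an unbounded sequence
   by [G]. *)
pose a := d ^+ 2 * (3 / 4).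
have a0 : 0 < a by rewrite mulr_gt0// ?exprn_gt0// divr_gt0.
have c1 : 0 < c * vol * a by rewrite !mulr_gt0.
have bnd (p : nat) : c * vol * a * p%:R <= G.
  have : c * vol * expR (p%:R * a) <= G.
    have -> : expR (p%:R * a) = e1 p * (e2 p)^-1.
      by rewrite -[(e2 p)^-1]expRN opprK -expRD /a; congr expR; field.
    by rewrite mulrA ler_pdivrMr ?expR_gt0// mulrAC [leRHS]mulrC.
  apply: le_trans; rewrite -(mulrA (c * vol)) ler_wpM2l ?mulr_ge0 ?ltW// mulrC.
  by rewrite (lt_le_trans _ (expR_ge1Dx _))// ltrDr.
have := bnd (Num.bound (G / (c * vol * a))).
rewrite leNgt -ltr_pdivrMl// mulrC => /negP; apply.
have G0 : 0 <= G by have := bnd 0%N; rewrite mulr0.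
exact: archi_boundP (divr_ge0 G0 (ltW c1)).
Qed.

(* cos (w / m)^(m^2) tends to exp (- w^2 / 2), so F is orthogonal to all Gaussians
   centred at y. *)
Lemma fourier_injective (F : 'rV[R]_n -> R[i]) : cmeasurable F -> decays F ->
  ccontinuous F -> (forall xi, fourier F xi = 0) -> forall y, F y = 0.
Proof.
move=> mF dF cF F0 y.
have [B B0 FB] := dF (2 * n)%N.
have iF : cintegrable F by exact: cintegrable_wt mF FB.
have Fq (q : R) : cintegral (fun z => F z * real_complex R (expR (- (q ^+ 2 / 2 * sqdist y z)))) = 0.
  pose cs (m : nat) (i : 'I_n) (z : 'rV[R]_n) := cos (q * (z ord0 i - y ord0 i) / m.+1%:R).
  have mcs m i : measurable_fun setT (cs m i).
    apply: (measurableT_comp (continuous_measurable_fun (@continuous_cos R))).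
    apply: measurable_funM => //; apply: measurable_funM => //.
    by apply: measurable_funB => //; exact: measurable_coord.
  apply: (@cintegral_dct _ _ F (fun m z => \prod_(i < n) cs m i z ^+ (m.+1 * m.+1)) _
    (fun z => B * wt (2 * n) z)) => //.
  - move=> m; apply: measurable_prod => i _; exact: measurable_funX.
  - rewrite (_ : _ \o _ = fun x => (B%:E * (EFin \o wt (2 * n)) x)%E)//.
    exact: integrableZl (integrable_wt R n).
  - move=> m z; rewrite -[leRHS]mulr1 ler_pM ?modc_ge0// normr_prod.
    apply: prodr_ile1 => i _; rewrite normr_ge0 normrX exprn_ile1//.
    by rewrite ler_norml cos_geN1 cos_le1.
  - move=> z.
    have := @cvg_prodX R _ (index_enum 'I_n) (fun=> 1%N)
      (fun i m => cs m i z ^+ (m.+1 * m.+1)) (fun i => expR (- ((q * (z ord0 i - y ord0 i)) ^+ 2 / 2))) (fun i => @cvg_cos_gauss (q * (z ord0 i - y ord0 i))).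
    rewrite (_ : \prod_(i <- _) _ = expR (- (q ^+ 2 / 2 * sqdist y z))) => [|].
      by congr (_ @ _ --> _); apply/funext => m; apply: eq_bigr => i _; rewrite expr1.
    rewrite /sqdist mulr_sumr -sumrN expR_sum; apply: eq_bigr => i _.
    by rewrite expr1 exprMn mulrAC.
  - move=> m; pose h : R := q / m.+1%:R.
    have ttau : trig_poly (\sum_(i < n) `|h| *+ (m.+1 * m.+1))
        (fun z => real_complex R (\prod_(i < n) cs m i z ^+ (m.+1 * m.+1))).
      rewrite (_ : (fun _ => _) = fun z : 'rV[R]_n => \prod_(i < n)
        (real_complex R (cos (h * z ord0 i + (- h * y ord0 i)))) ^+ (m.+1 * m.+1)).
        by apply: trig_poly_prod => i; apply: trig_polyX; exact: trig_poly_cos.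
      apply/funext => z; rewrite rmorph_prod; apply: eq_bigr => i _.
      rewrite rmorphXn; congr (real_complex R (cos _) ^+ _).
      by rewrite mulNr -mulrBr /h mulrAC.
    by rewrite (trig_poly_integral iF (fun xi _ => F0 xi) ttau) mul0r.
(* The choice [q = sqrt (2 p)] turns [q^2 / 2] into [p]. *)
have gE (p : nat) : cintegral (fun z => F z * real_complex R (expR (- (p%:R * sqdist y z)))) = 0.
  have := Fq (Num.sqrt (2 * p%:R)); rewrite sqr_sqrtr; last exact: (mulr_ge0 (ler0n R 2) (ler0n R p)).
  by rewrite (mulrC 2) mulfK.
have pos (g : 'rV[R]_n -> R) : leb.-integrable setT (EFin \o g) ->
   (forall e, 0 < e -> exists2 d, 0 < d & forall z : 'rV[R]_n, `|z - y| < d -> `|g z - g y| <= e) ->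
   (forall p : nat, \int[leb]_z (g z * expR (- (p%:R * sqdist y z))) = 0) -> g y <= 0.
  move=> ig cg gp; rewrite leNgt; apply/negP => gy.
  have [d d0 dg] := cg (g y / 2) (divr_gt0 gy (ltr0n R 2)).
  apply: (gauss_concentration ig d0 (divr_gt0 gy (ltr0n R 2))) gp => z /dg.
  by rewrite ler_norml => /andP[+ _]; lra.
(* Concentration only excludes a positive value of a real function; applied to the real part of
   [c F] for [c] equal to 1, -1, i and -i, it makes both parts of [F y] vanish. *)
have reg (c : R[i]) : modc c <= 1 -> complex.Re (c * F y) <= 0.
  move=> c1; apply: (pos (fun z => complex.Re (c * F z))).
  - exact: (cintegrableZ c iF).1.
  - move=> e e0; have [d d0 dF'] := cF y e e0; exists d => // z /dF' /ltW h1.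
    rewrite -cReN -cReD -mulrBr (le_trans (normr_Re_le _))// modcM.
    by apply: (le_trans _ h1); rewrite ler_piMl// modc_ge0.
  - move=> p; pose Gp (z : 'rV[R]_n) := expR (- (p%:R * sqdist y z)).
    rewrite (_ : (fun _ => _) = fun z => complex.Re (c * (F z * real_complex R (Gp z)))); last first.
      by apply/funext => z; rewrite mulrA [in RHS]cReM/= mulr0 subr0.
    have iG : cintegrable (fun z => F z * real_complex R (Gp z)).
      apply: (@cintegrableW _ _ _ (fun z => B * wt (2 * n) z)).
      - by apply: cmeasurableM => //; apply: cmeasurable_real; exact: measurable_gauss.
      - move=> z; rewrite modcM modc_real ger0_norm ?expR_ge0//.
        by rewrite (le_trans _ (FB z))// ler_piMr ?modc_ge0// gauss_le1.
      - rewrite (_ : _ \o _ = fun x => (B%:E * (EFin \o wt (2 * n)) x)%E)//.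
        exact: integrableZl (integrable_wt R n).
    by have := cintegralZ c iG; rewrite gE mulr0 => /(congr1 (@complex.Re R)).
have m1 : modc (1 : R[i]) <= 1 by rewrite /modc/= expr0n addr0 expr1n sqrtr1.
have mi : modc ('i%C : R[i]) <= 1 by rewrite /modc/= expr0n add0r expr1n sqrtr1.
have r1 := reg 1 m1; have r2 := reg (-1).
have r3 := reg _ mi; have r4 := reg (- 'i%C).
rewrite modcN in r2; rewrite modcN in r4; have := r2 m1; have := r4 mi.
rewrite !mulNr !cReN; move: r1 r3; rewrite !cReM /=.
move=> ? ? ? ?; apply: complex_eq => /=; lra.
Qed.
End gauss.

(** * Convolution and the Fourier transform *)

Section rapid.
Variables (R : realType) (n : nat).
Local Notation leb := (lebesgue_rV R n).
Implicit Types (F G U V : 'rV[R]_n -> R[i]) (x y z u v xi : 'rV[R]_n).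

Lemma integrable_wtZ (B : R) : leb.-integrable setT (EFin \o (fun x => B * wt (2 * n) x)).
Proof.
rewrite (_ : _ \o _ = fun x => (B%:E * (EFin \o wt (2 * n)) x)%E)//.
exact: integrableZl (integrable_wt R n).
Qed.

Lemma wt_opp N x : wt N (- x) = wt N x.
Proof. by rewrite /wt normrN. Qed.

Lemma integrable_wtZ_sub (B : R) y : leb.-integrable setT (EFin \o (fun x => B * wt (2 * n) (y - x))).
Proof.
have h := @integrable_rV_affine R n (-1) y _ _ (integrable_wtZ B).
have {h} : leb.-integrable setT (EFin \o (fun x => B * wt (2 * n) (-1 *: x + y))).
  by apply: h; rewrite oppr_eq0 oner_neq0.
by congr (_ .-integrable _ _); apply/funext => x /=; rewrite scaleN1r addrC.
Qed.

Lemma cintegrable_decays F : cmeasurable F -> decays F -> cintegrable F.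
Proof. by move=> mF dF; have [B _ FB] := dF (2 * n)%N; exact: cintegrable_wt mF FB. Qed.

Lemma measurable_sub y : measurable_fun setT (fun z : 'rV[R]_n => y - z).
Proof.
have := measurable_affine y (-1); congr measurable_fun.
by apply/funext => z; rewrite scaleN1r.
Qed.

Lemma measurable_rVB d (T : measurableType d) (f g : T -> 'rV[R]_n) :
  measurable_fun setT f -> measurable_fun setT g -> measurable_fun setT (fun t => f t - g t).
Proof.
move=> mf mg; apply/measurable_fun_rVP => i.
rewrite (_ : (fun _ => _) = fun t => f t ord0 i - g t ord0 i); last first.
  by apply/funext => p; rewrite !mxE.
by apply: measurable_funB; [exact: (measurableT_comp (measurable_coord i) mf)|
  exact: (measurableT_comp (measurable_coord i) mg)].
Qed.

Lemma decays_sub F u : decays F -> decays (fun z => F (u - z)).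
Proof.
move=> dF N; have [B B0 h] := dF N.
exists (B * (1 + `|u|) ^+ N) => [|z]; first by rewrite mulr_ge0// exprn_ge0// addr_ge0.
rewrite (le_trans (h _))// -mulrA ler_wpM2l// -opprB wt_opp.
by have := wt_shift N z (- u); rewrite normrN.
Qed.

Lemma decaysM F G : decays F -> decays G -> decays (fun z => F z * G z).
Proof.
move=> dF dG N; have [A A0 hA] := dF N; have [B B0 hB] := dG 0%N.
exists (A * B) => [|z]; first exact: mulr_ge0.
rewrite modcM mulrAC; apply: ler_pM; rewrite ?modc_ge0//.
by rewrite (le_trans (hB _))// /wt expr0 invr1 mulr1.
Qed.

Lemma cintegral_translate F v : cmeasurable F -> decays F ->
  cintegral (fun z => F (z - v)) = cintegral F.
Proof.
move=> mF dF; rewrite [RHS](cintegral_affine (- v) (oner_neq0 R) (cintegrable_decays mF dF)).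
rewrite normr1 expr1n mul1r.
by congr cintegral; apply/funext => z; rewrite scale1r.
Qed.

Lemma wt_sub N y z : wt N z * wt N (y - z) <= wt N y.
Proof.
have := wt_shift N y (- z); rewrite -(ler_pM2r (wt_gt0 N z)) normrN.
rewrite mulrAC {2}/wt divff ?mul1r 1?mulrC//.
Qed.

(** Of the [N + 2 * n] powers of decay of [U], the first [N] combine with those of [V] at [y - z]
    into [wt N y], and the others make the integral in [z] converge. *)
Lemma convolution_decays U V : cmeasurable U -> decays U -> cmeasurable V -> decays V ->
  decays (convolution U V).
Proof.
move=> mU dU mV dV N; have [A A0 UA] := dU (N + 2 * n)%N; have [B B0 VB] := dV N.
exists (2 * (A * B * wt_int R n)) => [|y].
  by rewrite !mulr_ge0// wt_int_ge0.
have bnd z : modc (U z * V (y - z)) <= A * B * wt N y * wt (2 * n) z.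
  rewrite modcM (le_trans (ler_pM (modc_ge0 _) (modc_ge0 _) (UA z) (VB _)))//.
  have -> : A * wt (N + 2 * n) z * (B * wt N (y - z)) =
      A * B * (wt N z * wt N (y - z)) * wt (2 * n) z.
    by rewrite -(wtM_expr N (2 * n) z) /wt; field; rewrite !expf_neq0 ?gt_eqF ?norm1_gt0.
  by rewrite ler_wpM2r ?wt_ge0// ler_wpM2l ?mulr_ge0// wt_sub.
have mUV : cmeasurable (fun z => U z * V (y - z)).
  by apply: cmeasurableM => //; apply: cmeasurable_comp => //; exact: measurable_sub.
have iUV := cintegrableW mUV bnd (integrable_wtZ _).
have := modc_cintegral iUV (integrable_wtZ (A * B * wt N y)) _ (aeW _ bnd).
move=> /(_ (fun z => _)) h; apply: (le_trans (h _)) => [z|].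
  by rewrite mulr_ge0 ?wt_ge0// mulr_ge0 ?wt_ge0// mulr_ge0.
rewrite RintegralZl//; last exact: integrable_wt.
by rewrite le_eqVlt; apply/orP; left; apply/eqP; rewrite /wt_int; ring.
Qed.

(** Fubini, with the character at [y] factored into those at [z] and at [y - z], followed by a
    translation in the inner integral. *)
Lemma fourier_convolution U V xi :
  cmeasurable U -> decays U -> cmeasurable V -> decays V ->
  fourier (convolution U V) xi = fourier U xi * fourier V xi.
Proof.
move=> mU dU mV dV.
have iU := cintegrable_decays mU dU; have iV := cintegrable_decays mV dV.
have [A A0 UA] := dU (2 * n)%N; have [B B0 VB] := dV (2 * n)%N.
have iUe := cintegrable_cexp xi iU.
have mcV y : cmeasurable (fun z => V (y - z)).
  by apply: cmeasurable_comp => //; exact: measurable_sub.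
have iUV y : cintegrable (fun z => U z * V (y - z)).
  apply: (cintegrableW (cmeasurableM mU (mcV y)) _ (integrable_wtZ (A * B))) => z.
  rewrite modcM mulrAC; apply: ler_pM; rewrite ?modc_ge0//.
  by rewrite (le_trans (VB _))// ler_piMr// wt_le1.
pose K y z := U z * V (y - z) * cexp (dot y xi).
have -> : fourier (convolution U V) xi = cintegral (fun y => cintegral (K y)).
  rewrite /fourier; congr cintegral; apply/funext => y.
  rewrite mulrC -[Complex _ _]/(cexp (dot y xi)) -cintegralZ//.
  by congr cintegral; apply/funext => z; rewrite mulrC.
have dxi y z : dot (y - z) xi = dot y xi - dot z xi.
  rewrite /dot -sumrB; apply: eq_bigr => i _; by rewrite !mxE mulrBl.
rewrite (@cintegral_fubini _ _ K (fun z => A * wt (2 * n) z) (fun z => B * wt (2 * n) z) (A + B)).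
- have -> : (fun z => cintegral (K^~ z)) = fun z => fourier V xi * (U z * cexp (dot z xi)).
    apply/funext => z; rewrite [RHS]mulrC /fourier -[X in _ = _ * X](cintegral_translate z).
    + rewrite -cintegralZ.
        congr cintegral; apply/funext => y; rewrite /K -[Complex _ _]/(cexp (dot (y - z) xi)).
        have -> : cexp (dot y xi) = cexp (dot z xi) * cexp (dot (y - z) xi).
          by rewrite -cexpD dxi addrC subrK.
        by rewrite mulrACA mulrA.
      have := cintegrable_affine (- z) (oner_neq0 R) (cintegrable_cexp xi iV).
      by congr cintegrable; apply/funext => y; rewrite scale1r.
    + by apply: cmeasurableM => //; exact: cmeasurable_cexp.
    + move=> N; have [D D0 VD] := dV N; exists D => // u.
      by rewrite modcM modc_cexp mulr1.
  by rewrite cintegralZ// mulrC.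
- apply: cmeasurableM; first apply: cmeasurableM.
  + exact: (cmeasurable_comp mU measurable_snd).
  + exact: (cmeasurable_comp mV (measurable_rVB measurable_fst measurable_snd)).
  + exact: (cmeasurable_comp (cmeasurable_cexp xi) measurable_fst).
- exact: integrable_wtZ.
- exact: integrable_wtZ.
- by move=> z; rewrite mulr_ge0 ?wt_ge0//= (le_trans (ler_piMr A0 (wt_le1 _ _)))// lerDl.
- by move=> z; rewrite mulr_ge0 ?wt_ge0//= (le_trans (ler_piMr B0 (wt_le1 _ _)))// lerDr.
- by move=> y z; rewrite /K 2!modcM modc_cexp mulr1 ler_pM ?modc_ge0.
Qed.

Lemma mpoly_size1_eval (P : mpoly n R[i]) y z : (mmeasure mdeg P <= 1)%N -> peval P y = peval P z.
Proof. by move=> /msize1_polyC ->; rewrite /peval !mevalC. Qed.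

(** The case [k = 0] of [average_taylor] with [b = 0] and [K = 0]: near [x] the function is within a
    multiple of [|y - x|] of a constant. The error vanishes at [y = x], so this constant is the
    value at [x]. *)
Lemma LP_ccontinuous (lam : nat) (phi : 'rV[R]_n -> R[i]) l w B : (0 < lam)%N -> schwartz phi ->
  cmeasurable w -> (forall z, modc (w z) <= B) -> ccontinuous (LP lam phi l w).
Proof.
move=> lam0 sphi mw wB x e e0; have pw := bounded_pgrowth wB.
have B0 : 0 <= B by rewrite (le_trans _ (wB 0))// modc_ge0.
have [C C0 HC] := average_taylor 0 0 sphi (@ler01 R).
pose a : R := lam%:R ^+ l.
have a0 : 0 < a by rewrite exprn_gt0// ltr0n.
have wA : {ae leb, forall z, modc (w z) <= B * (1 + 0 * `|z - x|) ^+ 0}.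
  by apply: aeW => z; rewrite expr0 mulr1.
have [P P1 HP] := HC a 0 B w x (lexx 0) (ltW a0) a0 B0 mw pw wA.
have LPE v := LP_average l x v lam0 sphi mw pw.
exists (Num.min a^-1 (e / (C * B * a + 1))).
  by rewrite lt_min invr_gt0 a0 divr_gt0// ltr_wpDl// !mulr_ge0// ltW.
move=> y; rewrite lt_min => /andP[y1 y2].
have h0 := HP 0; rewrite normr0 mulr0 ler01 expr1 mulr0 addr0 in h0.
have := h0 isT; rewrite -LPE => {}h0.
have {}h0 : LP lam phi l w (x + 0) = peval P x.
  apply/eqP; rewrite -subr_eq0; apply/eqP/modc_eq0/eqP.
  by rewrite eq_le h0 modc_ge0.
have := HP (y - x) _; rewrite -LPE (addrC x) subrK => h1.
have ay : a * `|y - x| <= 1 by rewrite -ler_pdivlMl// mulr1 ltW.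
rewrite addr0 in h0; rewrite h0 (mpoly_size1_eval x y P1).
apply: (le_lt_trans (h1 ay)); rewrite expr1 mulrA.
have p0 : 0 < C * B * a + 1 by rewrite ltr_wpDl// !mulr_ge0// ltW.
move: y2; rewrite ltr_pdivlMr// mulrC; apply: le_lt_trans.
by rewrite ler_wpM2r// lerDl.
Qed.

Section dilates.
Variables (lam : nat) (phi : 'rV[R]_n -> R[i]).
Hypotheses (lam0 : (0 < lam)%N) (sphi : schwartz phi).

Let a0 l : 0 < (lam%:R ^+ l : R). Proof. by rewrite exprn_gt0// ltr0n. Qed.

Lemma phi_cmeasurable : cmeasurable phi.
Proof. by have := schwartz_cmeasurable [::] sphi; rewrite cpartials_nil. Qed.

Lemma phi_decays : decays phi.
Proof. by have := schwartz_decays [::] sphi; rewrite cpartials_nil. Qed.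

Lemma phi_ccontinuous : ccontinuous phi.
Proof.
have [p1 p2] := sphi => x e e0; have e2 : 0 < e / 2 by rewrite divr_gt0.
have [c1 _ _] := p1 [::]; have [c2 _ _] := p2 [::].
have [d1 d10 h1] := continuousP_rV x c1 e2; have [d2 d20 h2] := continuousP_rV x c2 e2.
exists (Num.min d1 d2) => [|y yx]; first by rewrite lt_min d10.
have yi i : `|y ord0 i - x ord0 i| < Num.min d1 d2.
  by apply: le_lt_trans yx; have := coord_le_norm (y - x) i; rewrite !mxE.
rewrite (le_lt_trans (modc_le _))// [ltRHS](splitr e) ltrD//.
  by rewrite cReD cReN; apply: h1 => i; have := yi i; rewrite lt_min => /andP[].
by rewrite cImD cImN; apply: h2 => i; have := yi i; rewrite lt_min => /andP[].
Qed.

Lemma dilateE l x :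
  dilate lam phi l x = real_complex R ((lam%:R ^+ l) ^+ n) * phi (lam%:R ^+ l *: x).
Proof. by rewrite /dilate exprM !rmorphXn rmorph_nat. Qed.

Lemma dilate_cmeasurable l : cmeasurable (dilate lam phi l).
Proof.
rewrite (funext (dilateE l)); apply: cmeasurableM; first exact: cmeasurable_cst.
apply: (cmeasurable_comp phi_cmeasurable).
have := measurable_affine (0 : 'rV[R]_n) (lam%:R ^+ l); congr measurable_fun.
by apply/funext => u; rewrite add0r.
Qed.

Lemma dilate_decays l : decays (dilate lam phi l).
Proof.
move=> N; have [B B0 h] := phi_decays N; exists ((lam%:R ^+ l) ^+ n * B) => [|x].
  by rewrite mulr_ge0// exprn_ge0// ltW.
rewrite dilateE modcM modc_real ger0_norm ?exprn_ge0 ?(ltW (a0 l))// -mulrA.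
rewrite ler_wpM2l ?exprn_ge0 ?(ltW (a0 l))//.
rewrite (le_trans (h _))// ler_wpM2l// lef_pV2 ?posrE ?exprn_gt0 ?norm1_gt0//.
rewrite lerXn2r ?nnegrE ?(ltW (norm1_gt0 _))// lerD2l normrZ ler_peMl//.
by rewrite ger0_norm ?(ltW (a0 l))// exprn_ege1// ler1n.
Qed.

Lemma dilate_ccontinuous l : ccontinuous (dilate lam phi l).
Proof.
rewrite (funext (dilateE l)); apply: ccontinuousM; first exact: ccontinuous_cst.
move=> x e e0; have [d d0 h] := phi_ccontinuous (lam%:R ^+ l *: x) e0.
exists (d / lam%:R ^+ l) => [|y]; first by rewrite divr_gt0.
rewrite ltr_pdivlMr// => yx; apply: h; rewrite -scalerBr normrZ.
by rewrite ger0_norm ?(ltW (a0 l))// mulrC.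
Qed.

Lemma fourier_dilate l xi : fourier (dilate lam phi l) xi = fourier phi ((lam%:R ^+ l)^-1 *: xi).
Proof.
rewrite /fourier.
have c0 : (lam%:R ^+ l : R)^-1 != 0 by rewrite invr_eq0 gt_eqF.
have iphi := cintegrable_decays phi_cmeasurable phi_decays.
have E u : dilate lam phi l (0 + (lam%:R ^+ l)^-1 *: u) * cexp (dot (0 + (lam%:R ^+ l)^-1 *: u) xi) =
  real_complex R ((lam%:R ^+ l) ^+ n) * (phi u * cexp (dot u ((lam%:R ^+ l)^-1 *: xi))).
  rewrite add0r dilateE scalerA divff ?gt_eqF// scale1r -mulrA; congr (_ * (_ * cexp _)).
  by rewrite dotZr /dot mulr_sumr; apply: eq_bigr => i _; rewrite mxE mulrA.
rewrite (cintegral_affineV (y := 0) c0).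
  rewrite (funext E) cintegralZ; last exact: cintegrable_cexp.
  rewrite mulrA -rmorphM ger0_norm ?invr_ge0 ?(ltW (a0 l))// -exprMn mulVf ?gt_eqF//.
  by rewrite expr1n mul1r.
by rewrite (funext E); apply: cintegrableZ; exact: cintegrable_cexp.
Qed.

End dilates.

Lemma enormZ0 (c : R) xi : 0 <= c -> enorm (c *: xi) = c * enorm xi.
Proof. by move=> c0; rewrite enormZ ger0_norm. Qed.

(** The transforms are compared on two regions. Where [enorm xi <= lam^j] one has
    [enorm xi <= lam^(m-1)], so the transform of the dilate of level [m] is 1; elsewhere that of
    level [j] is 0. *)
Lemma LP_dilate (lam : nat) (phi : 'rV[R]_n -> R[i]) j m :
  (1 < lam)%N -> LP_function lam phi -> (j < m)%N ->
  LP lam phi m (dilate lam phi j) = dilate lam phi j.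
Proof.
move=> lam1 [sphi supp one] jm; have lam0 : (0 < lam)%N by exact: ltnW.
have a0 l : 0 < (lam%:R ^+ l : R) by rewrite exprn_gt0// ltr0n.
have mj := dilate_cmeasurable lam sphi j.
have dj := dilate_decays lam0 sphi j.
have mm := dilate_cmeasurable lam sphi m.
have dm := dilate_decays lam0 sphi m.
have cc : ccontinuous (LP lam phi m (dilate lam phi j)).
  have [B _ h] := dj 0%N; apply: (@LP_ccontinuous _ _ _ _ B) => // z.
  by have := h z; rewrite /wt expr0 invr1 mulr1.
have dd : decays (LP lam phi m (dilate lam phi j)) by exact: convolution_decays.
have mc := ccontinuous_cmeasurable cc.
pose G y := LP lam phi m (dilate lam phi j) y - dilate lam phi j y.
have G0 y : G y = 0.
  apply: fourier_injective => [|N||xi].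
  - by apply: cmeasurableB.
  - have [A A0 hA] := dd N; have [B B0 hB] := dj N; exists (A + B) => [|z].
      exact: addr_ge0.
    by rewrite (le_trans (modcB _ _))// mulrDl lerD.
  - rewrite /G (_ : (fun _ => _) = fun y => LP lam phi m (dilate lam phi j) y + (-1) * dilate lam phi j y).
      apply: ccontinuousD => //; apply: ccontinuousM; first exact: ccontinuous_cst.
      exact: dilate_ccontinuous.
    by apply/funext => z; rewrite mulN1r.
  - have -> : fourier G xi = fourier (LP lam phi m (dilate lam phi j)) xi - fourier (dilate lam phi j) xi.
      rewrite /fourier -cintegralB; last 2 first.
      + by apply: cintegrable_cexp; exact: cintegrable_decays.
      + by apply: cintegrable_cexp; exact: cintegrable_decays.
      by congr cintegral; apply/funext => z; rewrite mulrBl.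
    rewrite fourier_convolution// !fourier_dilate//.
    have [xs|xl] := leP (enorm xi) (lam%:R ^+ j).
      rewrite [X in _ * X]one ?mulr1 ?subrr// enormZ0 ?invr_ge0 ?(ltW (a0 m))//.
      rewrite mulrC ler_pdivrMr// (le_trans xs)// mulrC ler_pdivlMr ?ltr0n//.
      by rewrite -exprSr ler_weXn2l// ler1n.
    suff -> : fourier phi ((lam%:R ^+ j)^-1 *: xi) = 0 by rewrite mul0r subrr.
    apply: contrapT => /eqP h; have := supp _ (@subset_closure _ [set xi | fourier phi xi != 0] _ h).
    rewrite /= enormZ0 ?invr_ge0 ?(ltW (a0 j))// mulrC ler_pdivrMr// mul1r.
    by rewrite leNgt xl.
by apply/funext => y; apply/eqP; rewrite -subr_eq0; apply/eqP; exact: G0.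
Qed.

(** Associativity of convolution reduces this to [LP_dilate]. Since [w] is bounded but need not be
    integrable, the decay in the majorant comes from the two kernels: at [y - z] from level [m] and
    at [v - z] from level [j]. *)
Lemma LP_LP (lam : nat) (phi : 'rV[R]_n -> R[i]) j m w B :
  (1 < lam)%N -> LP_function lam phi -> (j < m)%N ->
  cmeasurable w -> (forall z, modc (w z) <= B) ->
  LP lam phi m (LP lam phi j w) = LP lam phi j w.
Proof.
move=> lam1 hphi jm mw wB; have [sphi _ _] := hphi; have lam0 : (0 < lam)%N by exact: ltnW.
have mj := dilate_cmeasurable lam sphi j.
have dj := dilate_decays lam0 sphi j.
have mm := dilate_cmeasurable lam sphi m.
have dm := dilate_decays lam0 sphi m.
have B0 : 0 <= B by rewrite (le_trans _ (wB 0))// modc_ge0.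
have [A1 A10 h1] := dj (2 * n)%N; have [A2 A20 h2] := dm (2 * n)%N.
apply/funext => y.
pose K v z := w v * dilate lam phi j (z - v) * dilate lam phi m (y - z).
have pw := bounded_pgrowth wB.
have shiftm F u : cmeasurable F -> cmeasurable (fun z => F (u - z)).
  by move=> mF; exact: (cmeasurable_comp mF (measurable_sub u)).
have -> : LP lam phi m (LP lam phi j w) y = cintegral (fun z => cintegral (K^~ z)).
  rewrite /LP {1}/convolution; congr cintegral; apply/funext => z.
  rewrite mulrC /convolution -cintegralZ.
    by congr cintegral; apply/funext => v; rewrite mulrC.
  by apply: cintegrable_pgrowth => //; [exact: shiftm|exact: decays_sub].
rewrite -(@cintegral_fubini _ _ K (fun z => A2 * wt (2 * n) (y - z)) (fun z => B * A1 * wt (2 * n) z) (A2 + B * A1)).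
- rewrite /LP /convolution; congr cintegral; apply/funext => v; rewrite /K.
  have -> : (fun z => w v * dilate lam phi j (z - v) * dilate lam phi m (y - z)) =
     fun z => w v * (dilate lam phi j (z - v) * dilate lam phi m (y - v - (z - v))).
    by apply/funext => z; rewrite opprB addrA subrK mulrA.
  have iF : cmeasurable (fun z => dilate lam phi j z * dilate lam phi m (y - v - z)).
    by apply: cmeasurableM => //; exact: shiftm.
  have dF : decays (fun z => dilate lam phi j z * dilate lam phi m (y - v - z)).
    by apply: decaysM => //; exact: decays_sub.
  rewrite cintegralZ; last first.
    have := cintegrable_affine (- v) (oner_neq0 R) (cintegrable_decays iF dF).
    by congr cintegrable; apply/funext => z; rewrite scale1r.
  rewrite (cintegral_translate v iF dF); congr (_ * _).
  by rewrite -[RHS](congr1 (fun F => F (y - v)) (LP_dilate lam1 hphi jm)).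
- apply: cmeasurableM; first apply: cmeasurableM.
  + exact: (cmeasurable_comp mw measurable_fst).
  + exact: (cmeasurable_comp mj (measurable_rVB measurable_snd measurable_fst)).
  + exact: (cmeasurable_comp (shiftm _ y mm) measurable_snd).
- exact: integrable_wtZ_sub.
- exact: integrable_wtZ.
- move=> z; rewrite mulr_ge0 ?wt_ge0//= (le_trans (ler_piMr A20 (wt_le1 _ _)))// lerDl mulr_ge0//.
- by move=> z; rewrite mulr_ge0 ?wt_ge0 ?mulr_ge0//= (le_trans (ler_piMr _ (wt_le1 _ _))) ?lerDr// mulr_ge0.
- move=> v z; rewrite /K 2!modcM mulrC ler_pM ?modc_ge0 ?mulr_ge0 ?modc_ge0//.
  rewrite -mulrA -(opprB z v) wt_opp; apply: ler_pM; rewrite ?modc_ge0//; exact: h1.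
Qed.

End rapid.

(** * Direct and inverse estimates *)

Section growth.
Variables (R : realType) (n : nat).
Local Notation leb := (lebesgue_rV R n).
Implicit Types (x y z : 'rV[R]_n) (g : 'rV[R]_n -> R[i]) (P Q : mpoly n R[i]).

Lemma expr_unbounded (q M : R) (k : nat) : 1 < q -> exists2 K, (k <= K)%N & M <= q ^+ K.
Proof.
move=> q1; have q0 : 0 < q - 1 by rewrite subr_gt0.
have bern m : 1 + m%:R * (q - 1) <= q ^+ m.
  elim: m => [|m IH]; first by rewrite mul0r addr0.
  rewrite exprS; apply: (@le_trans _ _ (q * (1 + m%:R * (q - 1)))).
    rewrite -natr1; have : 0 <= m%:R * (q - 1) ^+ 2 by rewrite mulr_ge0// sqr_ge0.
    by rewrite expr2; nra.
  by rewrite ler_wpM2l// (le_trans ler01)// ltW.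
pose N := Num.bound (M / (q - 1)); exists (maxn k N); first exact: leq_maxl.
apply: le_trans (bern _); have [M0|M0] := leP M 0.
  by rewrite (le_trans M0)// addr_ge0// mulr_ge0// ltW.
apply: (@le_trans _ _ (N%:R * (q - 1))).
  by rewrite -ler_pdivrMr// ltW// archi_boundP// divr_ge0// ltW.
rewrite (@le_trans _ _ ((maxn k N)%:R * (q - 1)))// ?lerDr//.
by rewrite ler_wpM2r// ?(ltW q0)// ler_nat leq_maxr.
Qed.

Lemma ler_expn2r (a b : R) m : 0 <= a -> a <= b -> a ^+ m <= b ^+ m.
Proof. by move=> a0 ab; rewrite lerXn2r ?nnegrE// (le_trans a0). Qed.

Lemma pevalD P Q y : peval (P + Q) y = peval P y + peval Q y.
Proof. exact: mevalD. Qed.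

Lemma pevalB P Q y : peval (P - Q) y = peval P y - peval Q y.
Proof. exact: mevalB. Qed.

Lemma mmeasureD k P Q : (mmeasure mdeg P <= k)%N -> (mmeasure mdeg Q <= k)%N ->
  (mmeasure mdeg (P + Q) <= k)%N.
Proof. by move=> Pk Qk; rewrite (leq_trans (mmeasureD_le _ _ _))// geq_max Pk. Qed.

Lemma mmeasureB k P Q : (mmeasure mdeg P <= k)%N -> (mmeasure mdeg Q <= k)%N ->
  (mmeasure mdeg (P - Q) <= k)%N.
Proof. by move=> Pk Qk; apply: mmeasureD => //; rewrite mmeasureN. Qed.

(** By continuity the bound holds everywhere on the open ball, hence on the closed ball of half the
    radius; halving the radius costs the factor [2^k]. *)
Lemma ae_peval_le k : exists2 D : R, 0 <= D & forall P x (r A : R),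
  (mmeasure mdeg P <= k.+1)%N -> 0 < r ->
  {ae leb, forall y, `|y - x| < r -> modc (peval P y) <= A} ->
  forall y, modc (peval P y) <= D * A * (1 + `|y - x| / r) ^+ k.
Proof.
have [D D0 HD] := peval_ball_growth R n k; exists (D * 2 ^+ k) => [|P x r A Pk r0 PA y].
  by rewrite mulr_ge0// exprn_ge0.
have r2 : 0 < r / 2 by rewrite divr_gt0.
have A0 : 0 <= A.
  have := @ae_ccontinuous_le R n (peval P) x r A (peval_ccontinuous P) PA x.
  by rewrite subrr normr0 => /(_ r0); apply: le_trans; exact: modc_ge0.
have h := HD P x (r / 2) A Pk r2 _ y.
apply: (le_trans (h _)) => [z zr|].
  apply: (ae_ccontinuous_le (peval_ccontinuous P) PA).
  by rewrite (le_lt_trans zr)// ltr_pdivrMr// ltr_pMr//; lra.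
have -> : D * 2 ^+ k * A * (1 + `|y - x| / r) ^+ k = D * A * (2 * (1 + `|y - x| / r)) ^+ k.
  by rewrite exprMn; ring.
rewrite ler_wpM2l ?mulr_ge0//.
have dr : 0 <= `|y - x| / r by rewrite divr_ge0// ltW.
rewrite lerXn2r ?nnegrE ?mulr_ge0 ?addr_ge0 ?divr_ge0 ?(ltW r0)//.
by rewrite invf_div mulrCA; lra.
Qed.

(* Induction on m. Inside the ball of radius r / L^(m+1) the hypothesis suffices; outside,
   1 + L^(m+1) |z - x| >= rho (1 + L^m |z - x|) with rho > 1, and rho^K >= 2 q for K large. *)
Lemma approx_growth k (L q r B C : R) g x (P_ : nat -> mpoly n R[i]) :
  1 < L -> 1 <= q -> 0 < r -> 0 <= C -> (forall z, modc (g z) <= B) ->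
  (forall l, (mmeasure mdeg (P_ l) <= k.+1)%N) ->
  (forall l, {ae leb, forall y, `|y - x| < r / L ^+ l ->
    modc (g y - peval (P_ l) y) <= C / q ^+ l}) ->
  exists A K, 0 <= A /\ forall m, {ae leb, forall z,
    modc (g z - peval (P_ m) z) <= A / q ^+ m * (1 + L ^+ m * `|z - x|) ^+ K}.
Proof.
move=> L1 q1 r0 C0 gB Pk Pg; have L0 : 0 < L by lra. have q0 : 0 < q by lra.
have [D D0 HD] := ae_peval_le k.
have B0 : 0 <= B by rewrite (le_trans _ (gB 0))// modc_ge0.
pose c := 1 + L / r.
have c1 : 1 <= c by rewrite lerDl divr_ge0// ltW.
(* Constant for consecutive polynomials: on the ball of level [m + 1] both are close to [g], hence
   within [2 C / q^m] of each other. The factor [c] compares the radius [r / L^(m+1)] with the scale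
   [L^-m]. *)
pose C2 := D * (2 * C) * c ^+ k.
have C20 : 0 <= C2 by rewrite !mulr_ge0// exprn_ge0// (le_trans ler01).
have qm m : 0 < q ^+ m by rewrite exprn_gt0.
have Lm m : 0 < L ^+ m by rewrite exprn_gt0.
have diff m y : modc (peval (P_ m.+1) y - peval (P_ m) y) <=
    C2 / q ^+ m * (1 + L ^+ m * `|y - x|) ^+ k.
  rewrite -pevalB; have h := @HD (P_ m.+1 - P_ m) x (r / L ^+ m.+1) (2 * C / q ^+ m).
  apply: (le_trans (h _ _ _ y)).
  - exact: mmeasureB.
  - by rewrite divr_gt0.
  - apply: filterS2 (Pg m) (Pg m.+1) => z h1 h2 zr; rewrite pevalB.
    have {}h2 := h2 zr.
    have {}h1 : modc (g z - peval (P_ m) z) <= C / q ^+ m.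
      apply: h1; apply: (lt_le_trans zr); rewrite ler_wpM2l ?(ltW r0)//.
      by rewrite lef_pV2 ?posrE// exprS ler_peMl// ltW.
    have h3 : C / q ^+ m.+1 <= C / q ^+ m.
      by rewrite ler_wpM2l// lef_pV2 ?posrE// exprS ler_peMl// ltW.
    have -> : peval (P_ m.+1) z - peval (P_ m) z =
      (g z - peval (P_ m) z) - (g z - peval (P_ m.+1) z) by ring.
    apply: (le_trans (modcB _ _)); rewrite -mulrA mulr2n mulrDl mul1r lerD//.
    exact: le_trans h2 h3.
  - have -> : C2 / q ^+ m * (1 + L ^+ m * `|y - x|) ^+ k =
        D * (2 * C / q ^+ m) * (c * (1 + L ^+ m * `|y - x|)) ^+ k.
      by rewrite exprMn /C2; ring.
    rewrite ler_wpM2l ?mulr_ge0 ?invr_ge0 ?(ltW (qm _))//.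
    have -> : `|y - x| / (r / L ^+ m.+1) = L / r * (L ^+ m * `|y - x|).
      by rewrite exprS; field; rewrite !gt_eqF.
    have t_ge0 : 0 <= L ^+ m * `|y - x| by rewrite mulr_ge0// ltW.
    have Lr0 : 0 <= L / r by rewrite divr_ge0// ltW.
    have Lrt : 0 <= L / r * (L ^+ m * `|y - x|) by rewrite mulr_ge0.
    apply: ler_expn2r; first exact: addr_ge0.
    by rewrite /c mulrDl mul1r mulrDr mulr1; lra.
pose c' := 1 + r^-1; have r'0 : 0 < r^-1 by rewrite invr_gt0.
have base : exists2 A0, 0 <= A0 & forall z, modc (g z - peval (P_ 0%N) z) <= A0 * (1 + `|z - x|) ^+ k.
  have P0 z : modc (peval (P_ 0%N) z) <= D * (C + B) * (1 + `|z - x| / r) ^+ k.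
    apply: HD => //; apply: filterS (Pg 0%N) => y; rewrite !expr0 !divr1 => h /h {}h.
    have := modcB (g y) (g y - peval (P_ 0%N) y); rewrite opprB addrC subrK => h2.
    by rewrite (le_trans h2)// addrC lerD.
  exists (B + D * (C + B) * c' ^+ k) => [|z].
    by rewrite addr_ge0// !mulr_ge0 ?exprn_ge0 ?addr_ge0// ltW.
  apply: (le_trans (modcB _ _)); rewrite mulrDl lerD//.
    by rewrite (le_trans (gB z))// ler_peMr// exprn_ege1// lerDl.
  apply: (le_trans (P0 z)); rewrite -[leRHS]mulrA -exprMn ler_wpM2l ?mulr_ge0 ?addr_ge0//.
  have rz : 0 <= `|z - x| * r^-1 by rewrite mulr_ge0// ltW.
  apply: ler_expn2r; first exact: addr_ge0.
  have := normr_ge0 (z - x).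
  by rewrite /c' mulrDl mul1r mulrDr mulr1; rewrite -[_ / r]/(_ * r^-1) (mulrC r^-1); lra.
have [A0 A00 hA0] := base.
pose t0 := r / L.
(* The ratio [(1 + L t) / (1 + t)] increases with [t]; [rho] is its value at [t0], the least value
   of [L^m |z - x|] outside the ball of level [m + 1]. *)
pose rho := 1 + (L - 1) * t0 / (1 + t0).
have t00 : 0 < t0 by rewrite divr_gt0.
have rho1 : 1 < rho by rewrite ltrDl divr_gt0 ?addr_gt0// mulr_gt0// subr_gt0.
(* The factor [q] pays for passing from [q^m] to [q^(m+1)], the factor 2 for adding the difference
   of consecutive polynomials to the induction hypothesis; [k <= K] covers the growth of that
   difference. *)
have [K kK HK] := expr_unbounded (2 * q) k rho1.
(* The summands serve the level 0, the inside of the ball and the difference of consecutive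
   polynomials. *)
pose A := A0 + C + C2.
have A_ge0 : 0 <= A by rewrite !addr_ge0.
exists A, K; split=> //.
have mono1 (t : R) : 0 <= t -> 1 <= (1 + t) ^+ K.
  by move=> t1; rewrite exprn_ege1// lerDl.
have Lrho (t : R) : t0 <= t -> rho * (1 + t) <= 1 + L * t.
  move=> t0t; have t1 : 0 < 1 + t0 by rewrite addr_gt0.
  have h : t0 * (1 + t) / (1 + t0) <= t by rewrite ler_pdivrMr// !mulrDr !mulr1 (mulrC t); lra.
  have -> : rho * (1 + t) = 1 + t + (L - 1) * (t0 * (1 + t) / (1 + t0)) by rewrite /rho; ring.
  have -> : 1 + L * t = 1 + t + (L - 1) * t by ring.
  by rewrite lerD2l ler_wpM2l// subr_ge0 ltW.
elim => [|m IH].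
  apply: aeW => z; apply: (le_trans (hA0 z)); rewrite expr0 divr1 mul1r.
  apply: ler_pM => //.
    by rewrite /A -addrA lerDl addr_ge0.
  by rewrite ler_weXn2l// lerDl.
apply: filterS2 IH (Pg m.+1) => z h1 h2.
have [zr|rz] := ltP `|z - x| (r / L ^+ m.+1).
  apply: (le_trans (h2 zr)); rewrite mulrAC; apply: ler_pM => //.
  - by rewrite invr_ge0 ltW.
  - rewrite -[leLHS]mulr1; apply: ler_pM => //; first by rewrite /A; lra.
    by apply: mono1; rewrite mulr_ge0// ltW.
have -> : g z - peval (P_ m.+1) z = (g z - peval (P_ m) z) - (peval (P_ m.+1) z - peval (P_ m) z) by ring.
apply: (le_trans (modcB _ _)); apply: (le_trans (lerD h1 (diff m z))).
pose t := L ^+ m * `|z - x|.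
have t_ge0 : 0 <= t by rewrite mulr_ge0// ltW.
have tt : t0 <= t.
  move: rz; rewrite ler_pdivrMr// exprSr /t /t0 => rz.
  by rewrite ler_pdivrMr// mulrAC mulrC.
rewrite -/t.
apply: (@le_trans _ _ ((2 * A) / q ^+ m * (1 + t) ^+ K)).
  have -> : 2 * A / q ^+ m * (1 + t) ^+ K = A / q ^+ m * (1 + t) ^+ K + A / q ^+ m * (1 + t) ^+ K by ring.
  rewrite lerD2l.
  apply: ler_pM; rewrite ?divr_ge0 ?exprn_ge0 ?addr_ge0 ?(ltW q0)//.
    by rewrite ler_wpM2r ?invr_ge0 ?(ltW (qm _))// /A lerDr addr_ge0.
  by rewrite ler_weXn2l// lerDl.
have -> : L ^+ m.+1 * `|z - x| = L * t by rewrite exprS mulrA.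
apply: (@le_trans _ _ (A / q ^+ m.+1 * (rho ^+ K * (1 + t) ^+ K))).
  rewrite mulrA ler_wpM2r ?exprn_ge0 ?addr_ge0//.
  have -> : 2 * A / q ^+ m = A / q ^+ m.+1 * (2 * q) by rewrite exprS; field; rewrite !gt_eqF.
  by rewrite ler_wpM2l// divr_ge0// ltW.
rewrite -exprMn ler_wpM2l ?divr_ge0 ?(ltW (qm _))//.
have rho0 : 0 <= rho by rewrite (le_trans ler01)// ltW.
apply: ler_expn2r; last exact: Lrho.
by apply: mulr_ge0 => //; exact: addr_ge0.
Qed.

Lemma powR_ge1 (a t : R) : 1 <= a -> 0 <= t -> 1 <= a `^ t.
Proof. by move=> a1 t0; have := ler_powR a1 t0; rewrite powRr0. Qed.

Lemma powR_exprn (L t : R) m : 0 <= L -> (L ^+ m) `^ t = (L `^ t) ^+ m.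
Proof. by move=> L0; rewrite -(powR_mulrn m L0) -(powR_mulrn m (powR_ge0 L t)) powRAC. Qed.

Lemma powR_invr (L t : R) : 0 <= L -> L^-1 `^ t = (L `^ t)^-1.
Proof. by move=> L0; rewrite -(powR_inv1 L0) -(powR_inv1 (powR_ge0 L t)) powRAC. Qed.

Lemma fourier_near0 (lam : nat) (phi : 'rV[R]_n -> R[i]) : (0 < n)%N -> (0 < lam)%N ->
  LP_function lam phi ->
  forall xi, `|xi| <= (lam%:R * n%:R)^-1 -> fourier phi xi = 1.
Proof.
move=> n0 lam0 [_ _ one] xi xis; apply: one; apply: (le_trans (enorm_le_norm _)).
rewrite -ler_pdivlMl ?ltr0n// (le_trans xis)// invfM mulrC//.
Qed.

(** Since the average reproduces [P], the difference is minus the average of [g - P]. It is taken at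
    scale [lam^-l], which is at most [lam^-m], so [average_bound] applies with [b = lam^m]. *)
Lemma LP_sub_poly (lam : nat) (phi : 'rV[R]_n -> R[i]) K : (0 < n)%N -> (1 < lam)%N ->
  LP_function lam phi -> exists2 D : R, 0 <= D &
  forall g (B : R) P x (A : R) m l, cmeasurable g -> (forall z, modc (g z) <= B) ->
    0 <= A -> (m <= l)%N ->
    {ae leb, forall z, modc (g z - peval P z) <= A * (1 + lam%:R ^+ m * `|z - x|) ^+ K} ->
    forall y, modc (peval P y - LP lam phi l g y) <=
      D * A * (1 + lam%:R ^+ m * `|y - x|) ^+ K.
Proof.
move=> n0 lam1 hphi; have [sphi _ _] := hphi; have lam0 : (0 < lam)%N by exact: ltnW.
have mphi := phi_cmeasurable sphi; have dphi := phi_decays sphi.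
have [B' B'0 HB'] := dphi (K + 2 * n)%N.
exists (2 * wt_int R n * B') => [|g B P x A m l mg gB A0 ml gP y].
  by rewrite !mulr_ge0// wt_int_ge0.
have a0 i : 0 < (lam%:R ^+ i : R) by rewrite exprn_gt0// ltr0n.
have pg := bounded_pgrowth gB.
have B0 : 0 <= B by rewrite (le_trans _ (gB 0))// modc_ge0.
have mP : cmeasurable (peval P) by exact: ccontinuous_cmeasurable (peval_ccontinuous P).
have [B1 HB1] := peval_growth (leqnSn (mmeasure mdeg P)).
have pP : pgrowth (peval P).
  exists `|B1|, (mmeasure mdeg P); split=> // z; apply: (le_trans (HB1 z)).
  by rewrite ler_wpM2r ?ler_norm// exprn_ge0// addr_ge0.
have pw : pgrowth (fun z => g z - peval P z).
  exists (B + `|B1|), (mmeasure mdeg P); split=> [|z]; first exact: addr_ge0.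
  apply: (le_trans (modcB _ _)); rewrite mulrDl lerD//.
    by rewrite (le_trans (gB z))// ler_peMr// exprn_ege1// lerDl.
  apply: (le_trans (HB1 z)).
  by rewrite ler_wpM2r ?ler_norm// exprn_ge0// addr_ge0.
pose h : R := - (lam%:R ^+ l)^-1.
have r0 : 0 < (lam%:R * n%:R : R)^-1 by rewrite invr_gt0 mulr_gt0// ltr0n.
have E1 : LP lam phi l g y = cintegral (fun u => g (y + h *: u) * phi u).
  rewrite -[in LHS](addr0 y) LP_average//; congr cintegral; apply/funext => u.
  by rewrite scaler0 addr0.
have E2 := average_polynomial P y h mphi dphi r0 (fourier_near0 n0 lam0 hphi).
have -> : peval P y - LP lam phi l g y =
    - cintegral (fun u => (g (y + h *: u) - peval P (y + h *: u)) * phi u).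
  rewrite -E2 E1 -opprB -cintegralB.
  - by congr (- cintegral _); apply/funext => u; rewrite mulrBl.
  - exact: cintegrable_average.
  - exact: cintegrable_average.
have h0 : h != 0 by rewrite oppr_eq0 invr_eq0 gt_eqF.
have bh : lam%:R ^+ m * `|h| <= 1.
  rewrite normrN ger0_norm ?invr_ge0 ?(ltW (a0 _))// ler_pdivrMr// mul1r.
  by rewrite ler_weXn2l// ler1n.
rewrite modcN.
have := @average_bound R n (fun z => g z - peval P z) phi y x h _ A B' K
  (cmeasurableB mg mP) pw mphi dphi (ltW (a0 m)) bh h0 A0 gP HB'.
by congr (_ <= _); ring.
Qed.

(** Take the last level [m <= l] with [L^-m] still at least [d]. If it is not [l], then [L^-m] is
    comparable to [d]. *)
Lemma scale_choice (L d : R) l : 0 <= d -> d <= 1 -> exists2 m, (m <= l)%N &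
  L ^+ m * d <= 1 /\ (m = l \/ 1 < L ^+ m.+1 * d).
Proof.
move=> d0 d1; elim: l => [|l [m ml [Lm [ml'|ml']]]].
- by exists 0%N => //; rewrite expr0 mul1r; split=> //; left.
- have [h|h] := leP (L ^+ l.+1 * d) 1; first by exists l.+1 => //; split=> //; left.
  by exists m; [exact: leq_trans ml _|split=> //; right; rewrite ml'].
- by exists m; [exact: leq_trans ml _|split=> //; right].
Qed.

Lemma LP_error (lam : nat) (phi : 'rV[R]_n -> R[i]) (s B : R) g x k C (r : R) :
  (0 < n)%N -> (1 < lam)%N ->
  LP_function lam phi -> 0 < s -> cmeasurable g -> (forall z, modc (g z) <= B) ->
  0 < r -> 0 <= C ->
  (forall l, exists2 P, (mmeasure mdeg P <= k.+1)%N &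
    {ae leb, forall y, `|y - x| < r / lam%:R ^+ l ->
      modc (g y - peval P y) <= C / (lam%:R `^ s) ^+ l}) ->
  exists C', forall l, {ae leb, forall y,
    modc (g y - LP lam phi l g y) <= C' * (lam%:R ^- l + `|x - y|) `^ s}.
Proof.
move=> n0 lam1 hphi s0 mg gB r0 C0 gP.
pose L : R := lam%:R; pose q := L `^ s.
have L1 : 1 < L by rewrite ltr1n.
have L0 : 0 < L by lra.
have q1 : 1 <= q by apply: powR_ge1; exact: ltW.
have B0 : 0 <= B by rewrite (le_trans _ (gB 0))// modc_ge0.
pose P_ l := sval (cid2 (gP l)).
have P_k l : (mmeasure mdeg (P_ l) <= k.+1)%N by rewrite /P_; case: cid2.
have P_g l : {ae leb, forall y, `|y - x| < r / L ^+ l ->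
    modc (g y - peval (P_ l) y) <= C / q ^+ l} by rewrite /P_; case: cid2.
have [A [K [A0 HA]]] := approx_growth L1 q1 r0 C0 gB P_k P_g.
have [D D0 HD] := LP_sub_poly K n0 lam1 hphi.
(* With exponent 0 and the zero polynomial this is a uniform bound on [LP lam phi l g]. *)
have [D' D'0 HD'] := LP_sub_poly 0 n0 lam1 hphi.
have q0 : 0 < q by lra.
have qm m : 0 < q ^+ m by rewrite exprn_gt0.
have Lm m : 0 < L ^+ m by rewrite exprn_gt0.
exists ((A + D * A) * 2 ^+ K * q + (B + D' * B)) => l.
(* The level [m] chosen below depends on [y], so the exceptional sets of all levels are gathered
   into one null set. *)
apply: filterS (ae_foralln HA) => y Hy.
have d0 : 0 <= `|x - y| by [].
have C10 : 0 <= (A + D * A) * 2 ^+ K * q by rewrite !mulr_ge0 ?addr_ge0 ?mulr_ge0 ?exprn_ge0// ltW.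
have C20 : 0 <= B + D' * B by rewrite addr_ge0 ?mulr_ge0.
have base0 : 0 < L ^- l + `|x - y| by rewrite ltr_pwDl// invr_gt0.
rewrite mulrDl.
(* Far from [x] the right-hand side is at least a constant, and boundedness of [g] and of its
   averages suffices. *)
have [d1|d1] := leP `|x - y| 1; last first.
  rewrite (@le_trans _ _ (B + D' * B))//.
    rewrite (le_trans (modcB _ _))// lerD//.
    have g0 : {ae leb, forall z, modc (g z - peval 0 z) <= B * (1 + L ^+ 0 * `|z - x|) ^+ 0}.
      by apply: aeW => z; rewrite /peval meval0 subr0 mulr1.
    have := @HD' g B 0 x B 0%N l mg gB B0 (leq0n _) g0 y.
    by rewrite /peval meval0 sub0r modcN mulr1.
  rewrite -[leLHS]add0r lerD ?(mulr_ge0 C10 (powR_ge0 _ _))//.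
  rewrite ler_peMr// powR_ge1 ?(ltW s0)//.
  by rewrite (le_trans (ltW d1))// lerDr invr_ge0 ltW.
have [m ml [Lmd mm]] := scale_choice L l d0 d1.
rewrite -[leLHS]addr0 lerD ?(mulr_ge0 C20 (powR_ge0 _ _))//.
have -> : g y - LP lam phi l g y = (g y - peval (P_ m) y) + (peval (P_ m) y - LP lam phi l g y).
  by rewrite addrA subrK.
have h1 := Hy m.
have Aq0 : 0 <= A / q ^+ m by rewrite divr_ge0// ltW.
have h2 := @HD g B (P_ m) x _ m l mg gB Aq0 ml (HA m) y.
have dm : (1 + L ^+ m * `|y - x|) ^+ K <= 2 ^+ K.
  apply: ler_expn2r; first by rewrite addr_ge0// mulr_ge0// ltW.
  by rewrite distrC; lra.
apply: (@le_trans _ _ ((A + D * A) * 2 ^+ K * (q ^+ m)^-1)).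
  rewrite (le_trans (modcD _ _))// (le_trans (lerD h1 h2))//.
  apply: (@le_trans _ _ ((A + D * A) / q ^+ m * (1 + L ^+ m * `|y - x|) ^+ K)).
    by rewrite -/L le_eqVlt; apply/orP; left; apply/eqP; ring.
  by rewrite [leRHS]mulrAC ler_wpM2l// divr_ge0 ?addr_ge0 ?mulr_ge0// ltW.
rewrite -[leRHS]mulrA ler_wpM2l ?mulr_ge0 ?addr_ge0 ?mulr_ge0 ?exprn_ge0//.
have -> : (q ^+ m)^-1 = (L ^- m) `^ s by rewrite powR_invr ?(ltW (Lm m))// powR_exprn ?(ltW L0).
rewrite -/L -powRM ?(ltW L0) ?(ltW base0)//.
apply: ge0_ler_powR; rewrite ?nnegrE ?mulr_ge0 ?invr_ge0 ?(ltW (Lm _)) ?(ltW L0) ?(ltW base0) ?(ltW s0)//.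
(* In both cases [L^-m <= L (L^-l + |x - y|)]; the power [s] of the factor [L] is the [q] in the
   constant. *)
case: mm => [->|mm].
  apply: (@le_trans _ _ (L ^- l + `|x - y|)); first by rewrite lerDl.
  by rewrite ler_peMl// ltW.
apply: (@le_trans _ _ (L * `|x - y|)).
  have -> : L * `|x - y| = L ^- m * (L ^+ m.+1 * `|x - y|).
    by rewrite exprS; field; rewrite gt_eqF.
  by rewrite ler_peMr ?invr_ge0 ?(ltW (Lm m))// ltW.
by rewrite ler_wpM2l ?(ltW L0)// lerDr invr_ge0 ltW.
Qed.

End growth.

(** * From Littlewood-Paley errors to local polynomials *)

Section inverse_estimate.
Variables (R : realType) (n : nat).
Local Notation leb := (lebesgue_rV R n).
Implicit Types (x y z : 'rV[R]_n) (g w : 'rV[R]_n -> R[i]) (P Q : mpoly n R[i]).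

Lemma LPB (lam : nat) (phi : 'rV[R]_n -> R[i]) l g w (B B' : R) : (0 < lam)%N -> schwartz phi ->
  cmeasurable g -> (forall z, modc (g z) <= B) ->
  cmeasurable w -> (forall z, modc (w z) <= B') ->
  forall y, LP lam phi l (fun z => g z - w z) y = LP lam phi l g y - LP lam phi l w y.
Proof.
move=> lam0 sphi mg gB mw wB y.
have md := dilate_cmeasurable lam sphi l; have dd := dilate_decays lam0 sphi l.
have ms : cmeasurable (fun z => dilate lam phi l (y - z)).
  exact: (cmeasurable_comp md (measurable_sub y)).
have ds := decays_sub y dd.
rewrite /LP /convolution -cintegralB.
- by congr cintegral; apply/funext => z; rewrite mulrBl.
- exact: cintegrable_pgrowth mg (bounded_pgrowth gB) ms ds.
- exact: cintegrable_pgrowth mw (bounded_pgrowth wB) ms ds.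
Qed.

Lemma LP_taylor (lam : nat) (phi : 'rV[R]_n -> R[i]) k K (r0 : R) : (0 < lam)%N -> schwartz phi ->
  0 <= r0 -> exists2 C : R, 0 <= C & forall i j (A B : R) w x, (j <= i)%N -> 0 <= A ->
    cmeasurable w -> (forall z, modc (w z) <= B) ->
    {ae leb, forall z, modc (w z) <= A * (1 + lam%:R ^+ j * `|z - x|) ^+ K} ->
    exists2 P, (mmeasure mdeg P <= k.+1)%N & forall v, lam%:R ^+ i * `|v| <= r0 ->
      modc (LP lam phi i w (x + v) - peval P (x + v)) <= C * A * (lam%:R ^+ i * `|v|) ^+ k.+1.
Proof.
move=> lam0 sphi r00; have [C C0 HC] := average_taylor k K sphi r00.
exists C => // i j A B w x ji A0 mw wB wA.
have a0 l : 0 < (lam%:R ^+ l : R) by rewrite exprn_gt0// ltr0n.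
have pw := bounded_pgrowth wB.
have ba : lam%:R ^+ j <= lam%:R ^+ i :> R by rewrite ler_weXn2l// ler1n.
have [P Pk HP] := HC _ _ A w x (ltW (a0 j)) ba (a0 i) A0 mw pw wA.
by exists P => // v vr; rewrite LP_average//; exact: HP.
Qed.

Lemma LP_bounded (lam : nat) (phi : 'rV[R]_n -> R[i]) :
  (0 < n)%N -> (1 < lam)%N -> LP_function lam phi ->
  exists2 D : R, 0 <= D & forall g (B : R) l, cmeasurable g -> (forall z, modc (g z) <= B) ->
    forall y, modc (LP lam phi l g y) <= D * B.
Proof.
move=> n0 lam1 hphi; have [D D0 HD] := LP_sub_poly 0 n0 lam1 hphi.
exists D => // g B l mg gB y; have B0 : 0 <= B by rewrite (le_trans _ (gB 0))// modc_ge0.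
have g0 : {ae leb, forall z, modc (g z - peval 0 z) <= B * (1 + lam%:R ^+ 0 * `|z - 0|) ^+ 0}.
  by apply: aeW => z; rewrite /peval meval0 subr0 mulr1.
have := @HD g B 0 0 B 0%N l mg gB B0 (leq0n _) g0 y.
by rewrite /peval meval0 sub0r modcN mulr1.
Qed.

(** Polynomials for [LP lam phi l g] are built level by level with one constant [A] for all levels.
    The residual [g - LP lam phi l g] is of the required size on the ball of radius [r / lam^l] by
    hypothesis, so the same polynomials serve for [g]. *)
Lemma inverse_estimate (lam : nat) (phi : 'rV[R]_n -> R[i]) (s B C : R) g x k (r : R) :
  (0 < n)%N -> (1 < lam)%N -> LP_function lam phi -> 0 < s -> s < k.+1%:R ->
  cmeasurable g -> (forall z, modc (g z) <= B) -> 0 <= r ->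
  (forall l, {ae leb, forall y,
    modc (g y - LP lam phi l g y) <= C * (lam%:R ^- l + enorm (x - y)) `^ s}) ->
  exists2 C', 0 <= C' & forall l, exists2 P, (mmeasure mdeg P <= k.+1)%N &
    {ae leb, forall y, `|y - x| <= r / lam%:R ^+ l ->
      modc (g y - peval P y) <= C' / (lam%:R `^ s) ^+ l}.
Proof.
move=> n0 lam1 hphi s0 sk mg gB r0 gC; have [sphi _ _] := hphi.
have lam0 : (0 < lam)%N by exact: ltnW.
pose L : R := lam%:R; pose q := L `^ s.
have L1 : 1 < L by rewrite ltr1n.
have L0 : 0 < L by lra.
have q1 : 1 <= q by apply: powR_ge1; exact: ltW.
have q0 : 0 < q by lra.
have qL : q < L ^+ k.+1.
  by rewrite -powR_mulrn ?(ltW L0)// /q /powR gt_eqF// ltr_expR ltr_pM2r// ln_gt0.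
have qm m : 0 < q ^+ m by rewrite exprn_gt0.
have Lm m : 0 < L ^+ m by rewrite exprn_gt0.
have B0 : 0 <= B by rewrite (le_trans _ (gB 0))// modc_ge0.
have [D D0 HD] := LP_bounded n0 lam1 hphi.
pose rj j z := g z - LP lam phi j g z.
have mLP j : cmeasurable (LP lam phi j g).
  by apply: ccontinuous_cmeasurable; exact: LP_ccontinuous lam0 sphi mg gB.
have mr j : cmeasurable (rj j) by exact: cmeasurableB.
have rB j z : modc (rj j z) <= B + D * B.
  by rewrite (le_trans (modcB _ _))// lerD// HD.
(* The factor [n^s] comes from [enorm <= n * |.|]; the absolute value is there because nothing fixes
   the sign of [C]. *)
pose C1 := `|C| * n%:R `^ s.
have C10 : 0 <= C1 by rewrite mulr_ge0// powR_ge0.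
have rC j : {ae leb, forall z, modc (rj j z) <= C1 / q ^+ j * (1 + L ^+ j * `|z - x|) ^+ k.+1}.
  apply: filterS (gC j) => z h; apply: (le_trans h).
  pose t := L ^+ j * `|z - x|.
  have t0 : 0 <= t by rewrite mulr_ge0// ltW.
  have Lj0 : 0 <= L ^- j by rewrite invr_ge0 ltW.
  have n1 : 1 <= n%:R :> R by rewrite ler1n.
  have le1 : L ^- j + enorm (x - z) <= n%:R * (L ^- j * (1 + t)).
    rewrite !mulrDr mulr1 /t mulKf ?gt_eqF// lerD//; first by rewrite ler_peMl.
    by rewrite (le_trans (enorm_le_norm _))// distrC.
  have e0 : 0 <= L ^- j + enorm (x - z) by rewrite addr_ge0// enorm_ge0.
  apply: (@le_trans _ _ (`|C| * (n%:R * (L ^- j * (1 + t))) `^ s)).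
    apply: (le_trans (ler_wpM2r (powR_ge0 _ _) (ler_norm C))); apply: ler_wpM2l => //.
    by apply: ge0_ler_powR => //; rewrite ?nnegrE ?mulr_ge0 ?addr_ge0 ?(ltW s0).
  rewrite powRM ?mulr_ge0 ?addr_ge0// powRM ?addr_ge0//.
  rewrite powR_invr ?(ltW (Lm j))// powR_exprn ?(ltW L0)// -/q !mulrA -/C1 -/t.
  rewrite ler_wpM2l ?divr_ge0 ?(ltW (qm j))// -powR_mulrn ?addr_ge0//.
  by apply: ler_powR; [rewrite lerDl|exact: ltW].
(* [T1] serves the residuals, which grow with exponent [k + 1]; [T0] serves [g] itself, which is
   bounded. *)
have [T1 T10 HT1] := LP_taylor k k.+1 lam0 sphi r0.
have [T0 T00 HT0] := LP_taylor k 0 lam0 sphi r0.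
pose C2 := T1 * (C1 * q) * (1 + L ^+ k.+1).
(* The first summand covers the levels 0 and 1. The second solves [(A + C2) q = A L^(k+1)] for [A];
   it is nonnegative because [q < L^(k+1)]. *)
pose A := T0 * B * q + C2 * q / (L ^+ k.+1 - q).
have C20 : 0 <= C2 by rewrite !mulr_ge0 ?addr_ge0 ?exprn_ge0// ltW.
have Lq0 : 0 < L ^+ k.+1 - q by rewrite subr_gt0.
have q_ge0 := ltW q0; have Lq_ge0 := ltW Lq0.
have TBq : 0 <= T0 * B * q by rewrite !mulr_ge0.
have C2q : 0 <= C2 * q / (L ^+ k.+1 - q) by rewrite divr_ge0// mulr_ge0.
have A0 : 0 <= A by exact: addr_ge0.
have A1 : T0 * B * q <= A by rewrite lerDl.
have A2 : (A + C2) * q <= A * L ^+ k.+1.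
  rewrite mulrDl -lerBrDl -mulrBr /A mulrDl divfK ?gt_eqF// lerDr.
  by rewrite !mulr_ge0// ltW.
have step l : exists2 P, (mmeasure mdeg P <= k.+1)%N & forall v, L ^+ l * `|v| <= r ->
   modc (LP lam phi l g (x + v) - peval P (x + v)) <= A / q ^+ l * (L ^+ l * `|v|) ^+ k.+1.
  (* The recursion passes from level [l + 1] to [l + 2] by means of the residual of level [l], so
     the levels 0 and 1 are treated directly. *)
  have small i : (i <= 1)%N -> exists2 P, (mmeasure mdeg P <= k.+1)%N & forall v, L ^+ i * `|v| <= r ->
   modc (LP lam phi i g (x + v) - peval P (x + v)) <= A / q ^+ i * (L ^+ i * `|v|) ^+ k.+1.
    move=> i1.
    have g0 : {ae leb, forall z, modc (g z) <= B * (1 + L ^+ 0 * `|z - x|) ^+ 0}.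
      by apply: aeW => z; rewrite mulr1.
    have [P Pk HP] := HT0 i 0%N B B g x (leq0n _) B0 mg gB g0.
    exists P => // v vr; apply: (le_trans (HP v vr)).
    rewrite ler_wpM2r ?exprn_ge0 ?mulr_ge0 ?(ltW (Lm _))//.
    rewrite ler_pdivlMr//; apply: le_trans A1.
    rewrite ler_wpM2l ?mulr_ge0//.
    by case: i i1 {P Pk HP vr} => [|[|//]] _; rewrite ?expr0 ?expr1.
  case: l => [|l]; first exact: small.
  elim: l => [|l [P Pk HP]]; first exact: small.
  have Aj : 0 <= C1 / q ^+ l by rewrite divr_ge0// ltW.
  have [P1 P1k HP1] := HT1 l.+1 l _ _ (rj l) x (leqnSn l) Aj (mr l) (rB l) (rC l).
  have [P2 P2k HP2] := HT1 l.+2 l _ _ (rj l) x (leqW (leqnSn l)) Aj (mr l) (rB l) (rC l).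
  (* Passing to level [l + 2] multiplies the variable by [L], which leaves room [L^(k+1) / q] for
     the error already present and for those of [P1] and [P2]. *)
  exists (P + (P2 - P1)) => [|v vr]; first by apply: mmeasureD => //; exact: mmeasureB.
  have LPr i : (l < i)%N -> forall y, LP lam phi i (rj l) y = LP lam phi i g y - LP lam phi l g y.
    move=> li y; rewrite (LPB i lam0 sphi mg gB (mLP l) (B' := D * B)) => [|z]; last exact: HD.
    by rewrite (LP_LP lam1 hphi li mg gB).
  have E : LP lam phi l.+2 g (x + v) = LP lam phi l.+1 g (x + v) +
      (LP lam phi l.+2 (rj l) (x + v) - LP lam phi l.+1 (rj l) (x + v)).
    by rewrite !LPr//; ring.
  rewrite pevalD pevalB E.
  have -> : forall a b c d e f : R[i], a + (b - c) - (d + (e - f)) = (a - d) + ((b - e) - (c - f)).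
    by move=> *; ring.
  pose t := L ^+ l.+1 * `|v|.
  have t0 : 0 <= t by rewrite mulr_ge0// ltW.
  have vE : L ^+ l.+2 * `|v| = L * t by rewrite exprS mulrA.
  have tr : t <= r by rewrite (le_trans _ vr)// vE ler_peMl// ltW.
  have h := HP v tr; have h1 := HP1 v tr; have h2 := HP2 v vr.
  apply: (le_trans (modcD _ _)); apply: (le_trans (lerD h (modcB _ _))).
  apply: (le_trans (lerD (lexx _) (lerD h2 h1))).
  rewrite -/L vE -/t.
  have -> : A / q ^+ l.+1 * t ^+ k.+1 + (T1 * (C1 / q ^+ l) * (L * t) ^+ k.+1 + T1 * (C1 / q ^+ l) * t ^+ k.+1) =
    (A + C2) * q / q ^+ l.+2 * t ^+ k.+1.
    rewrite [(L * t) ^+ _]exprMn /C2 (exprS q l.+1) (exprS q l); field.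
    by rewrite !gt_eqF.
  have -> : A / q ^+ l.+2 * (L * t) ^+ k.+1 = A * L ^+ k.+1 / q ^+ l.+2 * t ^+ k.+1.
    by rewrite [(L * t) ^+ _]exprMn; ring.
  by rewrite ler_wpM2r ?exprn_ge0// ler_wpM2r// invr_ge0 ltW.
exists (C1 * (1 + r) ^+ k.+1 + A * r ^+ k.+1) => [|l].
  by rewrite addr_ge0// mulr_ge0 ?exprn_ge0 ?addr_ge0.
have [P Pk HP] := step l; exists P => //.
apply: filterS (rC l) => y h yr.
have yr' : L ^+ l * `|y - x| <= r by move: yr; rewrite ler_pdivlMr ?exprn_gt0// mulrC.
have := HP (y - x) yr'; rewrite [x + _]addrC subrK => h2.
have -> : g y - peval P y = rj l y + (LP lam phi l g y - peval P y) by rewrite addrA subrK.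
rewrite (le_trans (modcD _ _))// (le_trans (lerD h h2))// [leRHS]mulrDl.
have Ly0 : 0 <= L ^+ l * `|y - x| by rewrite mulr_ge0// ltW.
apply: lerD; rewrite [leRHS]mulrAC; apply: ler_wpM2l; rewrite ?divr_ge0 ?(ltW (qm _))//.
  by apply: ler_expn2r; [exact: addr_ge0|rewrite lerD2l].
exact: ler_expn2r.
Qed.

End inverse_estimate.

(** * Cells of the tile and the class C^s(x) *)

Section cells.
Variables (R : realType) (n : nat).
Local Notation leb := (lebesgue_rV R n).
Implicit Types (x y z : 'rV[R]_n) (f : 'rV[R]_n -> R[i]) (Q : set 'rV[R]_n).

Lemma C_atP (lam k : nat) Q (s : R) f x : (0 < lam)%N ->
  C_at lam k Q s f x <-> exists2 C : R, 0 <= C & forall l,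
    exists2 P, (mmeasure mdeg P <= k.+1)%N & {ae leb, forall y, cell lam Q l x y ->
      modc (f y - peval P y) <= C / (lam%:R `^ s) ^+ l}.
Proof.
move=> lam0; have L0 : 0 < lam%:R :> R by rewrite ltr0n.
have q0 : 0 < (lam%:R : R) `^ s by rewrite powR_gt0.
have qE l : lam%:R `^ (l%:R * s) = (lam%:R `^ s) ^+ l :> R.
  by rewrite mulrC powRrM powR_mulrn// ltW.
have ql l : 0 < ((lam%:R : R) `^ s) ^+ l by rewrite exprn_gt0.
rewrite /C_at; set S := ereal_sup _; split=> [Soo|[C C0 HC]].
  have [M M0 SM] : exists2 M : R, 0 <= M & (S <= M%:E)%E.
    case: S Soo => [r _|//|_]; last by exists 0 => //; rewrite leNye.
    by exists `|r| => //; rewrite lee_fin ler_norm.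
  (* The infimum over polynomials may fail to be attained; the extra 1 gives a strict inequality,
     hence a polynomial. *)
  exists (M + 1) => [|l]; first by rewrite addr_ge0.
  have : (osc lam k Q f x l < ((M + 1) / (lam%:R `^ s) ^+ l)%:E)%E.
    have h : ((lam%:R `^ (l%:R * s))%:E * osc lam k Q f x l <= M%:E)%E.
      by apply: le_trans SM; apply: ereal_sup_ubound; exists l.
    rewrite qE -lee_pdivlMl// in h; apply: (le_lt_trans h).
    by rewrite -EFinM lte_fin mulrC ltr_pM2r ?invr_gt0// ltrDl.
  move=> /ereal_inf_lt[_ [P Pk <-]] /ltW /ess_supP h; exists P => //.
  by apply: filterS h => y + yQ; rewrite lee_fin indicE mem_set// mul1r.
apply: (@le_lt_trans _ _ C%:E); last exact: ltry.
apply: ub_ereal_sup => _ [l _ <-]; have [P Pk HP] := HC l.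
rewrite qE -lee_pdivlMl// -EFinM mulrC.
apply: (@le_trans _ _ (Linfty_norm (cell lam Q l x) (fun y => f y - peval P y))).
  by apply: ereal_inf_lbound; exists P.
apply/ess_supP; apply: filterS HP => y h; rewrite lee_fin indicE.
have [/set_mem/h|_] := boolP (y \in cell lam Q l x); first by rewrite mul1r.
by rewrite mul0r divr_ge0// ltW.
Qed.

Lemma cell_bounds (Q T : set 'rV[R]_n) a : compact T -> Q = translate T a -> interior Q 0 ->
  exists2 r : R, 0 < r & exists2 r' : R, 0 <= r' & forall (lam : nat) l x y, (0 < lam)%N ->
    (`|y - x| < r / lam%:R ^+ l -> cell lam Q l x y) /\
    (cell lam Q l x y -> `|y - x| <= r' / lam%:R ^+ l).
Proof.
move=> cT QE /nbhs_ballP[r /= r0 rQ].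
have [M [_ HM]] := compact_bounded cT.
exists r => //; exists (`|M| + 1 + `|a|) => [|lam l x y lam0]; first by rewrite !addr_ge0.
have Ll : 0 < (lam%:R ^+ l : R) by rewrite exprn_gt0// ltr0n.
split=> [yr|[z Qz <-]].
  exists (lam%:R ^+ l *: (y - x)); last by rewrite scalerA mulVf ?gt_eqF// scale1r subrK.
  have zr : `|lam%:R ^+ l *: (y - x)| < r.
    by rewrite normrZ gtr0_norm// mulrC -ltr_pdivlMr.
  apply: rQ; split=> // i j; rewrite ord1 /ball/= mxE sub0r normrN.
  exact: le_lt_trans (coord_le_norm _ _) zr.
rewrite addrK normrZ ger0_norm ?invr_ge0 ?(ltW Ll)// mulrC ler_wpM2r ?invr_ge0 ?(ltW Ll)//.
move: Qz; rewrite QE => -[t Tt <-]; apply: (le_trans (ler_normD _ _)); rewrite lerD2r.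
by apply: HM => //; rewrite (le_lt_trans (ler_norm M))// ltrDl.
Qed.

(** The Borel function is cut off where it exceeds the bound of [f]. Since [f] satisfies this bound
    everywhere, the cut only matters where the two functions differ, a null set. *)
Lemma bounded_representative f : lebesgue_measurable f -> bounded_function f ->
  exists g (B : R), [/\ cmeasurable g, forall z, modc (g z) <= B & {ae leb, forall z, f z = g z}].
Proof.
move=> [G [G1 G2 fG]] [B fB]; have mG : cmeasurable G by split.
exists (fun z => if modc (G z) <= B then G z else 0), B; split.
- have mb : measurable_fun setT (fun z => modc (G z) <= B).
    by apply: measurable_fun_ler => //; exact: measurable_modc.
  split.
  + rewrite (_ : (fun _ => _) = fun z => if modc (G z) <= B then complex.Re (G z) else 0).
      exact: measurable_fun_ifT.
    by apply/funext => z; case: ifP.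
  + rewrite (_ : (fun _ => _) = fun z => if modc (G z) <= B then complex.Im (G z) else 0).
      exact: measurable_fun_ifT.
    by apply/funext => z; case: ifP.
- move=> z; case: ifP => // _; rewrite modc0.
  by apply: le_trans (fB 0); exact: modc_ge0.
- by apply: filterS fG => z fz; rewrite -fz fB.
Qed.

Lemma LP_ae_eq (lam : nat) (phi : 'rV[R]_n -> R[i]) l f g : {ae leb, forall z, f z = g z} ->
  LP lam phi l f = LP lam phi l g.
Proof.
move=> fg; apply/funext => y; apply: ae_cintegral.
by apply: filterS fg => z ->.
Qed.

End cells.

Theorem proposition1 (R : realType) (n : nat) (hn : (0 < n)%N)
  (lam : nat) (hlam : (1 < lam)%N)
  (Gamma0 : set 'rV[int]_n) (hGamma0 : complete_residues lam Gamma0)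
  (T : set 'rV[R]_n) (hT : self_affine_tile lam Gamma0 T)
  (Q0 : set 'rV[R]_n) (hQ0 : exists a, Q0 = translate T a)
  (hQ00 : interior Q0 0)
  (phi : 'rV[R]_n -> R[i]) (hphi : LP_function lam phi)
  (s : R) (hs : 0 < s) (k : nat) (hk : s < k.+1%:R)
  (x : 'rV[R]_n) (f : 'rV[R]_n -> R[i])
  (hmf : lebesgue_measurable f) (hbf : bounded_function f) :
  C_at lam k Q0 s f x <->
  exists C : R, forall l : nat,
    {ae lebesgue_rV R n, forall y,
      modc (f y - LP lam phi l f y)
        <= C * (lam%:R ^- l + enorm (x - y)) `^ s}.
Proof.
have lam0 : (0 < lam)%N by exact: ltnW.
have [cT _ _ _ _] := hT; have [a QE] := hQ0.
have [r r0 [r' r'0 cellQ]] := cell_bounds cT QE hQ00.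
have [g [B [mg gB fg]]] := bounded_representative hmf hbf.
have Lm m : 0 < (lam%:R ^+ m : R) by rewrite exprn_gt0// ltr0n.
rewrite C_atP//; split=> [[C C0 HC]|[C HC]].
  have HC' l : exists2 P, (mmeasure mdeg P <= k.+1)%N & {ae lebesgue_rV R n, forall y,
      `|y - x| < r / lam%:R ^+ l -> modc (g y - peval P y) <= C / (lam%:R `^ s) ^+ l}.
    have [P Pk HP] := HC l; exists P => //.
    by apply: filterS2 fg HP => y <- h yr; apply: h; exact: (cellQ lam l x y lam0).1.
  have [C' HC''] := LP_error hn hlam hphi hs mg gB r0 C0 HC'.
  (* A nonnegative constant is wanted, so that the bound grows when the sup norm is replaced by the
     larger Euclidean norm. *)
  exists `|C'| => l; rewrite (LP_ae_eq lam phi l fg).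
  apply: filterS2 fg (HC'' l) => y -> h; apply: (le_trans h).
  apply: (le_trans (ler_wpM2r (powR_ge0 _ _) (ler_norm C'))); apply: ler_wpM2l => //.
  have Lm' : 0 <= (lam%:R ^- l : R) by rewrite invr_ge0 ltW.
  apply: ge0_ler_powR; rewrite ?nnegrE ?addr_ge0 ?enorm_ge0 ?(ltW hs)//.
  by rewrite lerD2l norm_le_enorm.
have HC' l : {ae lebesgue_rV R n, forall y,
    modc (g y - LP lam phi l g y) <= C * (lam%:R ^- l + enorm (x - y)) `^ s}.
  by rewrite -(LP_ae_eq lam phi l fg); apply: filterS2 fg (HC l) => y <-.
have [C' C'0 HC''] := inverse_estimate hn hlam hphi hs hk mg gB r'0 HC'.
exists C' => // l; have [P Pk HP] := HC'' l; exists P => //.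
by apply: filterS2 fg HP => y -> h yr; apply: h; exact: (cellQ lam l x y lam0).2.
Qed.
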